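(* There is a constant $C$, independent of $\varepsilon$, such that for all $S_0,S_1\in B$ and all $\varepsilon\in(0,1]$, the solution $u^\varepsilon\in L^2(\mathbb R^3)$ of the Helmholtz equation $$-i\frac{\alpha_\varepsilon}{\varepsilon}u^\varepsilon+\Delta u^\varepsilon+\frac{1}{\varepsilon^2}u^\varepsilon=\frac1{\varepsilon^3}S_0\Big(\frac x\varepsilon\Big)+\frac1{\varepsilon^3}S_1\Big(\frac{x-q_1}\varepsilon\Big),\qquad x\in\mathbb R^3,$$ satisfies $$\|u^\varepsilon\|_{B^*}\le C\,(\|S_0\|_B+\|S_1\|_B).$$
   Context: Standing setting: $q_1\in\mathbb R^3$, $q_1\ne0$; $\alpha_\varepsilon>0$ for every $\varepsilon\in(0,1]$ and $\alpha_\varepsilon\to0$ as $\varepsilon\to0$ (positivity gives existence and uniqueness of $u^\varepsilon$ in $L^2(\mathbb R^3)$). For $u,f\in L^2_{loc}(\mathbb R^3)$: $\|u\|_{B^*}=\sup_{j\ge-1}\big(2^{-j}\int_{C(j)}|u|^2dx\big)^{1/2}$ and $\|f\|_B=\sum_{j\ge-1}\big(2^{j+1}\int_{C(j)}|f|^2dx\big)^{1/2}$, where $C(j)=\{x\in\mathbb R^3:2^j\le|x|<2^{j+1}\}$ for $j\ge0$ and $C(-1)$ is the unit ball. $B$ is the space of $f$ with $\|f\|_B<\infty$. *)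

(* Defs.v *)
From HB Require Import structures.
From mathcomp Require Export all_boot all_order all_algebra complex.
From mathcomp Require Export all_classical all_reals all_analysis.

Set Implicit Arguments.
Unset Strict Implicit.
Unset Printing Implicit Defensive.

Export Order.TTheory GRing.Theory Num.Theory.
Export numFieldNormedType.Exports.
Export ComplexField.Normc.

Local Open Scope classical_set_scope.
Local Open Scope ring_scope.
Local Open Scope complex_scope.

(* Points of R^3 have type R * R * R. Its library norm is the sup norm, so the
   Euclidean length is defined separately; the topologies agree. Measurability
   uses measurableTypeR, the Borel sigma-algebra carried by lebesgue_measure. *)
Notation mR3 R :=
  (measurableTypeR R * measurableTypeR R * measurableTypeR R)%type.

Definition leb3 (R : realType) : {measure set (mR3 R) -> \bar R} :=
  (@lebesgue_measure R \x @lebesgue_measure R \x @lebesgue_measure R)%E.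

Definition euclid3 (R : realType) (x : R * R * R) : R :=
  Num.sqrt (x.1.1 ^+ 2 + x.1.2 ^+ 2 + x.2 ^+ 2).

(* Borel measurability is no restriction: every class of Lebesgue measurable
   functions modulo a.e. equality has such a representative. *)
Definition measurable_cplx (R : realType) (f : R * R * R -> R[i]) : Prop :=
  measurable_fun [set: mR3 R] (fun x => complex.Re (f x)) /\
  measurable_fun [set: mR3 R] (fun x => complex.Im (f x)).

Definition sqnorm2_on (R : realType) (A : set (R * R * R))
    (f : R * R * R -> R[i]) : \bar R :=
  (\int[@leb3 R]_(x in A) (normc (f x) ^+ 2)%:E)%E.

Definition in_L2 (R : realType) (f : R * R * R -> R[i]) : Prop :=
  measurable_cplx f /\ (sqnorm2_on setT f < +oo)%E.

Definition shell (R : realType) (j : int) : set (R * R * R) :=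
  if j == (-1)%R then [set x | euclid3 x < 1]
  else [set x | 2 ^ j <= euclid3 x < 2 ^ (j + 1)].

(* In both norms the index j >= -1 is written j = k - 1 with k : nat. *)
Definition Bstar_norm (R : realType) (u : R * R * R -> R[i]) : \bar R :=
  ereal_sup (range (fun k : nat => let j : int := k%:Z - 1 in
    sqrte (((2 : R) ^ (- j))%:E * sqnorm2_on (@shell R j) u)%E)).

Definition B_norm (R : realType) (f : R * R * R -> R[i]) : \bar R :=
  (\sum_(0 <= k <oo) let j : int := (k%:Z - 1)%R in
    sqrte (((2 : R) ^ (j + 1))%R%:E * sqnorm2_on (@shell R j) f))%E.

Definition in_B (R : realType) (f : R * R * R -> R[i]) : Prop :=
  measurable_cplx f /\ (B_norm f < +oo)%E.

Definition basis3 (R : realType) (i : 'I_3) : R * R * R :=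
  ((i == 0 :> nat)%:R, (i == 1 :> nat)%:R, (i == 2 :> nat)%:R).

Definition partial (R : realType) (i : 'I_3) (phi : R * R * R -> R) :
    R * R * R -> R :=
  fun x => 'D_(basis3 R i) phi x.

Definition iter_partial (R : realType) (s : seq 'I_3) (phi : R * R * R -> R) :
    R * R * R -> R :=
  foldr (@partial R) phi s.

Definition laplacian (R : realType) (phi : R * R * R -> R) : R * R * R -> R :=
  fun x => \sum_(i < 3) partial i (partial i phi) x.

(* 'D_v is a total operator, hence the explicit derivability clause. *)
Definition smooth3 (R : realType) (phi : R * R * R -> R) : Prop :=
  forall s : seq 'I_3,
    continuous (iter_partial s phi) /\
    forall (i : 'I_3) (x : R * R * R),
      derivable (iter_partial s phi) x (basis3 R i).

Definition test_function (R : realType) (phi : R * R * R -> R) : Prop :=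
  smooth3 phi /\ compact (closure [set x | phi x != 0]).

Definition pairing (R : realType) (u : R * R * R -> R[i])
    (phi : R * R * R -> R) : R[i] :=
  (\int[@leb3 R]_x (complex.Re (u x) * phi x)) +i*
  (\int[@leb3 R]_x (complex.Im (u x) * phi x)).

(* - i (a / e) u + Laplacian u + u / e ^ 2 = f in the sense of distributions;
   real-valued test functions suffice, by linearity over the complex numbers. *)
Definition helmholtz_sol (R : realType) (e a : R)
    (u f : R * R * R -> R[i]) : Prop :=
  forall phi : R * R * R -> R, test_function phi ->
    - 'i%C * (a / e)%:C * pairing u phi + pairing u (laplacian phi)
      + (e ^- 2)%:C * pairing u phi = pairing f phi.

(* Main.v *)
From HB Require Import structures.
Require Import Defs.
From mathcomp Require Import ring lra measurable_realfun.

(** The estimate is proved by the multiplier method, on a mollification of the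
    solution, with the explicit constant 224.

    Put l = 1 / e and m = alpha e / e. Testing the equation against translates of a
    smooth kernel (mollified_helmholtz) gives a pointwise system for the real and
    imaginary parts a, b of the mollified solution,
      Delta a + l^2 a + m b = p,   Delta b + l^2 b - m a = q,
    where a, b and their derivatives are square-integrable. Energy identities
    for it come from divergences of integrable fields, whose integrals vanish
    (integral_partial_eq0).

    If m > l^2, the imaginary energy identity bounds the L2 norm of the solution by
    that of the sources (damped_energy), and the B norm dominates the L2 norm.

    If m <= l^2, the equations are multiplied by y . grad + s, with
    s = (r^2 + |x - c|^2)^(-1/2) and y = s (x - c). The multiplier is bounded, and
    the resulting divergence controls r^2 s^3 / 2 times the energy density
    |grad u|^2 + l^2 |u|^2 (sum_dflux). On the ball of centre c and radius r that
    weight is at least 1 / (7 r). Hence, for every centre c and every r >= e, the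
    energy in the ball is at most 14 r N, where N is the integral of
    (|p| + |q|) (|grad u| + l |u|) (local_energy).

    It remains to bound N. Each source is cut along the dyadic shells of radius
    e 2^k around its own centre. Cauchy-Schwarz on each shell and the local bound for
    that centre yield N <= C e^-1 N^(1/2) (|S0|_B + |S1|_B), the sum over the shells
    being exactly the B norm (two_sources_coupling_le). So N is at most a multiple of
    e^-2 (|S0|_B + |S1|_B)^2. The local bound around the origin with r = 2^k >= 1 >= e
    is then the B* estimate, as l^2 = e^-2 cancels the power of e.

    Finally the mollification is removed: translations are continuous in the mean
    on square-integrable functions (continuous_translation_square_integrable), so
    mollified solutions converge in L2 (mollifier_cvg). *)

Set Implicit Arguments.
Unset Strict Implicit.
Unset Printing Implicit Defensive.

Local Open Scope classical_set_scope.
Local Open Scope ring_scope.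

(** * Lebesgue measure on space *)

(** The product measures carry names of their own, so that their
    sigma-finiteness can be attached to them and the Fubini-Tonelli theorems
    iterate. *)
Definition lebesgue2 (R : realType)
    : set (measurableTypeR R * measurableTypeR R) -> \bar R :=
  (@lebesgue_measure R \x @lebesgue_measure R)%E.
Arguments lebesgue2 : clear implicits.
HB.instance Definition _ (R : realType) := Measure.copy (lebesgue2 R)
  (@lebesgue_measure R \x @lebesgue_measure R)%E.

Lemma bounded_itvT (R : realType) :
  \bigcup_n (`](- n%:R), n%:R]%classic : set R) = setT.
Proof.
apply/seteqP; split => // x _; exists (Num.Def.trunc `|x|).+1 => //=.
rewrite in_itv/=; have := truncnS_gt `|x|.
by rewrite ltr_norml => /andP[-> /ltW ->].
Qed.

Lemma nd_bounded_itv (R : realType) n m : (n <= m)%N ->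
  (`](- n%:R), n%:R]%classic : set R) `<=` `](- m%:R), m%:R].
Proof. by move=> nm; apply: subset_itv; rewrite bnd_simp ?lerN2 ler_nat. Qed.

Lemma lebesgue2_setX (R : realType) (A B : set (measurableTypeR R)) :
  measurable A -> measurable B ->
  lebesgue2 R (A `*` B) = (lebesgue_measure A * lebesgue_measure B)%E.
Proof. exact: product_measure1E. Qed.

Lemma lebesgue_bounded_itv (R : realType) n :
  lebesgue_measure (`](- n%:R), n%:R]%classic : set (measurableTypeR R)) =
  (n%:R + n%:R)%:E.
Proof.
rewrite lebesgue_measure_itv/= lte_fin; case: ifPn => [_|]; first by rewrite -?EFinB opprK.
rewrite -leNgt => h; have := ler0n R n => n0; congr (_%:E); lra.
Qed.

Lemma lebesgue2_sigma_finite (R : realType) : sigma_finite setT (lebesgue2 R).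
Proof.
pose I n : set (measurableTypeR R) := `](- n%:R), n%:R]%classic.
have mI n : measurable (I n) by exact: measurable_itv.
exists (fun n => I n `*` I n).
  apply/seteqP; split => // -[x y] _.
  have [n _ xn] : (\bigcup_n I n) x by rewrite bounded_itvT.
  have [m _ ym] : (\bigcup_n I n) y by rewrite bounded_itvT.
  exists (maxn n m) => //; split => /=.
    exact: nd_bounded_itv (leq_maxl _ _) _ xn.
  exact: nd_bounded_itv (leq_maxr _ _) _ ym.
move=> n; split; first exact: measurableX.
by rewrite lebesgue2_setX// !lebesgue_bounded_itv -EFinM ltry.
Qed.

HB.instance Definition _ (R : realType) :=
  Measure_isSigmaFinite.Build _ _ _ (lebesgue2 R) (@lebesgue2_sigma_finite R).

Definition lebesgue3 (R : realType) : set (mR3 R) -> \bar R :=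
  (lebesgue2 R \x @lebesgue_measure R)%E.
Arguments lebesgue3 : clear implicits.
HB.instance Definition _ (R : realType) := Measure.copy (lebesgue3 R)
  (lebesgue2 R \x @lebesgue_measure R)%E.

Lemma lebesgue3_setX (R : realType)
    (A : set (measurableTypeR R * measurableTypeR R))
    (B : set (measurableTypeR R)) : measurable A -> measurable B ->
  lebesgue3 R (A `*` B) = (lebesgue2 R A * lebesgue_measure B)%E.
Proof. exact: product_measure1E. Qed.

Definition cube (R : realType) (n : nat) : set (mR3 R) :=
  (`](- n%:R), n%:R]%classic `*` `](- n%:R), n%:R]%classic) `*` `](- n%:R), n%:R]%classic.
Arguments cube : clear implicits.

Lemma measurable_cube (R : realType) n : measurable (cube R n).
Proof. by apply: measurableX => //; exact: measurableX. Qed.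

Lemma lebesgue3_cube (R : realType) n : (lebesgue3 R (cube R n) < +oo)%E.
Proof.
rewrite lebesgue3_setX//; last exact: measurableX.
by rewrite lebesgue2_setX// !lebesgue_bounded_itv -!EFinM ltry.
Qed.

Lemma nd_cube (R : realType) n m : (n <= m)%N -> cube R n `<=` cube R m.
Proof.
by move=> nm x [[x1 x2] x3]; split; [split|]; exact: nd_bounded_itv nm _ _.
Qed.

Lemma bigcup_cube (R : realType) : \bigcup_n cube R n = setT.
Proof.
apply/seteqP; split => // -[[x y] z] _.
have [n _ xn] : (\bigcup_n (`](- n%:R), n%:R]%classic : set R)) x by rewrite bounded_itvT.
have [m _ ym] : (\bigcup_n (`](- n%:R), n%:R]%classic : set R)) y by rewrite bounded_itvT.
have [p _ zp] : (\bigcup_n (`](- n%:R), n%:R]%classic : set R)) z by rewrite bounded_itvT.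
exists (maxn (maxn n m) p) => //; split; [split|] => /=.
- by apply: nd_bounded_itv xn; rewrite !leq_max leqnn.
- by apply: nd_bounded_itv ym; rewrite !leq_max leqnn orbT.
- by apply: nd_bounded_itv zp; rewrite leq_max leqnn orbT.
Qed.

Lemma lebesgue3_sigma_finite (R : realType) : sigma_finite setT (lebesgue3 R).
Proof.
exists (cube R) => [|n]; first by rewrite bigcup_cube.
by split; [exact: measurable_cube|exact: lebesgue3_cube].
Qed.

HB.instance Definition _ (R : realType) :=
  Measure_isSigmaFinite.Build _ _ _ (lebesgue3 R) (@lebesgue3_sigma_finite R).

Section tonelli.
Context {R : realType}.
Local Notation leb1 := (@lebesgue_measure R).

Lemma lebesgue3_tonelli (k : mR3 R -> \bar R) :
  measurable_fun setT k -> (forall x, 0 <= k x)%E ->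
  (\int[lebesgue3 R]_x k x = \int[leb1]_y \int[lebesgue2 R]_x k (x, y))%E.
Proof. by move=> mk k0; exact: (fubini_tonelli2 _ mk k0). Qed.

Lemma lebesgue2_tonelli (k : measurableTypeR R * measurableTypeR R -> \bar R) :
  measurable_fun setT k -> (forall x, 0 <= k x)%E ->
  (\int[lebesgue2 R]_x k x = \int[leb1]_x \int[leb1]_y k (x, y))%E.
Proof. by move=> mk k0; exact: (fubini_tonelli1 _ mk k0). Qed.
End tonelli.

(** * Affine changes of variables *)

Definition affine3 (R : realType) (s : R) (c x : R * R * R) : R * R * R :=
  (c.1.1 + s * x.1.1, c.1.2 + s * x.1.2, c.2 + s * x.2).

Section change_of_variables.
Context {R : realType}.
Local Notation mu1 := (@lebesgue_measure R).

Lemma measurable_affine1 (s c : R) :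
  measurable_fun setT (fun x : measurableTypeR R => c + s * x : measurableTypeR R).
Proof. by apply: measurable_funD => //; apply: measurable_funM. Qed.

(** A measure is Lebesgue measure as soon as it gives half-open intervals their
    length, and s times the image measure of an affine map of slope s does. *)
Lemma ge0_integral_affine1_pos (s c : R) (g : R -> \bar R) : 0 < s ->
  measurable_fun [set: measurableTypeR R] g -> (forall x, 0 <= g x)%E ->
  (\int[mu1]_x g (c + s * x)%R = (s^-1)%:E * \int[mu1]_x g x)%E.
Proof.
move=> s0 mg g0.
pose phi := fun x : measurableTypeR R => c + s * x : measurableTypeR R.
have mphi : measurable_fun setT phi := measurable_affine1 s c.
pose P : {measure set (measurableTypeR R) -> \bar R} :=
  measure_function_pushforward__canonical__measure_function_Measure mu1 mphi.
pose m : {measure set (measurableTypeR R) -> \bar R} := mscale (NngNum (ltW s0)) P.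
have mE A : measurable A -> mu1 A = m A.
  move=> mA; apply: lebesgue_measure_unique => //= _ [[a b]] _ <-.
  rewrite /m /mscale/= /P/= /pushforward.
  have -> : phi @^-1` `]a, b]%classic = `](a - c) / s, (b - c) / s]%classic.
    apply/seteqP; split => x; rewrite /phi /= !in_itv/=.
      by move=> /andP[? ?]; rewrite ltr_pdivrMr// ler_pdivlMr//; apply/andP; split; lra.
    by rewrite ltr_pdivrMr// ler_pdivlMr// => /andP[? ?]; apply/andP; split; lra.
  rewrite !lebesgue_measure_itv/= !lte_fin ltr_pM2r ?invr_gt0// ltrD2r.
  case: ifPn => _; last by rewrite mule0.
  by rewrite -!EFinD -EFinM; congr (_%:E); field; rewrite gt_eqF.
have -> : (\int[mu1]_x g x = \int[m]_x g x)%E.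
  by apply: eq_measure_integral => A mA _; exact: mE.
rewrite ge0_integral_mscale// ge0_integral_pushforward//.
  by rewrite muleA -EFinM mulVf ?gt_eqF// mul1e.
Qed.

Lemma ge0_integral_opp1 (g : R -> \bar R) :
  measurable_fun [set: measurableTypeR R] g -> (forall x, 0 <= g x)%E ->
  (\int[mu1]_x g (- x)%R = \int[mu1]_x g x)%E.
Proof.
move=> mg g0.
have mphi : measurable_fun setT (-%R : measurableTypeR R -> measurableTypeR R).
  exact: oppr_measurable.
have -> : (\int[mu1]_x g x = \int[pushforward mu1 (-%R : measurableTypeR R -> measurableTypeR R)]_x g x)%E.
  by apply: eq_measure_integral => A mA _; apply/esym; exact: lebesgue_measureN.
by rewrite ge0_integral_pushforward.
Qed.

Lemma ge0_integral_affine1 (s c : R) (g : R -> \bar R) : s != 0 ->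
  measurable_fun [set: measurableTypeR R] g -> (forall x, 0 <= g x)%E ->
  (\int[mu1]_x g (c + s * x)%R = (`|s|^-1)%:E * \int[mu1]_x g x)%E.
Proof.
move=> s0 mg g0; have [sp|sn|s00] := ltgtP 0 s; last by rewrite -s00 eqxx in s0.
  by rewrite gtr0_norm// ge0_integral_affine1_pos.
rewrite ltr0_norm// -(@ge0_integral_affine1_pos _ c) ?oppr_gt0//.
rewrite -(@ge0_integral_opp1 (fun x => g (c + s * x)%R)).
- by apply: eq_integral => x _; rewrite mulrN mulNr.
- by apply: measurableT_comp => //; exact: measurable_affine1.
- by move=> x; exact: g0.
Qed.

Lemma measurable_affine3 (s : R) (c : R * R * R) :
  measurable_fun setT (affine3 s c : mR3 R -> mR3 R).
Proof.
have m i (f : mR3 R -> measurableTypeR R) : measurable_fun setT f ->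
    measurable_fun setT (fun x => i + s * f x : measurableTypeR R).
  move=> mf; exact: (measurableT_comp (measurable_affine1 s i) mf).
apply/measurable_fun_pairP; split; last by apply: m; exact: measurable_snd.
apply/measurable_fun_pairP; split; apply: m.
  by apply: measurableT_comp; exact: measurable_fst.
by apply: measurableT_comp; [exact: measurable_snd|exact: measurable_fst].
Qed.

(** Tonelli's theorem reduces the substitution to one coordinate at a time. *)
Lemma ge0_integral_affine3 (s : R) (c : R * R * R) (h : mR3 R -> \bar R) :
  s != 0 -> measurable_fun setT h -> (forall x, 0 <= h x)%E ->
  (\int[lebesgue3 R]_x h (affine3 s c x) = (`|s| ^- 3)%:E * \int[lebesgue3 R]_x h x)%E.
Proof.
move=> s0 mh h0.
have l3 k : measurable_fun setT k -> (forall x, 0 <= k x)%E ->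
    (\int[lebesgue3 R]_x k x =
     \int[mu1]_x3 \int[mu1]_x1 \int[mu1]_x2 k (x1, x2, x3))%E.
  move=> mk k0; rewrite lebesgue3_tonelli//; apply: eq_integral => x3 _.
  rewrite (@lebesgue2_tonelli _ (fun y => k (y, x3)))//.
  by apply: measurableT_comp => //; exact: measurable_pair2.
have E1 := l3 _ (measurableT_comp mh (measurable_affine3 s c)) (fun x => h0 _).
rewrite (l3 _ mh h0); apply: (eq_trans E1) => /= {E1}.
have inv0 : (0 <= (`|s|^-1)%:E)%E by rewrite lee_fin invr_ge0.
have m12 x3 : measurable_fun setT (fun y : measurableTypeR R * measurableTypeR R => h (y, x3)).
  by apply: measurableT_comp => //; exact: measurable_pair2.
have m2 x1 x3 : measurable_fun setT (fun y : measurableTypeR R => h (x1, y, x3)).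
  by have := measurableT_comp (m12 x3) (measurable_pair1 x1).
pose h1 (x1 x3 : R) := (\int[mu1]_x2 h (x1, x2, x3))%E.
pose h2 (x3 : R) := (\int[mu1]_x1 h1 x1 x3)%E.
have h1_0 x1 x3 : (0 <= h1 x1 x3)%E by apply: integral_ge0.
have h2_0 x3 : (0 <= h2 x3)%E by apply: integral_ge0.
have mh1 x3 : measurable_fun setT (h1 ^~ x3).
  exact: (@measurable_fun_fubini_tonelli_F _ _ _ _ _ mu1 (fun y => h (y, x3))).
have mh2 : measurable_fun setT h2.
  have -> : h2 = fubini_G (lebesgue2 R) h.
    by apply/funext => x3; rewrite /fubini_G lebesgue2_tonelli.
  exact: measurable_fun_fubini_tonelli_G.
transitivity (\int[mu1]_x3 \int[mu1]_x1
    ((`|s|^-1)%:E * h1 (c.1.1 + s * x1)%R (c.2 + s * x3)%R))%E.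
  apply: eq_integral => x3 _; apply: eq_integral => x1 _.
  by rewrite -(ge0_integral_affine1 c.1.2 s0).
transitivity (\int[mu1]_x3 ((`|s|^-1)%:E * ((`|s|^-1)%:E * h2 (c.2 + s * x3)%R)))%E.
  apply: eq_integral => x3 _; rewrite ge0_integralZl//; last first.
    exact: (measurableT_comp (mh1 _) (measurable_affine1 s _)).
  by rewrite (ge0_integral_affine1 c.1.1 s0 (mh1 _)).
rewrite ge0_integralZl//; last 2 first.
- by apply: measurable_funeM; exact: (measurableT_comp mh2 (measurable_affine1 s _)).
- by move=> x _; rewrite mule_ge0.
rewrite ge0_integralZl//; last first.
  exact: (measurableT_comp mh2 (measurable_affine1 s _)).
rewrite (ge0_integral_affine1 c.2 s0 mh2)// !muleA -!EFinM; congr (_%:E * _)%E.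
by rewrite exprSr expr2 !invfM.
Qed.

End change_of_variables.

(** * Bounds on integrals and the Cauchy-Schwarz inequality *)

Section linear_bounds_of_integrals.
Context d (T : measurableType d) (R : realType).
Variables (m : {measure set T -> \bar R}) (D : set T).
Hypothesis mD : measurable D.
Implicit Types f g : T -> R.

Lemma measurable_sqr f : measurable_fun D f -> measurable_fun D (fun x => (f x ^+ 2)%:E).
Proof. by move=> mf; apply/measurable_EFinP; exact: measurable_funX. Qed.

Lemma ge0_le_integral_lin3 f g1 g2 g3 (k1 k2 k3 : R) : 0 <= k1 -> 0 <= k2 -> 0 <= k3 ->
  measurable_fun D f -> measurable_fun D g1 -> measurable_fun D g2 -> measurable_fun D g3 ->
  (forall x, 0 <= f x) -> (forall x, 0 <= g1 x) -> (forall x, 0 <= g2 x) -> (forall x, 0 <= g3 x) ->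
  (forall x, D x -> f x <= k1 * g1 x + k2 * g2 x + k3 * g3 x) ->
  (\int[m]_(x in D) (f x)%:E <= k1%:E * \int[m]_(x in D) (g1 x)%:E
     + k2%:E * \int[m]_(x in D) (g2 x)%:E + k3%:E * \int[m]_(x in D) (g3 x)%:E)%E.
Proof.
move=> k10 k20 k30 mf mg1 mg2 mg3 f0 g10 g20 g30 fg.
have mk k g : measurable_fun D g -> measurable_fun D (fun x => k%:E * (g x)%:E)%E.
  by move=> mg; apply: measurable_funeM; exact/measurable_EFinP.
have k0 k g x : 0 <= k -> (forall x, 0 <= g x) -> (0 <= k%:E * (g x)%:E)%E.
  by move=> ? ?; rewrite -EFinM lee_fin mulr_ge0.
have Z k g : 0 <= k -> measurable_fun D g -> (forall x, 0 <= g x) ->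
    (k%:E * \int[m]_(x in D) (g x)%:E = \int[m]_(x in D) (k%:E * (g x)%:E))%E.
  by move=> ? ? g0; rewrite ge0_integralZl//; [exact/measurable_EFinP|move=> x _; rewrite lee_fin].
have D12 : measurable_fun D (fun x => k1%:E * (g1 x)%:E + k2%:E * (g2 x)%:E)%E.
  by apply: emeasurable_funD; exact: mk.
rewrite !Z// -!ge0_integralD//; try exact: mk;
  try by move=> x _; rewrite ?adde_ge0// k0.
apply: ge0_le_integral => //; try (by move=> x _; rewrite lee_fin);
  try exact/measurable_EFinP.
by apply: emeasurable_funD => //; exact: mk.
Qed.

Lemma ge0_le_integral_lin2 f g1 g2 (k1 k2 : R) : 0 <= k1 -> 0 <= k2 ->
  measurable_fun D f -> measurable_fun D g1 -> measurable_fun D g2 ->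
  (forall x, 0 <= f x) -> (forall x, 0 <= g1 x) -> (forall x, 0 <= g2 x) ->
  (forall x, D x -> f x <= k1 * g1 x + k2 * g2 x) ->
  (\int[m]_(x in D) (f x)%:E <= k1%:E * \int[m]_(x in D) (g1 x)%:E
     + k2%:E * \int[m]_(x in D) (g2 x)%:E)%E.
Proof.
move=> k10 k20 mf mg1 mg2 f0 g10 g20 fg.
have := @ge0_le_integral_lin3 f g1 g2 (cst 0) k1 k2 0 k10 k20 (lexx 0) mf mg1 mg2
  (measurable_cst _) f0 g10 g20 (fun=> lexx 0).
by rewrite mul0e adde0; apply => x Dx; rewrite mul0r addr0 fg.
Qed.

Lemma ge0_le_integral_lin1 f g (k : R) : 0 <= k ->
  measurable_fun D f -> measurable_fun D g -> (forall x, 0 <= f x) -> (forall x, 0 <= g x) ->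
  (forall x, D x -> f x <= k * g x) ->
  (\int[m]_(x in D) (f x)%:E <= k%:E * \int[m]_(x in D) (g x)%:E)%E.
Proof.
move=> k0 mf mg f0 g0 fg.
have := @ge0_le_integral_lin2 f g (cst 0) k 0 k0 (lexx 0) mf mg (measurable_cst _) f0 g0 (fun=> lexx 0).
by rewrite mul0e adde0; apply => x Dx; rewrite mul0r addr0 fg.
Qed.

End linear_bounds_of_integrals.

Section cauchy_schwarz.
Context d (T : measurableType d) (R : realType).
Variable m : {measure set T -> \bar R}.
Implicit Types f g k : T -> R.

(** The bound is the minimum over t of the right-hand side of the hypothesis. The
    minimum is not attained when a or b vanishes, and a finite t is then chosen
    that already gives a contradiction. *)
Lemma le_geometric_mean (x a b : R) : 0 <= a -> 0 <= b ->
  (forall t, 0 < t -> 2 * x <= t * a ^+ 2 + t^-1 * b ^+ 2) -> x <= a * b.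
Proof.
move=> a0 b0 h; rewrite leNgt; apply/negP => abx.
have x0 : 0 < x by rewrite (le_lt_trans _ abx)// mulr_ge0.
have [a_eq0|a_neq0] := eqVneq a 0.
  have /h : 0 < (b ^+ 2 + 1) / x by rewrite divr_gt0// ltr_wpDl// sqr_ge0.
  rewrite a_eq0 expr0n/= mulr0 add0r invf_div.
  have b2 : 0 <= b ^+ 2 := sqr_ge0 b.
  rewrite mulrAC ler_pdivlMr; last lra.
  by nra.
have [b_eq0|b_neq0] := eqVneq b 0.
  have a2 : 0 < a ^+ 2 by rewrite exprn_gt0// lt0r a_neq0.
  have /h : 0 < x / a ^+ 2 by rewrite divr_gt0.
  by rewrite b_eq0 expr0n/= mulr0 addr0 divfK ?gt_eqF//; lra.
have a_gt0 : 0 < a by rewrite lt0r a_neq0.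
have b_gt0 : 0 < b by rewrite lt0r b_neq0.
have /h : 0 < b / a by rewrite divr_gt0.
have -> : b / a * a ^+ 2 + (b / a)^-1 * b ^+ 2 = 2 * (a * b).
  by field; rewrite a_neq0.
by lra.
Qed.

Lemma cauchy_schwarz f g (a b : R) : 0 <= a -> 0 <= b ->
  measurable_fun setT f -> measurable_fun setT g ->
  (\int[m]_x (f x ^+ 2)%:E <= (a ^+ 2)%:E)%E ->
  (\int[m]_x (g x ^+ 2)%:E <= (b ^+ 2)%:E)%E ->
  (\int[m]_x `|f x * g x|%:E <= (a * b)%:E)%E.
Proof.
move=> a0 b0 mf mg fa gb.
have mfg : measurable_fun setT (fun x => `|f x * g x|).
  by apply: measurableT_comp => //; exact: measurable_funM.
have key t : 0 < t -> (2%:E * \int[m]_x `|f x * g x|%:E <=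
    (t * a ^+ 2 + t^-1 * b ^+ 2)%:E)%E.
  move=> t0; rewrite -ge0_integralZl//; last by apply/measurable_EFinP.
  have t'0 : 0 <= t^-1 by rewrite invr_ge0 ltW.
  apply: (@le_trans _ _ (t%:E * \int[m]_x (f x ^+ 2)%:E + t^-1%:E * \int[m]_x (g x ^+ 2)%:E)%E).
    apply: (@ge0_le_integral_lin2 _ _ _ m _ measurableT (fun x => 2 * `|f x * g x|)
      (fun x => f x ^+ 2) (fun x => g x ^+ 2)).
    - exact: ltW.
    - by [].
    - exact: measurable_funM.
    - exact: measurable_funX.
    - exact: measurable_funX.
    - by move=> x; rewrite mulr_ge0.
    - by move=> x; exact: sqr_ge0.
    - by move=> x; exact: sqr_ge0.
    move=> x _; rewrite normrM -(real_normK (num_real (f x))) -(real_normK (num_real (g x))).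
    rewrite -subr_ge0 [leRHS](_ : _ = t^-1 * (t * `|f x| - `|g x|) ^+ 2).
      by rewrite mulr_ge0 ?sqr_ge0.
    by field; rewrite gt_eqF.
  by rewrite EFinD !EFinM; apply: leeD; apply: lee_wpmul2l; rewrite ?lee_fin ?(ltW t0).
have fin : (\int[m]_x `|f x * g x|%:E)%E \is a fin_num.
  rewrite ge0_fin_numE ?integral_ge0// ltNge leye_eq; apply/negP => /eqP E.
  have := key 1 ltr01; rewrite E mulry gtr0_sg// mul1e leNgt.
  by rewrite ltry.
rewrite -(fineK fin) lee_fin; apply: le_geometric_mean => // t t0.
by rewrite -lee_fin EFinM fineK// key.
Qed.

(** Cauchy-Schwarz for the measure of density k, whose mass is at most K. *)
Lemma le_sqr_integral_weighted f k (K : R) : 0 < K ->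
  measurable_fun setT f -> measurable_fun setT k -> (forall x, 0 <= k x) ->
  (\int[m]_x (k x)%:E <= K%:E)%E ->
  (((\int[m]_x (f x * k x)) ^+ 2)%:E <= K%:E * \int[m]_x (f x ^+ 2 * k x)%:E)%E.
Proof.
move=> K0 mf mk k0 hK.
set I2 := (\int[m]_x (f x ^+ 2 * k x)%:E)%E.
have I2_0 : (0 <= I2)%E.
  by apply: integral_ge0 => x _; rewrite lee_fin mulr_ge0// sqr_ge0.
have [I2y|I2y] := eqVneq I2 +oo%E.
  by rewrite I2y gt0_muley ?lte_fin// leey.
have I2f : I2 \is a fin_num by rewrite ge0_fin_numE// lt_neqAle I2y leey.
pose s x := Num.sqrt (k x).
have ms : measurable_fun setT s.
  by apply: measurableT_comp => //; exact: (continuous_measurable_fun (@sqrt_continuous R)).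
have ss x : s x ^+ 2 = k x by rewrite sqr_sqrtr.
have b2 : (Num.sqrt (fine I2)) ^+ 2 = fine I2 by rewrite sqr_sqrtr// fine_ge0.
have := @cauchy_schwarz (fun x => f x * s x) s (Num.sqrt (fine I2)) (Num.sqrt K)
  (sqrtr_ge0 _) (sqrtr_ge0 _) (measurable_funM mf ms) ms.
have -> : (\int[m]_x ((f x * s x) ^+ 2)%:E)%E = I2.
  by apply: eq_integral => x _; rewrite exprMn ss.
under eq_integral do rewrite ss.
rewrite b2 fineK// sqr_sqrtr ?(ltW K0)// => /(_ (lexx _) hK).
under eq_integral do rewrite -mulrA -expr2 ss.
move=> h.
have mfk : measurable_fun setT (fun x => f x * k x) by exact: measurable_funM.
have ifk : m.-integrable setT (EFin \o (fun x => f x * k x)).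
  apply/integrableP; split; first exact/measurable_EFinP.
  by apply: le_lt_trans h _; rewrite ltry.
rewrite -[I2]fineK// -EFinM lee_fin -real_normK ?num_real//.
have : `|\int[m]_x (f x * k x)| <= Num.sqrt (fine I2) * Num.sqrt K.
  apply: le_trans (le_normr_Rintegral measurableT ifk) _.
  rewrite -lee_fin /Rintegral fineK//.
  rewrite ge0_fin_numE ?integral_ge0//; apply: le_lt_trans h _; exact: ltry.
move=> /(lerXn2r 2)-/(_ _ _)/le_trans; apply; rewrite ?nnegrE ?mulr_ge0//.
by rewrite exprMn b2 (sqr_sqrtr (ltW K0)) mulrC.
Qed.

(** Every energy estimate is closed this way: D is a divergence, P the quantity to
    be bounded and H the contribution of the sources, whose integral is allowed
    to be infinite. *)
Lemma integral_le_of_null_divergence (P H D : T -> R) :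
  measurable_fun setT P -> measurable_fun setT H ->
  m.-integrable setT (EFin \o D) -> (\int[m]_x (D x)%:E = 0)%E ->
  (forall x, 0 <= P x) -> (forall x, P x <= D x + H x) -> (forall x, 0 <= H x) ->
  (\int[m]_x (P x)%:E <= \int[m]_x (H x)%:E)%E.
Proof.
move=> mP mH iD D0 P0 PDH H0.
have [->|Hy] := eqVneq (\int[m]_x (H x)%:E)%E +oo%E; first by rewrite leey.
have iH : m.-integrable setT (EFin \o H).
  apply/integrableP; split; first exact/measurable_EFinP.
  under eq_integral do rewrite /= ger0_norm//.
  by rewrite lt_neqAle Hy leey.
have iDH : m.-integrable setT (fun x => (D x)%:E + (H x)%:E)%E by apply: integrableD.
rewrite -[leRHS]add0e -D0 -integralD//=.
apply: le_integral => //; last by move=> x _; rewrite -EFinD lee_fin.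
apply: le_integrable iDH => //; first exact/measurable_EFinP.
move=> x _; rewrite /= lee_fin !ger0_norm//.
exact: le_trans (P0 x) (PDH x).
Qed.

End cauchy_schwarz.

(** * Smooth functions of one variable *)

Section smooth_functions_of_one_variable.
Context {R : realType}.
Implicit Types f g : R -> R.

Fixpoint differentiable_upto (N : nat) (f : R -> R) : Prop :=
  if N is N'.+1 then
    (forall x : R, derivable f x 1) /\ differentiable_upto N' f^`()%classic
  else True.

Definition smooth1 f := forall N, differentiable_upto N f.

Lemma differentiable_uptoW N f :
  differentiable_upto N.+1 f -> differentiable_upto N f.
Proof. by elim: N f => // N ih f [df]; split => //; exact: ih. Qed.

Lemma derive1_is_derive f (df : R -> R) : (forall x : R, is_derive x 1 f (df x)) ->
  (forall x : R, derivable f x 1) /\ f^`()%classic = df.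
Proof.
move=> fE; split => [x|]; first by have [] := fE x.
by apply/funext => x; rewrite derive1E derive_val.
Qed.

Lemma is_derive1_derivable f : (forall x : R, derivable f x 1) ->
  forall x : R, is_derive x 1 f (f^`()%classic x).
Proof. by move=> h x; rewrite derive1E; exact: derivableP. Qed.

Lemma differentiable_upto_lin N f g (a b : R) : differentiable_upto N f ->
  differentiable_upto N g -> differentiable_upto N (fun x => a * f x + b * g x).
Proof.
elim: N f g => //= N ih f g [df ff] [dg gg].
have := @derive1_is_derive (fun x => a * f x + b * g x)
  (fun x => a * f^`()%classic x + b * g^`()%classic x).
case => [x|dd ->].
  have := is_derive1_derivable df x; have := is_derive1_derivable dg x => Hg Hf.
  by apply: is_derive_eq; rewrite /GRing.scale/=; ring.
by split => //; exact: ih.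
Qed.

Lemma differentiable_upto_mul N f g : differentiable_upto N f ->
  differentiable_upto N g -> differentiable_upto N (fun x => f x * g x).
Proof.
elim: N f g => //= N ih f g [df ff] [dg gg].
have := @derive1_is_derive (fun x => f x * g x)
  (fun x => 1 * (f^`()%classic x * g x) + 1 * (f x * g^`()%classic x)).
case => [x|dd ->].
  have := is_derive1_derivable df x; have := is_derive1_derivable dg x => Hg Hf.
  by apply: is_derive_eq; rewrite /GRing.scale/=; ring.
split => //; apply: differentiable_upto_lin; apply: ih => //.
  by apply: differentiable_uptoW; split.
by apply: differentiable_uptoW; split.
Qed.

Lemma differentiable_upto_affine N f (c s : R) : differentiable_upto N f ->
  differentiable_upto N (fun x => f (c + s * x)).
Proof.
elim: N f => //= N ih f [df ff].
have := @derive1_is_derive (fun x => f (c + s * x))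
  (fun x => s * f^`()%classic (c + s * x) + 0 * f^`()%classic (c + s * x)).
case => [x|dd ->].
  have Hf := is_derive1_derivable df (c + s * x).
  have Hg : is_derive x 1 (fun x => c + s * x) s.
    by apply: is_derive_eq; rewrite /GRing.scale/=; ring.
  rewrite mul0r addr0 mulrC.
  exact: (@is_derive1_comp _ f (fun y => c + s * y) x _ _ Hf Hg).
by split => //; apply: differentiable_upto_lin; apply: ih.
Qed.

Lemma smooth1_derivable f : smooth1 f -> forall x : R, derivable f x 1.
Proof. by move=> /(_ 1%N)[]. Qed.

Lemma smooth1_derive f : smooth1 f -> smooth1 f^`()%classic.
Proof. by move=> sf N; have [] := sf N.+1. Qed.

Lemma smooth1_is_derive f : smooth1 f ->
  forall x : R, is_derive x 1 f (f^`()%classic x).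
Proof. by move=> /smooth1_derivable; exact: is_derive1_derivable. Qed.

Lemma smooth1_continuous f : smooth1 f -> continuous f.
Proof.
move=> sf x; apply: differentiable_continuous.
by apply/derivable1_diffP; exact: smooth1_derivable.
Qed.

Lemma smooth1_measurable f : smooth1 f ->
  measurable_fun [set: measurableTypeR R] (f : measurableTypeR R -> measurableTypeR R).
Proof. by move=> /smooth1_continuous; exact: continuous_measurable_fun. Qed.

(** The exponent n makes the family stable under differentiation, so that
    smoothness of all its members follows from one derivative computation. *)
Definition flat (n : nat) (t : R) : R :=
  if 0 < t then (t^-1) ^+ n * expR (- t^-1) else 0.

(** A quadratic bound is what makes the derivative at the origin exist and
    vanish; it comes from the term of order n + 2 of the exponential series. *)
Lemma flat_le_sqr n t : `|flat n t| <= (n.+2)`!%:R * t ^+ 2.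
Proof.
rewrite /flat; case: ifPn => t0; last by rewrite normr0 mulr_ge0// sqr_ge0.
have y0 : 0 < t^-1 by rewrite invr_gt0.
rewrite ger0_norm; last by rewrite mulr_ge0 ?expR_ge0// exprn_ge0// ltW.
have := @expR_ge1Dxn R (t^-1) n.+1 (ltW y0) => h.
have f0 : 0 < (n.+2)`!%:R :> R by rewrite ltr0n fact_gt0.
have {h} : t^-1 ^+ n.+2 <= (n.+2)`!%:R * expR t^-1.
  by rewrite mulrC -ler_pdivrMr//; lra.
rewrite expRN -ler_pdivrMr ?expR_gt0// => h.
rewrite -[_ ^+ n]mulr1 -[X in _ * X * _](@mulVf _ (t ^+ 2)) ?expf_neq0 ?gt_eqF//.
by rewrite -exprVn mulrA -exprD addn2 mulrAC ler_wpM2r ?sqr_ge0.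
Qed.

Lemma flat_is_derive n (t : R) :
  is_derive t 1 (flat n) (- n%:R * flat n.+1 t + 1 * flat n.+2 t).
Proof.
have [t0|t0|<-] := ltgtP 0 t.
- have nr : \near t, (t^-1) ^+ n * expR (- t^-1) = flat n t.
    near=> s; rewrite /flat ifT//; near: s; exact: lt_nbhsr.
  apply: (near_eq_is_derive nr); rewrite /flat t0.
  have tn0 : t != 0 by rewrite gt_eqF.
  have HV : is_derive t 1 (fun s : R => s^-1) (- t ^- 2 *: 1) by exact: is_deriveV.
  have HX : is_derive t 1 (fun s : R => s^-1 ^+ n)
      ((n%:R * t^-1 ^+ n.-1) *: (- t ^- 2 *: 1)).
    by have := @is_deriveX _ _ (fun s : R => s^-1) n _ _ _ HV; rewrite exprfctE.
  have HE : is_derive t 1 (fun s : R => expR (- s^-1)) (expR (- t^-1) * - (- t ^- 2 *: 1)).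
    exact: (@is_derive1_comp _ expR (fun s : R => - s^-1) t _ _
      (is_derive_expR _) (is_deriveN HV)).
  apply: (is_derive_eq (is_deriveM HX HE)); rewrite /GRing.scale/=.
  case: n {nr HX} => [|n]; first by rewrite !mul0r !expr0; field.
  by rewrite /= !exprS; field.
- have nr : \near t, cst 0 t = flat n t.
    near=> s; rewrite /flat ifF//; apply/negbTE; rewrite -leNgt; apply/ltW.
    by near: s; exact: lt_nbhsl.
  apply: (near_eq_is_derive nr); rewrite /flat ltNge (ltW t0)/=.
  by apply: is_derive_eq; rewrite !mulr0 addr0.
- have f00 k : flat k 0 = 0 by rewrite /flat ltxx.
  rewrite !f00 !mulr0 addr0.
  have H : h^-1 *: ((flat n \o shift 0) (h *: 1) - flat n 0) @[h --> 0^'] --> 0.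
    apply/cvgr0Pnorm_le => e e0.
    near=> h; rewrite /= f00 subr0 addr0 normrM normfV [h *: 1]mulr1.
    have h0 : 0 < `|h| by rewrite normr_gt0; near: h; exact: nbhs_dnbhs_neq.
    rewrite mulrC ler_pdivrMr//; apply: le_trans (flat_le_sqr n h) _.
    rewrite -real_normK ?num_real// expr2 mulrA ler_wpM2r//.
    have f0 : 0 < (n.+2)`!%:R :> R by rewrite ltr0n fact_gt0.
    rewrite mulrC -ler_pdivlMr//; near: h.
    apply: dnbhs0_le; rewrite divr_gt0//.
  apply: DeriveDef; first by apply/cvg_ex; exists 0.
  by apply/cvg_lim.
Unshelve. all: by end_near. Qed.

Lemma flat_smooth n : smooth1 (flat n).
Proof.
move=> N; elim: N n => //= N ih n.
have [d ->] := derive1_is_derive (flat_is_derive n).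
by split => //; exact: differentiable_upto_lin.
Qed.

End smooth_functions_of_one_variable.

(** * Coordinates and tensor-product kernels *)

Section coordinates.
Context {R : realType}.

Definition coord (j : 'I_3) (z : R * R * R) : R :=
  if j == 0 :> nat then z.1.1 else if j == 1 :> nat then z.1.2 else z.2.

Lemma coordD j (x y : R * R * R) : coord j (x + y) = coord j x + coord j y.
Proof. by rewrite /coord; case: ifP => // _; case: ifP. Qed.

Lemma coordN j (x : R * R * R) : coord j (- x) = - coord j x.
Proof. by rewrite /coord; case: ifP => // _; case: ifP. Qed.

Lemma coordB j (x y : R * R * R) : coord j (x - y) = coord j x - coord j y.
Proof. by rewrite coordD coordN. Qed.

Lemma coordZ j (a : R) (x : R * R * R) : coord j (a *: x) = a * coord j x.
Proof. by rewrite /coord; case: ifP => // _; case: ifP. Qed.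

Lemma coord_basis i j : coord j (@basis3 R i) = (i == j)%:R.
Proof. by case: i j => -[|[|[|]]]// ? [[|[|[|]]]//]. Qed.

Lemma measurable_coord j : measurable_fun setT (coord j : mR3 R -> measurableTypeR R).
Proof.
case: j => [[|[|[|//]]] ?]; rewrite /coord/=.
- exact: (measurableT_comp measurable_fst measurable_fst).
- exact: (measurableT_comp measurable_snd measurable_fst).
- exact: measurable_snd.
Qed.

Lemma ord3P (j : 'I_3) : [\/ j = ord0, j = 1 | j = ord_max].
Proof.
by case: j => [[|[|[|//]]] ?]; [apply: Or31|apply: Or32|apply: Or33]; exact/val_inj.
Qed.

Lemma measurable_fun_coord d (T : measurableType d) (F : T -> mR3 R) :
  (forall j, measurable_fun setT (fun z => coord j (F z) : measurableTypeR R)) ->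
  measurable_fun setT F.
Proof.
move=> m; apply/measurable_fun_pairP; split; [apply/measurable_fun_pairP; split|].
- exact: (m ord0).
- exact: (m 1).
- exact: (m ord_max).
Qed.

Definition ball3 (c : R * R * R) (r : R) : set (mR3 R) :=
  [set x | \sum_(j < 3) (coord j x - coord j c) ^+ 2 < r ^+ 2].

Lemma measurable_ball3 c r : measurable (ball3 c r).
Proof.
rewrite -[X in measurable X]setTI.
have mf : measurable_fun setT (fun x : mR3 R => \sum_(j < 3) (coord j x - coord j c) ^+ 2 < r ^+ 2).
  apply: measurable_fun_ltr => //; apply: measurable_sum => j; apply: measurable_funX.
  by apply: measurable_funB => //; exact: measurable_coord.
by have := mf measurableT [set true] I; rewrite preimage_true.
Qed.

Lemma continuous_coord j : continuous (coord j : R * R * R -> R).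
Proof.
case: j => [[|[|[|//]]] ?] x; rewrite /coord/=.
- by apply: (@continuous_comp _ _ _ fst fst); exact: cvg_fst.
- by apply: (@continuous_comp _ _ _ fst snd); [exact: cvg_fst|exact: cvg_snd].
- exact: cvg_snd.
Qed.

(** The right-hand side is the directional derivative of the distributional
    formulation; the left-hand side is amenable to one-variable calculus. *)
Lemma is_derive_line (F : R * R * R -> R) x i (df : R) :
  is_derive (0 : R) 1 (fun t => F (x + t *: basis3 R i)) df <->
  is_derive x (basis3 R i) F df.
Proof.
have E : (fun h : R => h^-1 *: ((F \o shift x) (h *: basis3 R i) - F x)) =
  (fun h : R => h^-1 *: (((fun t => F (x + t *: basis3 R i)) \o shift 0) (h *: 1) -
      F (x + 0 *: basis3 R i))).
  by apply/funext => h; rewrite /= addr0 scale0r addr0 [h *: 1]mulr1 (addrC x).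
split=> -[d1 d2]; split; rewrite /derivable /derive in d1 d2 *.
- by rewrite E.
- by rewrite E.
- by rewrite -E.
- by rewrite -E.
Qed.

End coordinates.
Arguments coord {R} j z.

Section tensor_products.
Context {R : realType}.
Implicit Types g : 'I_3 -> R -> R.

Definition tensor g (z : R * R * R) : R := \prod_(j < 3) g j (coord j z).

(** A partial derivative of a tensor product differentiates a single factor. *)
Definition derive_factor (i : 'I_3) g : 'I_3 -> R -> R :=
  fun j => if j == i then (g j)^`()%classic else g j.

Lemma derive_factorC i j g :
  derive_factor i (derive_factor j g) = derive_factor j (derive_factor i g).
Proof. by apply/funext => k; rewrite /derive_factor; case: ifP; case: ifP. Qed.

Definition test_kernel (M : R) (g : R -> R) : Prop :=
  smooth1 g /\ forall t, M < `|t| -> g t = 0.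

Lemma test_kernel_derive M (g : R -> R) : test_kernel M g -> test_kernel M g^`()%classic.
Proof.
move=> [sg g0]; split; first exact: smooth1_derive.
move=> t Mt; rewrite derive1E; have <- : 'D_1 (cst 0 : R -> R) t = 0 by exact: derive_cst.
apply: near_eq_derive; near=> s; rewrite g0//.
near: s; apply: (@cvgr_norm_gt _ _ _ _ _ id t) => //; exact: cvg_id.
Unshelve. all: by end_near. Qed.

Lemma derive_factor_test_kernel M i g :
  (forall j, test_kernel M (g j)) -> forall j, test_kernel M (derive_factor i g j).
Proof.
by move=> h j; rewrite /derive_factor; case: ifP => // _; exact: test_kernel_derive.
Qed.

Lemma tensor_line_derive (g : 'I_3 -> R -> R) i (z : R * R * R) (e t0 : R) :
  (forall j, smooth1 (g j)) ->
  is_derive t0 1 (fun t => tensor g (z + (e * t) *: basis3 R i))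
    (e * tensor (derive_factor i g) (z + (e * t0) *: basis3 R i)).
Proof.
move=> sg; rewrite /tensor.
have -> : (fun t => \prod_(j < 3) g j (coord j (z + (e * t) *: basis3 R i))) =
    (fun t => g i (coord i z + e * t) * (\prod_(j < 3 | j != i) g j (coord j z))).
  apply/funext => t; rewrite (bigD1 i)//=; congr (_ * _).
    by rewrite coordD coordZ coord_basis eqxx mulr1.
  apply: eq_bigr => j ji; rewrite coordD coordZ coord_basis.
  by rewrite eq_sym (negbTE ji) mulr0 addr0.
have -> : e * \prod_(j < 3) derive_factor i g j (coord j (z + (e * t0) *: basis3 R i)) =
    (e * (g i)^`()%classic (coord i z + e * t0)) * (\prod_(j < 3 | j != i) g j (coord j z)).
  rewrite (bigD1 i)//= /derive_factor eqxx mulrA; congr (_ * _).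
    by rewrite coordD coordZ coord_basis eqxx mulr1.
  apply: eq_bigr => j ji; rewrite (negbTE ji) coordD coordZ coord_basis.
  by rewrite eq_sym (negbTE ji) mulr0 addr0.
set P := (\prod_(j < 3 | j != i) _).
have Hf := smooth1_is_derive (sg i) (coord i z + e * t0).
have Hg : is_derive t0 1 (fun t : R => coord i z + e * t) e.
  by apply: is_derive_eq; rewrite /GRing.scale/=; ring.
have H := @is_derive1_comp _ (g i) (fun t => coord i z + e * t) t0 _ _ Hf Hg.
apply: (is_derive_eq (is_deriveM H (is_derive_cst P _ _))).
by rewrite /GRing.scale/= mulr0 add0r; ring.
Qed.

Lemma continuous_tensor_reflect g (x : R * R * R) : (forall j, smooth1 (g j)) ->
  continuous (fun y : R * R * R => tensor g (x - y)).
Proof.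
move=> sg; rewrite /tensor.
have c j : continuous (fun y : R * R * R => g j (coord j (x - y))).
  move=> y.
  apply: (@continuous_comp (R * R * R)%type R R (fun y => coord j (x - y)) (g j)).
    have -> : (fun y => coord j (x - y)) = (fun y => coord j x - coord j y).
      by apply/funext => z; rewrite coordB.
    by apply: continuousB; [exact: cst_continuous|exact: continuous_coord].
  exact: smooth1_continuous.
move=> y; under eq_fun do rewrite !big_ord_recl big_ord0 mulr1.
have c12 := @continuousM _ _ _ _ y (c (lift ord0 ord0) y) (c (lift ord0 (lift ord0 ord0)) y).
exact: (@continuousM _ _ _ _ y (c ord0 y) c12).
Qed.

Lemma partial_tensor_reflect g (x : R * R * R) i (k : R) : (forall j, smooth1 (g j)) ->
  forall y, is_derive y (basis3 R i) (fun y => k * tensor g (x - y))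
    (- k * tensor (derive_factor i g) (x - y)).
Proof.
move=> sg y; apply/is_derive_line.
have -> : (fun t : R => k * tensor g (x - (y + t *: basis3 R i))) =
   (fun t : R => k * tensor g ((x - y) + (- 1 * t) *: basis3 R i)).
  by apply/funext => t; rewrite mulN1r scaleNr opprD addrA.
apply: (is_derive_eq (is_deriveM (is_derive_cst k _ _) (tensor_line_derive i (x - y) (-1) 0 sg))).
by rewrite mulr0 scale0r addr0 /GRing.scale/=; ring.
Qed.

Lemma partial_tensorE g (x : R * R * R) i (k : R) : (forall j, smooth1 (g j)) ->
  partial i (fun y => k * tensor g (x - y)) =
  (fun y => - k * tensor (derive_factor i g) (x - y)).
Proof.
move=> sg; apply/funext => y; rewrite /partial.
by have [_ ->] := partial_tensor_reflect x i k sg y.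
Qed.

Lemma derive_factor_smooth i g : (forall j, smooth1 (g j)) ->
  forall j, smooth1 (derive_factor i g j).
Proof. by move=> h j; rewrite /derive_factor; case: ifP => // _; exact: smooth1_derive. Qed.

Lemma tensor_smooth3 g (x : R * R * R) : (forall j, smooth1 (g j)) ->
  smooth3 (fun y => tensor g (x - y)).
Proof.
move=> sg s.
have [k [h [sh ->]]] : exists k h, (forall j, smooth1 (h j)) /\
    iter_partial s (fun y => tensor g (x - y)) = (fun y => k * tensor h (x - y)).
  elim: s => [|i s [k [h [sh IH]]]] /=.
    by exists 1, g; split => //; apply/funext => y; rewrite mul1r.
  exists (- k), (derive_factor i h); split; first exact: derive_factor_smooth.
  by rewrite IH partial_tensorE.
split=> [y|i y].
  have ck : continuous_at y (fun=> k : R) by exact: cst_continuous.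
  exact: (@continuousM _ _ _ _ y ck (@continuous_tensor_reflect h x sh y)).
by have [] := partial_tensor_reflect x i k sh y.
Qed.

Lemma tensor_eq0 M g (z : R * R * R) j : (forall j, test_kernel M (g j)) ->
  M < `|coord j z| -> tensor g z = 0.
Proof. by move=> h Mz; rewrite /tensor (bigD1 j)//= (h j).2// mul0r. Qed.

Lemma tensor_test_function M g (x : R * R * R) : (forall j, test_kernel M (g j)) ->
  test_function (fun y => tensor g (x - y)).
Proof.
move=> kg; split; first by apply: tensor_smooth3 => j; exact: (kg j).1.
pose I j : set R := `[coord j x - M, coord j x + M]%classic.
pose K : set (R * R * R) := (I ord0 `*` I 1) `*` I ord_max.
have cK : compact K.
  by apply: compact_setX; first apply: compact_setX; exact: segment_compact.
apply: (subclosed_compact _ cK); first exact: closed_closure.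
have clK : closed K by apply: compact_closed => //; exact: norm_hausdorff.
rewrite [X in _ `<=` X](closure_id K).1//; apply: closure_subset => y /= ty.
have b j : I j (coord j y).
  rewrite /I /= in_itv/=; have : `|coord j (x - y)| <= M.
    by rewrite leNgt; apply: contra ty => h; rewrite (tensor_eq0 kg h).
  by rewrite coordB ler_norml => /andP[? ?]; apply/andP; split; lra.
by split; [split|]; have := b ord0; have := b 1; have := b ord_max.
Qed.

(** The sign produced by the reflection y |-> x - y disappears in second
    derivatives. *)
Lemma laplacian_tensor g (x : R * R * R) : (forall j, smooth1 (g j)) ->
  laplacian (fun y => tensor g (x - y)) =
  (fun y => \sum_(i < 3) tensor (derive_factor i (derive_factor i g)) (x - y)).
Proof.
move=> sg; apply/funext => y; rewrite /laplacian; apply: eq_bigr => i _.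
have -> : (fun y => tensor g (x - y)) = (fun y => 1 * tensor g (x - y)).
  by apply/funext => z; rewrite mul1r.
rewrite partial_tensorE// partial_tensorE; last exact: derive_factor_smooth.
by rewrite opprK mul1r.
Qed.

End tensor_products.

(** * Square-integrable functions and convolution *)

Section square_integrable_functions.
Context {R : realType}.
Local Notation mu := (lebesgue3 R).
Implicit Types u v w : mR3 R -> R.

Definition square_integrable u : Prop :=
  measurable_fun setT u /\ (\int[mu]_x (u x ^+ 2)%:E < +oo)%E.

Lemma square_integrableP u : measurable_fun setT u ->
  square_integrable u <-> mu.-integrable setT (EFin \o (fun x => u x ^+ 2)).
Proof.
move=> mu_; have m2 : measurable_fun setT (fun x => u x ^+ 2) by exact: measurable_funX.
have E : (\int[mu]_x `|(EFin \o (fun x => u x ^+ 2)%R) x| = \int[mu]_x (u x ^+ 2)%:E)%E.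
  by apply: eq_integral => x _ /=; rewrite ger0_norm// sqr_ge0.
split => [[_ h]|/integrableP[_]]; last by rewrite E.
by apply/integrableP; split; [exact/measurable_EFinP|rewrite E].
Qed.

Lemma integrable_le_sqr u v (f : mR3 R -> R) (C D : R) :
  square_integrable u -> square_integrable v -> measurable_fun setT f ->
  (forall x, `|f x| <= C * u x ^+ 2 + D * v x ^+ 2) ->
  mu.-integrable setT (EFin \o f).
Proof.
move=> su sv mf h.
have iu := (square_integrableP su.1).1 su; have iv := (square_integrableP sv.1).1 sv.
have := integrableD measurableT (integrableZl measurableT C iu) (integrableZl measurableT D iv).
apply: le_integrable => //; first exact/measurable_EFinP.
move=> x _; rewrite /= lee_fin; apply: le_trans (h x) _; exact: ler_norm.
Qed.

Lemma integrable_mul_sqr u v : square_integrable u -> square_integrable v ->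
  mu.-integrable setT (EFin \o (fun x => u x * v x)).
Proof.
move=> su sv; apply: (@integrable_le_sqr u v _ 1 1) => //.
  by apply: measurable_funM; [exact: su.1|exact: sv.1].
move=> x; rewrite !mul1r normrM.
have := sqr_ge0 (`|u x| - `|v x|); rewrite sqrrB !real_normK ?num_real//.
by have := sqr_ge0 (u x); have := sqr_ge0 (v x); rewrite mulr2n; nra.
Qed.

Lemma square_integrable_le u v (f : mR3 R -> R) (C D : R) : square_integrable u -> square_integrable v ->
  measurable_fun setT f -> (forall x, f x ^+ 2 <= C * u x ^+ 2 + D * v x ^+ 2) ->
  square_integrable f.
Proof.
move=> su sv mf h; apply/(square_integrableP mf).
apply: (integrable_le_sqr su sv (measurable_funX _ mf)) => x.
by rewrite ger0_norm ?sqr_ge0.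
Qed.

Lemma square_integrableD u v : square_integrable u -> square_integrable v ->
  square_integrable (fun x => u x + v x).
Proof.
move=> su sv; apply: (@square_integrable_le u v _ 2 2) => //.
  by apply: measurable_funD; [exact: su.1|exact: sv.1].
by move=> x; have := sqr_ge0 (u x - v x); nra.
Qed.

Lemma square_integrableM_bounded u w (C : R) : square_integrable u ->
  measurable_fun setT w -> (forall x, `|w x| <= C) ->
  square_integrable (fun x => w x * u x).
Proof.
move=> su mw wC; apply: (@square_integrable_le u u _ (C ^+ 2) 0) => //.
  by apply: measurable_funM => //; exact: su.1.
move=> x; rewrite mul0r addr0 exprMn ler_wpM2r ?sqr_ge0//.
rewrite -real_normK ?num_real// lerXn2r// nnegrE//.
exact: le_trans (wC x).
Qed.

Lemma square_integrableZ u (C : R) : square_integrable u ->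
  square_integrable (fun x => C * u x).
Proof. by move=> su; apply: (square_integrableM_bounded su (C:=`|C|)). Qed.

Lemma square_integrable_abs u : square_integrable u ->
  square_integrable (fun x => `|u x|).
Proof.
move=> [mu_ h]; split; first exact: measurableT_comp.
by under eq_integral do rewrite real_normK ?num_real//.
Qed.

End square_integrable_functions.

Section kernels.
Context {R : realType}.
Local Notation mu := (lebesgue3 R).
Variables (M : R) (g : 'I_3 -> R -> R).
Hypothesis kg : forall j, test_kernel M (g j).

Lemma test_kernel_bounded (f : R -> R) : test_kernel M f ->
  exists2 C, 0 <= C & forall t, `|f t| <= C.
Proof.
move=> [sf f0]; pose N := Num.max M 0.
have N0 : 0 <= N by rewrite le_max lexx orbT.
have c : {within `[- N, N], continuous (fun t => `|f t|)}.
  apply: continuous_subspaceT => t.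
  apply: (@continuous_comp _ _ _ f (fun y => `|y|)); last exact: norm_continuous.
  exact: smooth1_continuous.
have NN : - N <= N by lra.
have [c0 _ hc] := EVT_max NN c.
exists `|f c0| => // t; have [tN|tN] := leP `|t| N.
  by apply: hc; rewrite in_itv/= -ler_norml.
by rewrite f0 ?normr0// (le_lt_trans _ tN)// le_max lexx.
Qed.

Lemma tensor_bounded : exists2 C, 0 <= C & forall z, `|tensor g z| <= C.
Proof.
have /choice[C hC] : forall j, exists C, 0 <= C /\ forall t, `|g j t| <= C.
  by move=> j; have [C ? ?] := test_kernel_bounded (kg j); exists C.
exists (\prod_(j < 3) C j); first by apply: prodr_ge0 => j _; case: (hC j).
move=> z; rewrite /tensor normr_prod; apply: ler_prod => j _.
by rewrite normr_ge0/=; case: (hC j).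
Qed.

Lemma measurable_tensor : measurable_fun setT (tensor g : mR3 R -> R).
Proof.
apply: measurable_prod => j _.
exact: (measurableT_comp (smooth1_measurable (kg j).1) (measurable_coord j)).
Qed.

Lemma measurable_sub3 :
  measurable_fun setT (fun z : mR3 R * mR3 R => (z.1 : R * R * R) - z.2 : mR3 R).
Proof.
apply: measurable_fun_coord => j; under eq_fun do rewrite coordB.
apply: measurable_funB.
  exact: (measurableT_comp (measurable_coord j) measurable_fst).
exact: (measurableT_comp (measurable_coord j) measurable_snd).
Qed.

Lemma measurable_tensor_sub :
  measurable_fun setT (fun z : mR3 R * mR3 R => tensor g ((z.1 : R * R * R) - z.2)).
Proof. exact: (measurableT_comp measurable_tensor measurable_sub3). Qed.

Lemma measurable_tensor_reflect (x : R * R * R) :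
  measurable_fun setT (fun y : mR3 R => tensor g (x - (y : R * R * R))).
Proof.
exact: (measurableT_comp measurable_tensor_sub (measurable_pair1 (x : mR3 R))).
Qed.

Lemma tensor_outside_cube n (z : R * R * R) : M < n%:R -> ~ cube R n z -> tensor g z = 0.
Proof.
move=> Mn nz; apply/eqP; apply: contra_notT nz => tz.
have b j : - n%:R < coord j z <= n%:R.
  have : `|coord j z| <= M.
    by rewrite leNgt; apply: contra tz => h; rewrite (tensor_eq0 kg h).
  by rewrite ler_norml => /andP[? ?]; apply/andP; split; lra.
by split; [split|] => /=; rewrite in_itv/=; [exact: (b ord0)|exact: (b 1)|exact: (b ord_max)].
Qed.

Lemma reflect3 (x y : R * R * R) : x - y = affine3 (-1) x y.
Proof. by rewrite /affine3 !mulN1r. Qed.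

Lemma ge0_integral_reflect (h : mR3 R -> \bar R) (x : R * R * R) :
  measurable_fun setT h -> (forall x, 0 <= h x)%E ->
  (\int[mu]_y h (x - (y : R * R * R))%R = \int[mu]_y h y)%E.
Proof.
move=> mh h0; under eq_integral do rewrite reflect3.
rewrite ge0_integral_affine3// ?oppr_eq0 ?oner_eq0//.
by rewrite normrN normr1 expr1n invr1 mul1e.
Qed.

Lemma integral_abs_tensor_lty : (\int[mu]_z `|tensor g z|%:E < +oo)%E.
Proof.
have [C C0 hC] := tensor_bounded.
pose n := (Num.Def.trunc `|M|).+1.
have Mn : M < n%:R by apply: le_lt_trans (truncnS_gt `|M|); exact: ler_norm.
apply: (@le_lt_trans _ _ (C%:E * \int[mu]_z (\1_(cube R n) z)%:E)%E).
  apply: ge0_le_integral_lin1 => //.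
  - by apply: measurableT_comp => //; exact: measurable_tensor.
  - by apply: measurable_indic; exact: measurable_cube.
  move=> z _; have [zn|zn] := pselect (cube R n z).
    by rewrite indicE mem_set// mulr1.
  by rewrite (tensor_outside_cube Mn zn) normr0 mulr_ge0.
rewrite integral_indic//; last exact: measurable_cube.
by rewrite setIT lte_mul_pinfty// lebesgue3_cube.
Qed.

Lemma square_integrable_tensor_reflect (x : R * R * R) :
  square_integrable (fun y : mR3 R => tensor g (x - (y : R * R * R))).
Proof.
split; first exact: measurable_tensor_reflect.
have [C C0 hC] := tensor_bounded.
rewrite (@ge0_integral_reflect (fun z => (tensor g z ^+ 2)%:E)).
- apply: (@le_lt_trans _ _ (C%:E * \int[mu]_z `|tensor g z|%:E)%E).
    apply: ge0_le_integral_lin1 => //.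
    - exact: measurable_funX measurable_tensor.
    - by apply: measurableT_comp => //; exact: measurable_tensor.
    - by move=> z; exact: sqr_ge0.
    by move=> z _; rewrite -real_normK ?num_real// expr2 ler_wpM2r.
  by rewrite lte_mul_pinfty//; exact: integral_abs_tensor_lty.
- by apply: measurable_sqr; exact: measurable_tensor.
- by move=> z; rewrite lee_fin sqr_ge0.
Qed.

End kernels.

Section convolution.
Context {R : realType}.
Local Notation mu := (lebesgue3 R).
Implicit Types (u v : mR3 R -> R) (g : 'I_3 -> R -> R) (M : R).

Definition conv u g (x : R * R * R) : R :=
  \int[mu]_y (u y * tensor g (x - (y : R * R * R))).

Lemma conv_integrable M u g x : (forall j, test_kernel M (g j)) ->
  square_integrable u ->
  mu.-integrable setT (EFin \o (fun y => u y * tensor g (x - (y : R * R * R)))).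
Proof.
by move=> kg su; apply: integrable_mul_sqr => //; exact: square_integrable_tensor_reflect.
Qed.

Lemma conv_measurable M u g : (forall j, test_kernel M (g j)) ->
  measurable_fun setT u -> measurable_fun setT (conv u g : mR3 R -> R).
Proof.
move=> kg mu_.
pose F (z : mR3 R * mR3 R) := (u z.2 * tensor g ((z.1 : R * R * R) - z.2))%:E.
have mF : measurable_fun setT F.
  apply/measurable_EFinP; apply: measurable_funM.
    exact: (measurableT_comp mu_ measurable_snd).
  exact: measurable_tensor_sub.
have -> : conv u g = (fun x => fine (fubini_F mu (F^\+)%E x - fubini_F mu (F^\-)%E x)%E).
  apply/funext => x; rewrite /conv /Rintegral integralE /fubini_F.
  by congr (fine (_ - _)%E); apply: eq_integral => y _; rewrite ?funeposE ?funenegE.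
have mfine : measurable_fun setT (fine : \bar R -> R) by apply: fine_measurable.
have mFF : measurable_fun setT
    (fun x : mR3 R => (fubini_F mu (F^\+)%E x - fubini_F mu (F^\-)%E x)%E).
  apply: emeasurable_funB; apply: measurable_fun_fubini_tonelli_F => //.
    exact: measurable_funepos.
  exact: measurable_funeneg.
exact: (measurableT_comp mfine mFF).
Qed.

(** Cauchy-Schwarz with the kernel itself as weight; integration in x then gives
    Young's convolution inequality. *)
Lemma sqr_conv_le M u g x (K : R) : (forall j, test_kernel M (g j)) ->
  0 < K -> (\int[mu]_z `|tensor g z|%:E <= K%:E)%E -> square_integrable u ->
  ((conv u g x ^+ 2)%:E <=
   K%:E * \int[mu]_y (u y ^+ 2 * `|tensor g (x - (y : R * R * R))|)%:E)%E.
Proof.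
move=> kg K0 gK su.
have mt := measurable_tensor_reflect kg x.
have mat : measurable_fun setT (fun y : mR3 R => `|tensor g (x - (y : R * R * R))|).
  by apply: measurableT_comp.
have i := conv_integrable x kg su.
have := @le_sqr_integral_weighted _ _ _ mu (fun y => `|u y|)
  (fun y => `|tensor g (x - (y : R * R * R))|) K K0 _ mat.
have mau : measurable_fun setT (fun y => `|u y|).
  by apply: measurableT_comp => //; exact: su.1.
move=> /(_ mau (fun=> normr_ge0 _)).
rewrite (@ge0_integral_reflect _ (fun z => `|tensor g z|%:E))//; last first.
  apply/measurable_EFinP; apply: measurableT_comp => //; exact: (measurable_tensor kg).
move=> /(_ gK); under eq_integral do rewrite real_normK ?num_real//.
apply: le_trans; rewrite lee_fin -(real_normK (num_real (conv u g x))).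
rewrite lerXn2r ?nnegrE//.
  by apply: Rintegral_ge0 => y _; rewrite mulr_ge0.
apply: le_trans (le_normr_Rintegral measurableT i) _.
by under eq_Rintegral do rewrite normrM.
Qed.

Lemma integral_sqr_conv_le M u g (K : R) : (forall j, test_kernel M (g j)) ->
  0 < K -> (\int[mu]_z `|tensor g z|%:E <= K%:E)%E -> square_integrable u ->
  (\int[mu]_x (conv u g x ^+ 2)%:E <= (K ^+ 2)%:E * \int[mu]_y (u y ^+ 2)%:E)%E.
Proof.
move=> kg K0 gK su.
pose F (z : mR3 R * mR3 R) := (u z.2 ^+ 2 * `|tensor g ((z.1 : R * R * R) - z.2)|)%:E.
have F0 z : (0 <= F z)%E by rewrite lee_fin mulr_ge0// sqr_ge0.
have mF : measurable_fun setT F.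
  apply/measurable_EFinP; apply: measurable_funM.
    apply: measurable_funX; exact: (measurableT_comp su.1 measurable_snd).
  apply: measurableT_comp => //; exact: (measurable_tensor_sub kg).
have mu2 : measurable_fun setT (fun y => (u y ^+ 2)%:E).
  by apply: measurable_sqr; exact: su.1.
apply: (@le_trans _ _ (\int[mu]_x (K%:E * \int[mu]_y F (x, y)))%E).
  apply: ge0_le_integral => //.
  - by move=> x _; rewrite lee_fin sqr_ge0.
  - apply/measurable_EFinP; apply: measurable_funX; exact: (conv_measurable kg su.1).
  - apply: measurable_funeM; exact: (measurable_fun_fubini_tonelli_F F mF F0).
  - by move=> x _; exact: sqr_conv_le.
have K0' : (0 <= K%:E)%E by rewrite lee_fin ltW.
rewrite ge0_integralZl//; last 2 first.
- exact: (measurable_fun_fubini_tonelli_F F mF F0).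
- by move=> x _; exact: integral_ge0.
rewrite (fubini_tonelli F)// EFinM -muleA lee_wpmul2l//.
rewrite -ge0_integralZl//; last by move=> y _; rewrite lee_fin sqr_ge0.
apply: ge0_le_integral => //.
- by move=> y _; exact: integral_ge0.
- exact: (measurable_fun_fubini_tonelli_G F mF F0).
- exact: measurable_funeM.
move=> y _; rewrite /F/=.
under eq_integral do rewrite EFinM.
have mty : measurable_fun setT (fun x : mR3 R => `|tensor g ((x : R * R * R) - y)|%:E).
  apply/measurable_EFinP; apply: measurableT_comp => //.
  exact: (measurableT_comp (measurable_tensor_sub kg) (measurable_pair2 (y : mR3 R))).
rewrite ge0_integralZl//; last by rewrite lee_fin sqr_ge0.
rewrite muleC lee_wpmul2r// ?lee_fin ?sqr_ge0//.
apply: le_trans gK.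
have E : forall x : R * R * R, x - y = affine3 1 (- y) x.
  by move=> x; rewrite /affine3 !mul1r addrC.
under eq_integral do rewrite E.
rewrite (@ge0_integral_affine3 _ 1 (- (y : R * R * R)) (fun x => `|tensor g x|%:E)) ?oner_eq0//.
  by rewrite normr1 expr1n invr1 mul1e.
by apply/measurable_EFinP; apply: measurableT_comp => //; exact: (measurable_tensor kg).
Qed.

Lemma conv_square_integrable M u g : (forall j, test_kernel M (g j)) ->
  square_integrable u -> square_integrable (conv u g).
Proof.
move=> kg su; split; first exact: (conv_measurable kg su.1).
have := integral_abs_tensor_lty kg; set I := (\int[mu]_z _)%E => Iy.
have If : I \is a fin_num by rewrite ge0_fin_numE// integral_ge0.
have K0 : 0 < fine I + 1 by rewrite ltr_wpDl// fine_ge0// integral_ge0.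
apply: (le_lt_trans (@integral_sqr_conv_le M u g (fine I + 1) kg K0 _ su)).
  by rewrite EFinD fineK// leeDl.
by rewrite lte_mul_pinfty// ?lee_fin ?sqr_ge0//; exact: su.2.
Qed.

End convolution.

(** * Derivatives of a convolution *)

Section directional_derivatives.
Context {R : realType}.
Local Notation mu := (lebesgue3 R).

(** Differentiability along coordinate lines is all the regularity that the
    integrations by parts below rely on. *)
Definition has_partial (i : 'I_3) (F G : R * R * R -> R) : Prop :=
  forall x, is_derive (0 : R) 1 (fun t => F (x + t *: basis3 R i)) (G x).

Lemma has_partial_line i F G x (t : R) : has_partial i F G ->
  is_derive t 1 (fun t => F (x + t *: basis3 R i)) (G (x + t *: basis3 R i)).
Proof.
move=> h; have := h (x + t *: basis3 R i).
have -> : (fun s : R => F (x + t *: basis3 R i + s *: basis3 R i)) =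
    (fun s : R => F (x + s *: basis3 R i)) \o (fun s : R => t + s).
  by apply/funext => s /=; rewrite -addrA -scalerDl.
move=> H.
have H' : is_derive (t + - t) 1 ((fun s : R => F (x + s *: basis3 R i)) \o (fun s : R => t + s))
   (G (x + t *: basis3 R i)) by rewrite subrr.
have Hs : is_derive t 1 (fun s : R => s - t) 1.
  by apply: is_derive_eq; rewrite /GRing.scale/= oppr0 addr0.
have := @is_derive1_comp _ _ (fun s => s - t) t _ _ H' Hs.
rewrite mulr1; have -> // : ((fun s : R => F (x + s *: basis3 R i)) \o (fun s : R => t + s)) \o
   (fun s : R => s - t) = (fun s : R => F (x + s *: basis3 R i)).
by apply/funext => s /=; rewrite addrCA subrr addr0.
Qed.

Lemma has_partial_continuous i F G x : has_partial i F G ->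
  continuous (fun t : R => F (x + t *: basis3 R i)).
Proof.
move=> h t; apply: differentiable_continuous; apply/derivable1_diffP.
by have [] := has_partial_line x t h.
Qed.

(** Differentiation under the integral sign: for |t| < 1 the difference quotients
    live in a fixed cube B around x, where they are dominated by a multiple of
    |u|, an integrable function on B. *)
Lemma conv_has_partial M (u : mR3 R -> R) (g : 'I_3 -> R -> R) i :
  (forall j, test_kernel M (g j)) -> square_integrable u ->
  has_partial i (conv u g) (conv u (derive_factor i g)).
Proof.
move=> kg su x.
have sg j : smooth1 (g j) := (kg j).1.
have kg' := derive_factor_test_kernel i kg.
have [C C0 hC] := tensor_bounded kg'.
pose f (t : R) (y : mR3 R) := u y * tensor g (x + t *: basis3 R i - (y : R * R * R)).
(* n exceeds M + 1: the kernel of range M is translated by less than 1 *)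
pose n := (Num.Def.trunc `|M|).+2.
have Mn : M + 1 < n%:R.
  rewrite /n -addn1 natrD ltrD2r; apply: le_lt_trans (truncnS_gt `|M|); exact: ler_norm.
pose B : set (mR3 R) := [set y | cube R n (x - (y : R * R * R))].
pose G (y : mR3 R) := C * (`|u y| * \1_B y).
have df (t : R) (y : mR3 R) : is_derive t 1 (f ^~ y)
    (u y * tensor (derive_factor i g) (x + t *: basis3 R i - (y : R * R * R))).
  rewrite /f; have -> : (fun t : R => u y * tensor g (x + t *: basis3 R i - (y : R * R * R))) =
    (fun t => u y * tensor g (x - (y : R * R * R) + (1 * t) *: basis3 R i)).
    by apply/funext => s; rewrite mul1r addrAC.
  apply: (is_derive_eq (is_deriveM (is_derive_cst (u y) _ _)
    (tensor_line_derive i (x - (y : R * R * R)) 1 t sg))).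
  by rewrite /GRing.scale/= !mul1r mulr0 addr0 addrAC.
have d1E (t : R) (y : mR3 R) : partial1of2 f t y =
    u y * tensor (derive_factor i g) (x + t *: basis3 R i - (y : R * R * R)).
  by rewrite partial1of2E; have [] := df t y.
have mB : measurable B.
  rewrite -[B]setTI /B; have mr : measurable_fun setT (fun y : mR3 R => x - (y : R * R * R) : mR3 R).
    have -> : (fun y : mR3 R => x - (y : R * R * R) : mR3 R) = affine3 (-1) x.
      by apply/funext => y; rewrite reflect3.
    exact: measurable_affine3.
  by apply: mr => //; exact: measurable_cube.
have sB : square_integrable (\1_B : mR3 R -> R).
  split; first exact: measurable_indic.
  have -> : (\int[mu]_y (\1_B y ^+ 2)%:E = \int[mu]_y ((\1_(cube R n) (x - (y : R * R * R)))%:E))%E.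
    apply: eq_integral => y _; rewrite !indicE /B; congr (_%:E).
    have -> : (y \in [set y0 : mR3 R | cube R n (x - (y0 : R * R * R))]) = (x - (y : R * R * R) \in cube R n).
      by apply/idP/idP; rewrite !inE.
    by case: (_ \in _); rewrite ?expr1n ?expr0n.
  have mi : measurable_fun setT (fun y : mR3 R => (\1_(cube R n) y : R)%:E).
    by apply/measurable_EFinP; apply: measurable_indic; exact: measurable_cube.
  rewrite (@ge0_integral_reflect _ (fun y => (\1_(cube R n) y)%:E))//.
    rewrite integral_indic//; last exact: measurable_cube.
    by rewrite setIT lebesgue3_cube.
have intG : mu.-integrable setT (EFin \o G).
  have iab := integrableZl measurableT C (integrable_mul_sqr (square_integrable_abs su) sB).
  by apply: eq_integrable iab => // y _; rewrite /G/= EFinM.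
have fb (t : R) (y : mR3 R) : t \in `](-1), 1[ -> `|partial1of2 f t y| <= G y.
  rewrite in_itv/= => /andP[t1 t2]; rewrite d1E normrM /G.
  have [yB|yB] := pselect (B y).
    by rewrite indicE mem_set// mulr1 mulrC ler_wpM2r.
  have -> : tensor (derive_factor i g) (x + t *: basis3 R i - (y : R * R * R)) = 0.
    apply/eqP; apply: contra_notT yB => tz.
    have b j : - n%:R < coord j (x - (y : R * R * R)) <= n%:R.
      have : `|coord j (x + t *: basis3 R i - (y : R * R * R))| <= M.
        by rewrite leNgt; apply: contra tz => h; rewrite (tensor_eq0 kg' h).
      rewrite coordB coordD coordZ coord_basis.
      have : `|t * (i == j)%:R| <= 1.
        by case: (i == j); rewrite ?mulr1 ?mulr0 ?normr0// ler_norml; apply/andP; split; lra.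
      rewrite !ler_norml coordB => /andP[? ?] /andP[? ?]; apply/andP; split; lra.
    by split; [split|] => /=; rewrite in_itv/=; [exact: (b ord0)|exact: (b 1)|exact: (b ord_max)].
  by rewrite normr0 mulr0 mulr_ge0// mulr_ge0.
have intf (t : R) : t \in `](-1), 1[ -> mu.-integrable setT (EFin \o f t).
  by move=> _; exact: (conv_integrable _ kg su).
have G0 y : 0 <= G y by rewrite mulr_ge0// mulr_ge0.
have I0 : `](-1), 1[%classic (0 : R) by rewrite /= in_itv/= ltrN10 ltr01.
have der (t : R) (y : mR3 R) : `](-1), 1[%classic t -> [set: mR3 R] y -> derivable (f ^~ y) t 1.
  by move=> _ _; have [] := df t y.
have fb' (t : R) (y : mR3 R) : `](-1), 1[%classic t -> [set: mR3 R] y -> `|partial1of2 f t y| <= G y.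
  by move=> ht _; exact: fb.
apply: DeriveDef.
  exact: (derivable_under_integral measurableT I0 intf der G0 intG fb').
rewrite -derive1E.
rewrite (differentiation_under_integral measurableT I0 intf der G0 intG fb').
by apply: eq_Rintegral => y _; rewrite d1E scale0r addr0.
Qed.

End directional_derivatives.

(** * Integrals of divergences *)

Section divergence_theorem.
Context {R : realType}.
Local Notation mu := (lebesgue3 R).
Local Notation leb1 := (@lebesgue_measure R).

Lemma translate3 (v x : R * R * R) : x + v = affine3 1 v x.
Proof. by rewrite /affine3 !mul1r addrC. Qed.

Lemma measurable_translate (v : R * R * R) :
  measurable_fun setT (fun x : mR3 R => (x : R * R * R) + v : mR3 R).
Proof.
have -> : (fun x : mR3 R => (x : R * R * R) + v : mR3 R) = affine3 1 v.
  by apply/funext => x; rewrite -translate3.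
exact: measurable_affine3.
Qed.

Lemma ge0_integral_translate (v : R * R * R) (h : mR3 R -> \bar R) :
  measurable_fun setT h -> (forall x, 0 <= h x)%E ->
  (\int[mu]_x h ((x : R * R * R) + v)%R = \int[mu]_x h x)%E.
Proof.
move=> mh h0; under eq_integral do rewrite translate3.
by rewrite ge0_integral_affine3 ?oner_eq0// normr1 expr1n invr1 mul1e.
Qed.

Lemma integral_translate (v : R * R * R) (h : mR3 R -> \bar R) :
  measurable_fun setT h ->
  (\int[mu]_x h ((x : R * R * R) + v)%R = \int[mu]_x h x)%E.
Proof.
move=> mh; rewrite integralE [RHS]integralE; congr (_ - _)%E.
- rewrite -(@ge0_integral_translate v (h^\+)%E)//; last exact: measurable_funepos.
  by apply: eq_integral => x _; rewrite !funeposE.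
- rewrite -(@ge0_integral_translate v (h^\-)%E)//; last exact: measurable_funeneg.
  by apply: eq_integral => x _; rewrite !funenegE.
Qed.

Lemma integrable_translate (v : R * R * R) (h : mR3 R -> \bar R) :
  mu.-integrable setT h ->
  mu.-integrable setT (fun x : mR3 R => h ((x : R * R * R) + v)).
Proof.
move=> /integrableP[mh hy]; apply/integrableP; split.
  exact: (measurableT_comp mh (measurable_translate v)).
rewrite (@ge0_integral_translate v (fun x => `|h x|%E))//.
exact: measurableT_comp.
Qed.

Lemma measurable_line i : measurable_fun setT
  (fun z : mR3 R * measurableTypeR R => (z.1 : R * R * R) + (z.2 : R) *: basis3 R i : mR3 R).
Proof.
apply: measurable_fun_coord => j; under eq_fun do rewrite coordD coordZ.
apply: measurable_funD.
  exact: (measurableT_comp (measurable_coord j) measurable_fst).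
by apply: measurable_funM => //; exact: measurable_snd.
Qed.

(** By translation invariance the integral of G is the average over t in [0, 1] of
    the integrals of G (x + t e_i). By Fubini's theorem and the fundamental theorem
    of calculus it is the integral of F (x + e_i) - F x, which vanishes by
    translation invariance again. Integrability of F and G replaces any decay at
    infinity. *)
Lemma integral_partial_eq0 i (F G : mR3 R -> R) :
  has_partial i F G -> (forall x : R * R * R, continuous (fun t : R => G (x + t *: basis3 R i))) ->
  mu.-integrable setT (EFin \o F) -> mu.-integrable setT (EFin \o G) ->
  (\int[mu]_x (G x)%:E = 0)%E.
Proof.
move=> FG cG iF iG.
have mG : measurable_fun setT G by apply/measurable_EFinP; case/integrableP : iG.
have mF : measurable_fun setT F by apply/measurable_EFinP; case/integrableP : iF.
pose I01 : set (measurableTypeR R) := `[0, 1]%classic.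
have mI : measurable I01 by exact: measurable_itv.
pose H (z : mR3 R * measurableTypeR R) : \bar R :=
  (G ((z.1 : R * R * R) + (z.2 : R) *: basis3 R i) * \1_I01 z.2)%:E.
have mH : measurable_fun setT H.
  apply/measurable_EFinP; apply: measurable_funM.
    exact: (measurableT_comp mG (measurable_line i)).
  exact: (measurableT_comp (measurable_indic mI) measurable_snd).
have leb01 : leb1 I01 = 1%E.
  by rewrite /I01 lebesgue_measure_itv/= lte01 oppr0 adde0.
have integral_indic01 (c : \bar R) : (0 <= c)%E ->
    (\int[leb1]_t (c * (\1_I01 t)%:E) = c)%E.
  move=> c0; rewrite ge0_integralZl//; last first.
    by apply/measurable_EFinP; exact: measurable_indic.
  by rewrite integral_indic//= setIT leb01 mule1.
have iH : (mu \x leb1)%E.-integrable setT H.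
  apply/integrable21ltyP => //.
  have E : (\int[leb1]_y \int[mu]_x `|H (x, y)| =
      \int[leb1]_y ((\int[mu]_x `|(G x)%:E|) * (\1_I01 y)%:E))%E.
    apply: eq_integral => t _.
    rewrite -(@ge0_integral_translate (t *: basis3 R i) (fun x => `|(G x)%:E|%E))//; last first.
      by apply: measurableT_comp => //; exact/measurable_EFinP.
    rewrite muleC -ge0_integralZl//.
    + by apply: eq_integral => x _; rewrite /H/= normrM EFinM muleC indicE (ger0_norm (ler0n _ _)).
    + apply: measurableT_comp => //; apply/measurable_EFinP.
      exact: (measurableT_comp mG (measurable_translate _)).
  rewrite E integral_indic01; last exact: integral_ge0.
  by case/integrableP : iG.
have := Fubini iH.
have -> : (\int[leb1]_y \int[mu]_x H (x, y) = \int[mu]_x (G x)%:E)%E.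
  transitivity (\int[leb1]_y (fine (\int[mu]_x (G x)%:E) * \1_I01 y)%:E)%E.
    apply: eq_integral => t _.
    rewrite /H/= -(integral_translate (t *: basis3 R i) (_ : measurable_fun setT (EFin \o G)))//; last exact/measurable_EFinP.
    have iGt := integrable_translate (t *: basis3 R i) iG.
    rewrite EFinM fineK; last exact: (integrable_fin_num measurableT iGt).
    rewrite muleC -integralZl//; apply: eq_integral => x _.
    by rewrite /= EFinM muleC.
  under eq_integral do rewrite EFinM.
  rewrite integralZl//; last first.
    apply/integrableP; split; first by apply/measurable_EFinP; exact: measurable_indic.
    have -> : (\int[leb1]_x `|(\1_I01 x : R)%:E| = \int[leb1]_x (1 * (\1_I01 x)%:E))%E.
      by apply: eq_integral => t _; rewrite mul1e /= indicE ger0_norm.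
    by rewrite integral_indic01// ltry.
  rewrite integral_indic//= setIT leb01 mule1 fineK//.
  exact: integrable_fin_num iG.
move=> <-.
transitivity (\int[mu]_x ((F ((x : R * R * R) + basis3 R i))%:E - (F x)%:E))%E; last first.
  have iFt := integrable_translate (basis3 R i) iF.
  apply: (eq_trans (integralB measurableT iFt iF)).
  rewrite (integral_translate (basis3 R i) (_ : measurable_fun setT (EFin \o F))); last exact/measurable_EFinP.
  by rewrite subee//; exact: (integrable_fin_num measurableT iF).
apply: eq_integral => x _.
transitivity (\int[leb1]_(t in I01) (G ((x : R * R * R) + t *: basis3 R i))%:E)%E.
  rewrite [RHS]integral_mkcond; apply: eq_integral => t _.
  rewrite /H/= patchE indicE; case: ifP => _; first by rewrite mulr1.
  by rewrite mulr0.
have FL := fun t => has_partial_line x t FG.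
have cF := has_partial_continuous FG (x:=x).
rewrite (@continuous_FTC2 _ (fun t : R => G (x + t *: basis3 R i)) (fun t : R => F (x + t *: basis3 R i)) 0 1)//.
- by rewrite scale1r scale0r addr0.
- exact/continuous_subspaceT/cG.
- split.
  + by move=> t _; case: (FL t).
  + by apply: cvg_at_right_filter; exact: cF.
  + by apply: cvg_at_left_filter; exact: cF.
- by move=> t _; rewrite derive1E; case: (FL t).
Qed.

End divergence_theorem.

(** * The multiplier identity *)

Section multiplier.
Context {R : realType}.
Local Notation mu := (lebesgue3 R).
Implicit Types (a u v w : mR3 R -> R).

Definition line_continuous (f : mR3 R -> R) : Prop :=
  forall i (x : R * R * R), continuous (fun t : R => f (x + t *: basis3 R i)).

(** Multiplication by such a coefficient preserves square integrability and
    continuity along lines. *)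
Definition weight w : Prop :=
  [/\ measurable_fun setT w, exists C, forall x, `|w x| <= C & line_continuous w].

Record regular a (da : 'I_3 -> mR3 R -> R) (dda : 'I_3 -> 'I_3 -> mR3 R -> R) : Prop := Regular {
  reg_sq : square_integrable a;
  reg_dsq : forall i, square_integrable (da i);
  reg_ddsq : forall i j, square_integrable (dda i j);
  reg_d : forall i, has_partial i a (da i);
  reg_dd : forall i j, has_partial i (da j) (dda i j);
  reg_sym : forall i j, dda i j = dda j i;
  reg_ddc : forall i j, line_continuous (dda i j) }.

Lemma line_continuousD f g : line_continuous f -> line_continuous g ->
  line_continuous (fun x => f x + g x).
Proof. by move=> cf cg i x t; apply: cvgD; [exact: cf|exact: cg]. Qed.

Lemma line_continuousM f g : line_continuous f -> line_continuous g ->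
  line_continuous (fun x => f x * g x).
Proof. by move=> cf cg i x t; apply: cvgM; [exact: cf|exact: cg]. Qed.

Lemma line_continuous_cst (k : R) : line_continuous (fun=> k).
Proof. by move=> i x t; exact: cst_continuous. Qed.

Lemma has_partial_line_continuous f (df : 'I_3 -> mR3 R -> R) :
  (forall i, has_partial i f (df i)) -> line_continuous f.
Proof. by move=> h i x; exact: has_partial_continuous (h i). Qed.

Lemma weightM w v : weight w -> weight v -> weight (fun x => w x * v x).
Proof.
move=> [mw [C wC] cw] [mv [D vD] cv]; split.
- exact: measurable_funM.
- exists (C * D) => x; rewrite normrM; apply: ler_pM => //.
- exact: line_continuousM.
Qed.

Lemma weightD w v : weight w -> weight v -> weight (fun x => w x + v x).
Proof.
move=> [mw [C wC] cw] [mv [D vD] cv]; split.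
- exact: measurable_funD.
- by exists (C + D) => x; apply: le_trans (ler_normD _ _) _; apply: lerD.
- exact: line_continuousD.
Qed.

Lemma weightN w : weight w -> weight (fun x => - w x).
Proof.
move=> [mw [C wC] cw]; split.
- exact: measurableT_comp.
- by exists C => x; rewrite normrN.
- by move=> i x t; apply: cvgN; exact: cw.
Qed.

Lemma weight_cst k : weight (fun=> k).
Proof.
by split; [exact: measurable_cst|by exists (`|k| )|exact: line_continuous_cst].
Qed.

Lemma square_integrable_weight w u : weight w -> square_integrable u ->
  square_integrable (fun x => w x * u x).
Proof. by move=> [mw [C wC] _] su; exact: square_integrableM_bounded su mw wC. Qed.

(** The integrands whose divergence theorem is integral_partial_eq0; products of
    two functions of the class admissible1 below belong to it. *)
Definition admissible (f : mR3 R -> R) : Prop :=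
  mu.-integrable setT (EFin \o f) /\ line_continuous f.

Definition admissible1 u : Prop := square_integrable u /\ line_continuous u.

Lemma admissibleD f g : admissible f -> admissible g -> admissible (fun x => f x + g x).
Proof.
move=> [f1 f2] [g1 g2]; split; last exact: line_continuousD.
by apply: eq_integrable (integrableD measurableT f1 g1) => // x _.
Qed.

Lemma admissibleM u v : admissible1 u -> admissible1 v -> admissible (fun x => u x * v x).
Proof.
by move=> [u1 u2] [v1 v2]; split; [exact: integrable_mul_sqr|exact: line_continuousM].
Qed.

Lemma admissible1D u v : admissible1 u -> admissible1 v -> admissible1 (fun x => u x + v x).
Proof.
by move=> [u1 u2] [v1 v2]; split; [exact: square_integrableD|exact: line_continuousD].
Qed.

Lemma admissible1M w u : weight w -> admissible1 u -> admissible1 (fun x => w x * u x).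
Proof.
move=> ww [u1 u2]; split; first exact: square_integrable_weight.
by apply: line_continuousM => //; case: ww.
Qed.

Lemma admissible_sum (f : 'I_3 -> mR3 R -> R) : (forall i, admissible (f i)) ->
  admissible (fun x => \sum_(i < 3) f i x).
Proof.
move=> h; have -> : (fun x => \sum_(i < 3) f i x) = (fun x => f ord0 x + (f 1 x + f ord_max x)).
  apply/funext => x; rewrite !big_ord_recl big_ord0 addr0; congr (_ + (f _ _ + f _ _));
  exact/val_inj.
by do 2 (apply: admissibleD => //).
Qed.

Lemma admissible1_sum (f : 'I_3 -> mR3 R -> R) : (forall i, admissible1 (f i)) ->
  admissible1 (fun x => \sum_(i < 3) f i x).
Proof.
move=> h; have -> : (fun x => \sum_(i < 3) f i x) = (fun x => f ord0 x + (f 1 x + f ord_max x)).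
  apply/funext => x; rewrite !big_ord_recl big_ord0 addr0; congr (_ + (f _ _ + f _ _));
  exact/val_inj.
by do 2 (apply: admissible1D => //).
Qed.

Lemma admissible1N u : admissible1 u -> admissible1 (fun x => - u x).
Proof.
move=> hu; have := admissible1M (weight_cst (-1)) hu.
by congr admissible1; apply/funext => x; rewrite mulN1r.
Qed.

Section regular_admissible.
Variables (a : mR3 R -> R) (da : 'I_3 -> mR3 R -> R) (dda : 'I_3 -> 'I_3 -> mR3 R -> R).
Hypothesis ra : regular a da dda.

Lemma regular_admissible1 : admissible1 a.
Proof.
split; first exact: reg_sq ra.
exact: has_partial_line_continuous (reg_d ra).
Qed.

Lemma regular_admissible1_d j : admissible1 (da j).
Proof.
split; first exact: reg_dsq ra j.
exact: (@has_partial_line_continuous (da j) _ (fun i => reg_dd ra i j)).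
Qed.

Lemma regular_admissible1_dd i j : admissible1 (dda i j).
Proof. by split; [exact: reg_ddsq ra i j|exact: reg_ddc ra i j]. Qed.

End regular_admissible.

Lemma integral_divergence_eq0 (F G : 'I_3 -> mR3 R -> R) :
  (forall i, has_partial i (F i) (G i)) -> (forall i, mu.-integrable setT (EFin \o F i)) ->
  (forall i, admissible (G i)) ->
  mu.-integrable setT (EFin \o (fun x => \sum_(i < 3) G i x)) /\
  (\int[mu]_x (\sum_(i < 3) G i x)%:E = 0)%E.
Proof.
move=> FG iF aG; split; first by have [] := admissible_sum aG.
have i0 i : (\int[mu]_x (G i x)%:E = 0)%E.
  by apply: (integral_partial_eq0 (FG i)) => //; [move=> x; exact: (aG i).2|exact: (aG i).1].
under eq_integral do rewrite !big_ord_recl big_ord0 addr0 !EFinD.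
rewrite integralD//=; [|exact: (aG _).1|].
  rewrite i0 add0e integralD//=; [|exact: (aG _).1|exact: (aG _).1].
  by rewrite !i0 adde0.
by apply: (@integrableD _ _ _ mu _ measurableT (EFin \o G _) (EFin \o G _)); exact: (aG _).1.
Qed.

Section identity.
Variables (s : mR3 R -> R) (y : 'I_3 -> mR3 R -> R).
Hypothesis ws : weight s.
Hypothesis wy : forall j, weight (y j).
(* s and y stand for (r ^ 2 + |x - c| ^ 2) ^ (-1/2) and s (x - c), of which the
   identity involves only the following differential relations. *)
Hypothesis ds : forall i, has_partial i s (fun x => - (y i x * s x * s x)).
Hypothesis dy : forall i j,
  has_partial i (y j) (fun x => (i == j)%:R * s x + - (y i x * y j x * s x)).
Variables (a : mR3 R -> R) (da : 'I_3 -> mR3 R -> R) (dda : 'I_3 -> 'I_3 -> mR3 R -> R).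
Hypothesis ra : regular a da dda.
Variable l : R.

(** The field obtained when Delta a + l ^ 2 a is multiplied by y . grad a + s a and
    written as a divergence. *)
Definition flux (i : 'I_3) (x : mR3 R) : R :=
  (\sum_(j < 3) y j x * da j x) * da i x
  + (\sum_(j < 3) (- 2^-1 * y i x * da j x) * da j x)
  + s x * a x * da i x + 2^-1 * (y i x * s x * s x + l ^+ 2 * y i x) * a x * a x.

Definition dflux (i : 'I_3) (x : mR3 R) : R :=
  (\sum_(j < 3) (((i == j)%:R * s x + - (y i x * y j x * s x)) * da j x + y j x * dda i j x)) * da i x
  + (\sum_(j < 3) y j x * da j x) * dda i i x
  + (\sum_(j < 3) (- (y i x) * da j x) * dda i j x)
  + (\sum_(j < 3) ((- 2^-1) * (s x + - (y i x * y i x * s x)) * da j x) * da j x)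
  + (s x * da i x) * da i x + s x * a x * dda i i x
  + 2^-1 * ((s x + - (3 * (y i x * y i x * s x))) * s x * s x + l ^+ 2 * (s x + - (y i x * y i x * s x))) * a x * a x
  + l ^+ 2 * y i x * a x * da i x.

Lemma has_partial_flux i : has_partial i (flux i) (dflux i).
Proof.
move=> x; rewrite /flux /dflux !big_ord_recl !big_ord0.
have x0 : x + (0 : R) *: basis3 R i = x by rewrite scale0r addr0.
have Hs := ds i x; have Ha := reg_d ra i x.
have Hyi := dy i i x.
have Hy0 := dy i ord0 x; have Hy1 := dy i (lift ord0 ord0) x;
have Hy2 := dy i (lift ord0 (lift ord0 ord0)) x.
have Hai := reg_dd ra i i x.
have Ha0 := reg_dd ra i ord0 x; have Ha1 := reg_dd ra i (lift ord0 ord0) x;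
have Ha2 := reg_dd ra i (lift ord0 (lift ord0 ord0)) x.
under eq_fun do rewrite !big_ord_recl !big_ord0.
by apply: is_derive_eq; rewrite /GRing.scale/= x0 eqxx/=; field.
Qed.

Ltac weight_tac := repeat first
  [ exact: ws | exact: wy | exact: weight_cst | apply: weightN | apply: weightD
  | apply: weightM ].

Ltac admissible_tac := repeat first
  [ exact: (regular_admissible1 ra) | exact: (regular_admissible1_d ra)
  | exact: (regular_admissible1_dd ra)
  | apply: admissible_sum => ? | apply: admissibleD | apply: admissibleM
  | apply: admissible1_sum => ? | apply: admissible1D
  | apply: admissible1M; first by weight_tac ].

Lemma admissible_flux i : admissible (flux i).
Proof. by rewrite /flux; admissible_tac. Qed.

Lemma admissible_dflux i : admissible (dflux i).
Proof. by rewrite /dflux; admissible_tac. Qed.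

(** The density in front of the energy; it is half the smallest eigenvalue
    s (1 - |y| ^ 2) of the Hessian of (r ^ 2 + |x - c| ^ 2) ^ (1/2). *)
Definition profile (x : mR3 R) : R := 2^-1 * s x * (1 - \sum_(j < 3) y j x ^+ 2).

(** The gradient terms are those of the Hessian s (1 - y y^T) of
    (r ^ 2 + |x - c| ^ 2) ^ (1/2), corrected by s - (div y) / 2. They are regrouped
    as the profile times |grad a| ^ 2 and a Gram determinant, the third line,
    which is nonnegative. The last line is minus half the Laplacian of s, times
    a ^ 2. *)
Lemma sum_dflux (x : mR3 R) : \sum_(i < 3) dflux i x =
  (\sum_(j < 3) y j x * da j x + s x * a x) * (\sum_(i < 3) dda i i x + l ^+ 2 * a x)
  + profile x * (\sum_(j < 3) da j x ^+ 2 + l ^+ 2 * a x ^+ 2)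
  + s x * ((\sum_(j < 3) y j x ^+ 2) * (\sum_(j < 3) da j x ^+ 2)
           - (\sum_(j < 3) y j x * da j x) ^+ 2)
  + 3 * s x ^+ 2 * profile x * a x ^+ 2.
Proof.
rewrite /profile /dflux !big_ord_recl !big_ord0/=.
rewrite (reg_sym ra (lift ord0 ord0) ord0) (reg_sym ra (lift ord0 (lift ord0 ord0)) ord0).
rewrite (reg_sym ra (lift ord0 (lift ord0 ord0)) (lift ord0 ord0)).
by field.
Qed.

Lemma le_sum_dflux (x : mR3 R) : 0 <= s x -> \sum_(j < 3) y j x ^+ 2 <= 1 ->
  (\sum_(j < 3) y j x * da j x + s x * a x) * (\sum_(i < 3) dda i i x + l ^+ 2 * a x)
  + profile x * (\sum_(j < 3) da j x ^+ 2 + l ^+ 2 * a x ^+ 2)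
  <= \sum_(i < 3) dflux i x.
Proof.
move=> s0 y1; rewrite sum_dflux -!addrA lerD2l lerDl addr_ge0//.
  apply: mulr_ge0 => //; rewrite !big_ord_recl !big_ord0 !addr0.
  move: (y _ x) (y _ x) (y _ x) (da _ x) (da _ x) (da _ x) => y1' y2 y3 d1 d2 d3.
  (* Lagrange's identity for y and grad a *)
  have := sqr_ge0 (y1' * d2 - y2 * d1); have := sqr_ge0 (y1' * d3 - y3 * d1).
  have := sqr_ge0 (y2 * d3 - y3 * d2); nra.
have p0 : 0 <= profile x by rewrite /profile !mulr_ge0// ?invr_ge0// subr_ge0.
by rewrite mulr_ge0 ?sqr_ge0// mulr_ge0// mulr_ge0// sqr_ge0.
Qed.

End identity.
End multiplier.

(** * Radial weights *)

Section radial_weights.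
Context {R : realType}.
Variables (c : R * R * R) (r : R).
Hypothesis r0 : 0 < r.

Definition radial_q (x : R * R * R) : R := r ^+ 2 + \sum_(j < 3) (coord j x - coord j c) ^+ 2.

(** The power q ^ (-1/2), in a form that the chain rule differentiates. *)
Definition radial_s (x : R * R * R) : R := expR (- (2^-1 * ln (radial_q x))).

Definition radial_y (j : 'I_3) (x : R * R * R) : R := (coord j x - coord j c) * radial_s x.

Lemma radial_q_gt0 x : 0 < radial_q x.
Proof. by rewrite /radial_q ltr_wpDr ?exprn_gt0// sumr_ge0// => j _; rewrite sqr_ge0. Qed.

Lemma radial_s_gt0 x : 0 < radial_s x. Proof. exact: expR_gt0. Qed.

Lemma radial_sq x : radial_s x ^+ 2 * radial_q x = 1.
Proof.
have q0 := radial_q_gt0 x.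
have e : ln (radial_q x) = 2^-1 * ln (radial_q x) + 2^-1 * ln (radial_q x) by field.
rewrite /radial_s expr2 -expRD -opprD -e expRN lnK ?posrE//.
by rewrite mulVf// gt_eqF.
Qed.

Lemma radial_s_le x : radial_s x <= r^-1.
Proof.
have s0 := radial_s_gt0 x.
rewrite -(ler_pXn2r (isT : (0 < 2)%N)) ?nnegrE ?invr_ge0 ?(ltW s0) ?(ltW r0)//.
rewrite exprVn -div1r ler_pdivlMr ?exprn_gt0// -(radial_sq x) ler_wpM2l ?sqr_ge0//.
by rewrite /radial_q lerDl sumr_ge0// => j _; rewrite sqr_ge0.
Qed.

Lemma sum_radial_y x : \sum_(j < 3) radial_y j x ^+ 2 = 1 - r ^+ 2 * radial_s x ^+ 2.
Proof.
have -> : \sum_(j < 3) radial_y j x ^+ 2 =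
    radial_s x ^+ 2 * \sum_(j < 3) (coord j x - coord j c) ^+ 2.
  by rewrite mulr_sumr; apply: eq_bigr => j _; rewrite /radial_y exprMn mulrC.
by have := radial_sq x; rewrite /radial_q; move: (\sum_(j < 3) _) => S; lra.
Qed.

Lemma sum_radial_y_le1 x : \sum_(j < 3) radial_y j x ^+ 2 <= 1.
Proof. by rewrite sum_radial_y lerBlDr lerDl mulr_ge0// sqr_ge0. Qed.

Lemma radial_y_le1 j x : `|radial_y j x| <= 1.
Proof.
rewrite -(ler_pXn2r (isT : (0 < 2)%N)) ?nnegrE// real_normK ?num_real// expr1n.
apply: le_trans (sum_radial_y_le1 x); rewrite (bigD1 j)//= lerDl.
by rewrite sumr_ge0// => k _; rewrite sqr_ge0.
Qed.

Lemma has_partial_coord i j : has_partial i (fun x => coord j x - coord j c) (fun=> (i == j)%:R).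
Proof.
move=> x; rewrite (_ : (fun t : R => _) = (fun t : R => (coord j x - coord j c) + t * (i == j)%:R)).
  by apply: is_derive_eq; rewrite /GRing.scale/=; ring.
by apply/funext => t; rewrite coordD coordZ coord_basis addrAC.
Qed.

Lemma has_partial_q i : has_partial i radial_q (fun x => 2 * (coord i x - coord i c)).
Proof.
move=> x; rewrite /radial_q.
have H j := has_partial_coord i j x.
have H0 := H ord0; have H1 := H (lift ord0 ord0); have H2 := H (lift ord0 (lift ord0 ord0)).
under eq_fun do rewrite !big_ord_recl !big_ord0 !expr2.
apply: is_derive_eq; rewrite scale0r addr0 /GRing.scale/=.
have -> : coord i x - coord i c = \sum_(j < 3) (coord j x - coord j c) * (i == j)%:R.
  rewrite (bigD1 i)//= eqxx mulr1 big1 ?addr0// => j ji.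
  by rewrite eq_sym (negbTE ji) mulr0.
by rewrite !big_ord_recl !big_ord0; ring.
Qed.

Lemma has_partial_s i :
  has_partial i radial_s (fun x => - (radial_y i x * radial_s x * radial_s x)).
Proof.
move=> x; rewrite /radial_s.
have x0 : x + (0 : R) *: basis3 R i = x by rewrite scale0r addr0.
have Hq := has_partial_q i x.
have q0 : 0 < radial_q (x + (0 : R) *: basis3 R i) by exact: radial_q_gt0.
have Hl := @is_derive1_comp _ (@ln R) (fun t : R => radial_q (x + t *: basis3 R i)) 0 _ _
  (is_derive1_ln q0) Hq.
have Hl2 : is_derive (0 : R) 1 (fun t : R => - (2^-1 * ln (radial_q (x + t *: basis3 R i))))
    (- (2^-1 * ((radial_q x)^-1 * (2 * (coord i x - coord i c))))).
  by apply: is_derive_eq; rewrite x0 /GRing.scale/=.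
have := @is_derive1_comp _ expR _ 0 _ _ (is_derive_expR _) Hl2.
move=> H; apply: (is_derive_eq H); rewrite x0 -/(radial_s x) /radial_y.
have -> : (radial_q x)^-1 = radial_s x ^+ 2.
  by rewrite -[LHS]mul1r -(radial_sq x) mulfK// gt_eqF// radial_q_gt0.
by field.
Qed.

Lemma has_partial_y i j : has_partial i (radial_y j)
  (fun x => (i == j)%:R * radial_s x + - (radial_y i x * radial_y j x * radial_s x)).
Proof.
move=> x; have x0 : x + (0 : R) *: basis3 R i = x by rewrite scale0r addr0.
have H1 := has_partial_coord i j x; have H2 := has_partial_s i x.
rewrite /radial_y; apply: (is_derive_eq (is_deriveM H1 H2)); rewrite x0 /GRing.scale/= /radial_y.
by ring.
Qed.

Lemma weight_radial_s : weight (radial_s : mR3 R -> R).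
Proof.
split; last exact: has_partial_line_continuous has_partial_s.
  apply: (measurableT_comp (@measurable_expR R)) => //; apply: measurableT_comp => //.
  apply: measurable_funM => //; apply: (measurableT_comp (@measurable_ln R)).
  apply: measurable_funD => //; apply: measurable_sum => j; apply: measurable_funX.
  by apply: measurable_funB => //; exact: measurable_coord.
by exists r^-1 => x; rewrite ger0_norm ?radial_s_le// ltW// radial_s_gt0.
Qed.

Lemma weight_radial_y j : weight (radial_y j : mR3 R -> R).
Proof.
split; last exact: (@has_partial_line_continuous _ (radial_y j) _ (fun i => has_partial_y i j)).
  apply: measurable_funM; last by case: weight_radial_s.
  by apply: measurable_funB => //; exact: measurable_coord.
by exists 1 => x; exact: radial_y_le1.
Qed.

Lemma radial_profileE x : profile (radial_s : mR3 R -> R) radial_y x = 2^-1 * r ^+ 2 * radial_s x ^+ 3.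
Proof. by rewrite /profile sum_radial_y; ring. Qed.

(** On the ball r s >= 2 ^ (-1/2) >= 2 / 3, and (2 / 3) ^ 3 / 2 >= 1 / 7. *)
Lemma radial_profile_lower x : \sum_(j < 3) (coord j x - coord j c) ^+ 2 < r ^+ 2 ->
  (7 * r)^-1 <= profile (radial_s : mR3 R -> R) radial_y x.
Proof.
move=> xr; rewrite radial_profileE; have s0 := radial_s_gt0 x; have sq := radial_sq x.
have sr : 2 / 3 <= r * radial_s x.
  rewrite -(ler_pXn2r (isT : (0 < 2)%N)) ?nnegrE ?mulr_ge0 ?divr_ge0 ?(ltW s0) ?(ltW r0)//.
  have : 1 <= 2 * (r * radial_s x) ^+ 2.
    have h : 0 <= radial_s x ^+ 2 * (r ^+ 2 - \sum_(j < 3) (coord j x - coord j c) ^+ 2).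
      by rewrite mulr_ge0 ?sqr_ge0// subr_ge0 ltW.
    move: sq h; rewrite /radial_q exprMn; move: (\sum_(j < 3) _) => S; lra.
  by rewrite expr2; lra.
have -> : 2^-1 * r ^+ 2 * radial_s x ^+ 3 = 2^-1 * (r * radial_s x) ^+ 3 / r.
  by field; rewrite gt_eqF.
rewrite invfM ler_wpM2r ?invr_ge0 ?(ltW r0)//.
have : (2 / 3) ^+ 3 <= (r * radial_s x) ^+ 3.
  by rewrite lerXn2r// nnegrE ?mulr_ge0 ?divr_ge0 ?(ltW s0) ?(ltW r0).
by rewrite !exprS expr0; lra.
Qed.

End radial_weights.

(** * Energy estimates for the damped system *)

Section helmholtz_system.
Context {R : realType}.
Local Notation mu := (lebesgue3 R).
Variables (a b : mR3 R -> R) (da db : 'I_3 -> mR3 R -> R) (dda ddb : 'I_3 -> 'I_3 -> mR3 R -> R).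
Hypothesis ra : regular a da dda.
Hypothesis rb : regular b db ddb.
Variables (p q : mR3 R -> R) (l m : R).
Hypothesis mp : measurable_fun setT p.
Hypothesis mq : measurable_fun setT q.
Hypothesis l0 : 0 < l.
Hypothesis m0 : 0 < m.
Hypothesis eqa : forall x, \sum_(i < 3) dda i i x + l ^+ 2 * a x + m * b x = p x.
Hypothesis eqb : forall x, \sum_(i < 3) ddb i i x + l ^+ 2 * b x - m * a x = q x.

Definition energy_density (x : mR3 R) : R :=
  \sum_(j < 3) (da j x ^+ 2 + db j x ^+ 2) + l ^+ 2 * (a x ^+ 2 + b x ^+ 2).

Definition amplitude (x : mR3 R) : R :=
  \sum_(j < 3) (`|da j x| + `|db j x|) + l * (`|a x| + `|b x|).

Definition coupling (x : mR3 R) : R := (`|p x| + `|q x|) * amplitude x.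

Lemma energy_density_ge0 x : 0 <= energy_density x.
Proof.
apply: addr_ge0; first by apply: sumr_ge0 => j _; rewrite addr_ge0 ?sqr_ge0.
by rewrite mulr_ge0 ?addr_ge0 ?sqr_ge0.
Qed.

Lemma amplitude_ge0 x : 0 <= amplitude x.
Proof.
apply: addr_ge0; first by apply: sumr_ge0 => j _; rewrite addr_ge0.
by rewrite mulr_ge0 ?addr_ge0 ?(ltW l0).
Qed.

Lemma coupling_ge0 x : 0 <= coupling x.
Proof. by rewrite mulr_ge0 ?amplitude_ge0// addr_ge0. Qed.

Lemma measurable_energy_density : measurable_fun setT energy_density.
Proof.
have ma := (reg_sq ra).1; have mb := (reg_sq rb).1.
apply: measurable_funD; last first.
  by apply: measurable_funM => //; apply: measurable_funD; exact: measurable_funX.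
apply: measurable_sum => j; apply: measurable_funD; apply: measurable_funX.
  exact: (reg_dsq ra j).1.
exact: (reg_dsq rb j).1.
Qed.

Lemma measurable_amplitude : measurable_fun setT amplitude.
Proof.
have ma := (reg_sq ra).1; have mb := (reg_sq rb).1.
apply: measurable_funD; last first.
  by apply: measurable_funM => //; apply: measurable_funD; exact: measurableT_comp.
apply: measurable_sum => j; apply: measurable_funD; apply: measurableT_comp => //.
  exact: (reg_dsq ra j).1.
exact: (reg_dsq rb j).1.
Qed.

Lemma measurable_coupling : measurable_fun setT coupling.
Proof.
apply: measurable_funM; last exact: measurable_amplitude.
by apply: measurable_funD; exact: measurableT_comp.
Qed.

(** Cauchy-Schwarz for a sum of eight terms. *)
Lemma sqr_amplitude_le x : amplitude x ^+ 2 <= 8 * energy_density x.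
Proof.
rewrite /amplitude /energy_density !big_ord_recl !big_ord0 !addr0.
have E (z : R) : z ^+ 2 = `|z| ^+ 2 by rewrite real_normK ?num_real.
rewrite mulrDr [l ^+ 2 * _]mulrDr -!exprMn.
rewrite (E (da _ x)) (E (da (lift _ _) x)) (E (da (lift _ (lift _ _)) x)).
rewrite (E (db _ x)) (E (db (lift _ _) x)) (E (db (lift _ (lift _ _)) x)).
rewrite (E (l * a x)) (E (l * b x)) !normrM (gtr0_norm l0).
move: `|da _ _| `|da _ _| `|da _ _| `|db _ _| `|db _ _| `|db _ _| (l * `|a x|) (l * `|b x|).
move=> z1 z2 z3 z4 z5 z6 z7 z8.
have h1 := sqr_ge0 (z1 - z4); have h2 := sqr_ge0 (z2 - z5).
have h3 := sqr_ge0 (z3 - z6); have h4 := sqr_ge0 (z7 - z8).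
have h5 := sqr_ge0 (z1 + z4 - (z2 + z5)); have h6 := sqr_ge0 (z1 + z4 - (z3 + z6)).
have h7 := sqr_ge0 (z1 + z4 - (z7 + z8)); have h8 := sqr_ge0 (z2 + z5 - (z3 + z6)).
have h9 := sqr_ge0 (z2 + z5 - (z7 + z8)); have h10 := sqr_ge0 (z3 + z6 - (z7 + z8)).
by lra.
Qed.

(* The imaginary and the real part of conj u grad u: the divergence of the first
   carries the damping, that of the second compares |grad u| ^ 2 with
   l ^ 2 |u| ^ 2. *)
Let flux_im i (x : mR3 R) := a x * db i x + (- b x) * da i x.
Let dflux_im i (x : mR3 R) := a x * ddb i i x + (- b x) * dda i i x.
Let flux_re i (x : mR3 R) := a x * da i x + b x * db i x.
Let dflux_re i (x : mR3 R) :=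
  (a x * dda i i x + da i x * da i x) + (b x * ddb i i x + db i x * db i x).

Lemma divergence_im : mu.-integrable setT (EFin \o (fun x => \sum_(i < 3) dflux_im i x)) /\
  (\int[mu]_x (\sum_(i < 3) dflux_im i x)%:E = 0)%E.
Proof.
apply: (@integral_divergence_eq0 _ flux_im).
- move=> i x; rewrite /flux_im /dflux_im.
  have Ha := reg_d ra i x; have Hb := reg_d rb i x.
  have Ha2 := reg_dd ra i i x; have Hb2 := reg_dd rb i i x.
  by apply: is_derive_eq; rewrite scale0r addr0 /GRing.scale/=; ring.
- move=> i; suff [] : admissible (flux_im i) by [].
  rewrite /flux_im; apply: admissibleD; apply: admissibleM.
  + exact: (regular_admissible1 ra). + exact: (regular_admissible1_d rb i).
  + by apply: admissible1N; exact: (regular_admissible1 rb). + exact: (regular_admissible1_d ra i).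
- move=> i; rewrite /dflux_im; apply: admissibleD; apply: admissibleM.
  + exact: (regular_admissible1 ra). + exact: (regular_admissible1_dd rb i i).
  + by apply: admissible1N; exact: (regular_admissible1 rb). + exact: (regular_admissible1_dd ra i i).
Qed.

Lemma divergence_re : mu.-integrable setT (EFin \o (fun x => \sum_(i < 3) dflux_re i x)) /\
  (\int[mu]_x (\sum_(i < 3) dflux_re i x)%:E = 0)%E.
Proof.
apply: (@integral_divergence_eq0 _ flux_re).
- move=> i x; rewrite /flux_re /dflux_re.
  have Ha := reg_d ra i x; have Hb := reg_d rb i x.
  have Ha2 := reg_dd ra i i x; have Hb2 := reg_dd rb i i x.
  by apply: is_derive_eq; rewrite scale0r addr0 /GRing.scale/=; ring.
- move=> i; suff [] : admissible (flux_re i) by [].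
  rewrite /flux_re; apply: admissibleD; apply: admissibleM.
  + exact: (regular_admissible1 ra). + exact: (regular_admissible1_d ra i).
  + exact: (regular_admissible1 rb). + exact: (regular_admissible1_d rb i).
- move=> i; rewrite /dflux_re; apply: admissibleD; apply: admissibleD; apply: admissibleM.
  + exact: (regular_admissible1 ra). + exact: (regular_admissible1_dd ra i i).
  + exact: (regular_admissible1_d ra i). + exact: (regular_admissible1_d ra i).
  + exact: (regular_admissible1 rb). + exact: (regular_admissible1_dd rb i i).
  + exact: (regular_admissible1_d rb i). + exact: (regular_admissible1_d rb i).
Qed.

Lemma sum_dflux_im x :
  \sum_(i < 3) dflux_im i x = m * (a x ^+ 2 + b x ^+ 2) + (a x * q x - b x * p x).
Proof.
rewrite big_split/= -!mulr_sumr.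
have -> : \sum_(i < 3) ddb i i x = q x - l ^+ 2 * b x + m * a x by rewrite -eqb; ring.
have -> : \sum_(i < 3) dda i i x = p x - l ^+ 2 * a x - m * b x by rewrite -eqa; ring.
by ring.
Qed.

Lemma sum_dflux_re x : \sum_(i < 3) dflux_re i x =
  \sum_(j < 3) (da j x ^+ 2 + db j x ^+ 2) - l ^+ 2 * (a x ^+ 2 + b x ^+ 2)
  + (a x * p x + b x * q x).
Proof.
rewrite /dflux_re !big_split/= -!mulr_sumr.
have -> : \sum_(i < 3) ddb i i x = q x - l ^+ 2 * b x + m * a x by rewrite -eqb; ring.
have -> : \sum_(i < 3) dda i i x = p x - l ^+ 2 * a x - m * b x by rewrite -eqa; ring.
under [X in _ = X + _ - _ + _]eq_bigr do rewrite expr2.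
under [X in _ = _ + X - _ + _]eq_bigr do rewrite expr2.
by ring.
Qed.

(** The imaginary energy identity and Young's inequality; this is the estimate for
    strong damping. *)
Lemma damped_energy :
  (\int[mu]_x ((m * (a x ^+ 2 + b x ^+ 2))%:E) <= \int[mu]_x ((m^-1 * (p x ^+ 2 + q x ^+ 2))%:E))%E.
Proof.
have ma := (reg_sq ra).1; have mb := (reg_sq rb).1.
have [i1 i0] := divergence_im.
have i2 : mu.-integrable setT (EFin \o (fun x => 2 * \sum_(i < 3) dflux_im i x)).
  by apply: eq_integrable (integrableZl measurableT 2 i1) => // x _; rewrite /= EFinM.
apply: (@integral_le_of_null_divergence _ _ _ mu _ _ (fun x => 2 * \sum_(i < 3) dflux_im i x)) => //.
- by apply: measurable_funM => //; apply: measurable_funD; exact: measurable_funX.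
- by apply: measurable_funM => //; apply: measurable_funD; exact: measurable_funX.
- under eq_integral do rewrite EFinM.
  by rewrite integralZl// i0 mule0.
- by move=> x; rewrite mulr_ge0 ?addr_ge0 ?sqr_ge0// ltW.
- move=> x; rewrite sum_dflux_im -subr_ge0.
  rewrite [leRHS](_ : _ = m^-1 * ((m * a x + q x) ^+ 2 + (m * b x - p x) ^+ 2)).
    by rewrite mulr_ge0 ?addr_ge0 ?sqr_ge0// invr_ge0 ltW.
  by field; rewrite gt_eqF.
- by move=> x; rewrite mulr_ge0 ?addr_ge0 ?sqr_ge0// invr_ge0 ltW.
Qed.

Section weak_damping.
Hypothesis ml : m <= l ^+ 2.
Variables (c : R * R * R) (r : R).
Hypothesis lr : l^-1 <= r.

Let r0 : 0 < r. Proof. by rewrite (lt_le_trans _ lr)// invr_gt0. Qed.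
Let s := radial_s c r : mR3 R -> R.
Let y := radial_y c r : 'I_3 -> mR3 R -> R.

Let young (z u v : R) : `|z| <= 1 -> z * (u * v) <= 2^-1 * (l * u ^+ 2 + l^-1 * v ^+ 2).
Proof.
move=> z1; apply: (@le_trans _ _ (`|u| * `|v|)).
  rewrite (le_trans (ler_norm _))// normrM normrM.
  by rewrite -[leRHS]mul1r ler_wpM2r// mulr_ge0.
rewrite -(real_normK (num_real u)) -(real_normK (num_real v)) -subr_ge0.
rewrite [leRHS](_ : _ = (2 * l)^-1 * (l * `|u| - `|v|) ^+ 2); last first.
  by field; rewrite gt_eqF.
by rewrite mulr_ge0 ?sqr_ge0// invr_ge0 mulr_ge0// ltW.
Qed.

(* s <= 1 / r <= l, which is where the restriction on r comes from *)
Let multiplier_le (u : mR3 R -> R) du x :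
  `|\sum_(j < 3) y j x * du j x + s x * u x| <= \sum_(j < 3) `|du j x| + l * `|u x|.
Proof.
apply: le_trans (ler_normD _ _) _; apply: lerD.
  apply: le_trans (ler_norm_sum _ _ _) _; apply: ler_sum => j _.
  by rewrite normrM -[leRHS]mul1r ler_wpM2r// radial_y_le1.
rewrite normrM ler_wpM2r// ger0_norm ?(ltW (radial_s_gt0 c r x))//.
apply: le_trans (radial_s_le c r0 x) _.
by rewrite invf_ple ?posrE.
Qed.

Let ws : weight s. Proof. exact: weight_radial_s. Qed.

Let wy j : weight (y j). Proof. exact: weight_radial_y. Qed.

Let measurable_profile : measurable_fun setT (profile s y).
Proof.
apply: measurable_funM; first by apply: measurable_funM => //; case: ws.
apply: measurable_funB => //; apply: measurable_sum => j; apply: measurable_funX.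
by case: (wy j).
Qed.

Let profile_ge0 x : 0 <= profile s y x.
Proof.
rewrite /profile mulr_ge0//; first by rewrite mulr_ge0// ltW// radial_s_gt0.
by rewrite subr_ge0 sum_radial_y_le1.
Qed.

(** The sum of the multiplier identities for a and b. Damping couples the two by a
    cross term, bounded by (3 / 2) m l |u| ^ 2 + m / (2 l) |grad u| ^ 2; these are
    exactly the gains of 2 l times the imaginary and m / (2 l) times the real
    energy identity. The assumption m <= l ^ 2 bounds the price m / (2 l) of the
    latter by l / 2. *)
Lemma weighted_energy_pointwise x : profile s y x * energy_density x <=
  (\sum_(i < 3) dflux s y a da dda l i x + \sum_(i < 3) dflux s y b db ddb l i x
   + 2 * l * \sum_(i < 3) dflux_im i x + m / (2 * l) * \sum_(i < 3) dflux_re i x)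
  + 2 * coupling x.
Proof.
have s0 : 0 <= s x := ltW (radial_s_gt0 c r x).
have y1 := sum_radial_y_le1 c r0 x.
have := le_sum_dflux ra l s0 y1; have := le_sum_dflux rb l s0 y1.
have -> : \sum_(i < 3) ddb i i x + l ^+ 2 * b x = q x + m * a x by rewrite -eqb; ring.
have -> : \sum_(i < 3) dda i i x + l ^+ 2 * a x = p x - m * b x by rewrite -eqa; ring.
rewrite sum_dflux_im sum_dflux_re.
have := multiplier_le a da x; have := multiplier_le b db x.
have cross : m * (b x * (\sum_(j < 3) y j x * da j x + s x * a x)
    - a x * (\sum_(j < 3) y j x * db j x + s x * b x)) <=
    3 * m * l / 2 * (a x ^+ 2 + b x ^+ 2)
    + m / (2 * l) * \sum_(j < 3) (da j x ^+ 2 + db j x ^+ 2).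
  have E : b x * (\sum_(j < 3) y j x * da j x + s x * a x)
    - a x * (\sum_(j < 3) y j x * db j x + s x * b x) =
    \sum_(j < 3) (y j x * (b x * da j x) + (- y j x) * (a x * db j x)).
    rewrite !mulrDr !mulr_sumr big_split/=.
    rewrite [X in X + _ - _](_ : _ = \sum_(i < 3) y i x * (b x * da i x)); last first.
      by apply: eq_bigr => j _; ring.
    rewrite [X in _ - (X + _)](_ : _ = - \sum_(i < 3) - y i x * (a x * db i x)); last first.
      by rewrite -sumrN; apply: eq_bigr => j _; ring.
    by ring.
  have F : \sum_(j < 3) (y j x * (b x * da j x) + (- y j x) * (a x * db j x)) <=
    \sum_(j < 3) (2^-1 * (l * b x ^+ 2 + l^-1 * da j x ^+ 2)
                  + 2^-1 * (l * a x ^+ 2 + l^-1 * db j x ^+ 2)).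
    apply: ler_sum => j _; apply: lerD; apply: young; first exact: radial_y_le1.
    by rewrite normrN; exact: radial_y_le1.
  rewrite E; apply: (@le_trans _ _ (m * \sum_(j < 3) (2^-1 * (l * b x ^+ 2 + l^-1 * da j x ^+ 2)
                  + 2^-1 * (l * a x ^+ 2 + l^-1 * db j x ^+ 2)))).
    by rewrite ler_wpM2l// ltW.
  rewrite le_eqVlt; apply/orP; left; apply/eqP.
  by rewrite !big_ord_recl !big_ord0; field; rewrite gt_eqF.
have kl : m / (2 * l) <= l / 2.
  rewrite ler_pdivrMr ?mulr_gt0//; have := ml; rewrite expr2; lra.
have k0 : 0 <= m / (2 * l) by rewrite divr_ge0 ?mulr_ge0// ltW.
have lin (Mz z w pz : R) (S : R) : `|Mz| <= S + l * `|z| -> 0 <= S ->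
   pz * (- Mz + 2 * l * w - m / (2 * l) * z) <= 2 * `|pz| * (S + l * (`|z| + `|w|)).
  move=> hM S0; apply: le_trans (ler_norm _) _.
  rewrite normrM [leRHS](_ : _ = `|pz| * (2 * (S + l * (`|z| + `|w|)))); last by ring.
  apply: ler_wpM2l => //.
  have h1 : `|- Mz + 2 * l * w - m / (2 * l) * z| <= `|Mz| + 2 * l * `|w| + m / (2 * l) * `|z|.
    apply: le_trans (ler_normB _ _) _; rewrite [X in _ + X]normrM (ger0_norm k0) lerD2r.
    apply: le_trans (ler_normD _ _) _; rewrite normrN lerD2l !normrM.
    by rewrite (gtr0_norm l0) ger0_norm.
  have h2 : m / (2 * l) * `|z| <= l / 2 * `|z| by rewrite ler_wpM2r.
  have h3 : 0 <= l * `|z| by rewrite mulr_ge0// ltW.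
  by lra.
set Ma := \sum_(j < 3) y j x * da j x + s x * a x in cross *.
set Mb := \sum_(j < 3) y j x * db j x + s x * b x in cross *.
move=> hMb hMa hb ha.
have Sa0 : 0 <= \sum_(j < 3) `|da j x| by exact: sumr_ge0.
have Sb0 : 0 <= \sum_(j < 3) `|db j x| by exact: sumr_ge0.
have := lin Ma (a x) (b x) (p x) _ hMa Sa0.
have := lin Mb (b x) (- a x) (q x) _ hMb Sb0.
rewrite normrN => hq hp.
have am : amplitude x = \sum_(j < 3) `|da j x| + \sum_(j < 3) `|db j x| + l * (`|a x| + `|b x|).
  by rewrite /amplitude big_split.
have en : energy_density x = (\sum_(j < 3) da j x ^+ 2 + l ^+ 2 * a x ^+ 2)
   + (\sum_(j < 3) db j x ^+ 2 + l ^+ 2 * b x ^+ 2).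
  by rewrite /energy_density big_split/=; ring.
rewrite /coupling am en.
have P0 : 0 <= `|p x| * \sum_(j < 3) `|db j x| by exact: mulr_ge0.
have Q0 : 0 <= `|q x| * \sum_(j < 3) `|da j x| by exact: mulr_ge0.
have kl2 : m / (2 * l) * l ^+ 2 = m * l / 2 by field; rewrite gt_eqF.
have ka : m / (2 * l) * l ^+ 2 * a x ^+ 2 = m * l / 2 * a x ^+ 2 by rewrite kl2.
have kb : m / (2 * l) * l ^+ 2 * b x ^+ 2 = m * l / 2 * b x ^+ 2 by rewrite kl2.
move: cross hp hq ha hb P0 Q0 ka kb; clear.
move: (\sum_(i < 3) dflux _ _ a _ _ _ _ _) (\sum_(i < 3) dflux _ _ b _ _ _ _ _) => G1 G2.
move: (\sum_(j < 3) (da j x ^+ 2 + db j x ^+ 2)) (\sum_(j < 3) da j x ^+ 2) (\sum_(j < 3) db j x ^+ 2).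
move=> T T1 T2.
move: (\sum_(j < 3) `|da j x|) (\sum_(j < 3) `|db j x|) (profile s y x) => Sa Sb ph.
move: Ma Mb (a x) (b x) (p x) (q x) `|a x| `|b x| `|p x| `|q x|.
move=> Ma Mb a0 b0 p0 q0 na nb np nq.
move: (m / (2 * l)) => k.
by lra.
Qed.

Lemma weighted_energy : (\int[mu]_x (profile s y x * energy_density x)%:E <=
  2%:E * \int[mu]_x (coupling x)%:E)%E.
Proof.
have mc := measurable_coupling.
have [im1 im0] := divergence_im; have [re1 re0] := divergence_re.
have ds i := has_partial_s c r0 i.
have dy i j := has_partial_y c r0 i j.
have div u du ddu (ru : regular u du ddu) :=
  integral_divergence_eq0 (has_partial_flux ds dy ru l)
    (fun i => (admissible_flux ws wy ru l i).1) (admissible_dflux ws wy ru l).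
have [a1 a0] := div _ _ _ ra; have [b1 b0] := div _ _ _ rb.
have im2 := integrableZl measurableT (2 * l) im1.
have re2 := integrableZl measurableT (m / (2 * l)) re1.
have ab := integrableD measurableT a1 b1.
have abi := integrableD measurableT ab im2.
have abir := integrableD measurableT abi re2.
rewrite -ge0_integralZl//; last 2 first.
- exact/measurable_EFinP.
- by move=> x _; rewrite lee_fin coupling_ge0.
apply: (@integral_le_of_null_divergence _ _ _ mu _ (fun x => 2 * coupling x)
  (fun x => \sum_(i < 3) dflux s y a da dda l i x + \sum_(i < 3) dflux s y b db ddb l i x
   + 2 * l * \sum_(i < 3) dflux_im i x + m / (2 * l) * \sum_(i < 3) dflux_re i x)).
- apply: measurable_funM; [exact: measurable_profile|exact: measurable_energy_density].
- by apply: measurable_funM.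
- by apply: eq_integrable abir => // x _; rewrite /= -!EFinM -!EFinD.
- under eq_integral do rewrite !EFinD 2!EFinM.
  have E1 := integralD measurableT abi re2; have E2 := integralD measurableT ab im2.
  have E3 := integralD measurableT a1 b1.
  have E4 := integralZl measurableT im1 (2 * l); have E5 := integralZl measurableT re1 (m / (2 * l)).
  rewrite [LHS]E1 [X in (X + _)%E]E2 [X in (X + _ + _)%E]E3 [X in (_ + X + _)%E]E4 [X in (_ + X)%E]E5.
  have Z (A B C D : \bar R) (k1 k2 : R) : A = 0%E -> B = 0%E -> C = 0%E -> D = 0%E ->
      (A + B + k1%:E * C + k2%:E * D = 0)%E.
    by move=> -> -> -> ->; rewrite !mule0 !adde0.
  exact: Z a0 b0 im0 re0.
- by move=> x; rewrite mulr_ge0 ?energy_density_ge0.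
- exact: weighted_energy_pointwise.
- by move=> x; rewrite mulr_ge0// coupling_ge0.
Qed.

(** The centre c enters the left-hand side only, a fact that lets every source be
    treated as if it were at the origin. *)
Lemma local_energy : (\int[mu]_(x in ball3 c r) (energy_density x)%:E <=
  (14 * r)%:E * \int[mu]_x (coupling x)%:E)%E.
Proof.
have mball := measurable_ball3 c r.
have me := measurable_energy_density.
have mprof := measurable_profile; have prof0 := profile_ge0.
have r7 : 0 <= 7 * r by rewrite mulr_ge0// ltW.
apply: (@le_trans _ _ ((7 * r)%:E * \int[mu]_x (profile s y x * energy_density x)%:E)%E); last first.
  have -> : 14 * r = 7 * r * 2 by ring.
  by rewrite (EFinM (7 * r) 2) -muleA lee_wpmul2l ?lee_fin// weighted_energy.
apply: (@le_trans _ _ ((7 * r)%:E * \int[mu]_(x in ball3 c r) (profile s y x * energy_density x)%:E)%E).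
  apply: ge0_le_integral_lin1 => //.
  - exact: measurable_funTS.
  - by apply: measurable_funTS; exact: measurable_funM.
  - exact: energy_density_ge0.
  - by move=> x; rewrite mulr_ge0// energy_density_ge0.
  move=> x xr; rewrite mulrA -[leLHS]mul1r ler_wpM2r ?energy_density_ge0//.
  have := ler_wpM2l r7 (radial_profile_lower r0 xr).
  by rewrite divff// mulf_neq0// gt_eqF.
apply: lee_wpmul2l; first by rewrite lee_fin.
apply: ge0_subset_integral => //.
  by apply/measurable_EFinP; exact: measurable_funM.
by move=> x _; rewrite lee_fin mulr_ge0// energy_density_ge0.
Qed.

End weak_damping.
End helmholtz_system.

(** * Continuity of translations in the mean *)

Section translation_continuity.
Context {R : realType}.
Local Notation mu := (lebesgue3 R).
Variables (z : R * R * R) (e : nat -> R).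
(* Half-open boxes are translated in the direction of the open octant only; their
   indicator functions then converge at every point. *)
Hypothesis z0 : forall j, 0 < coord j z.
Hypothesis e0 : forall n, 0 < e n.
Hypothesis ecvg : e @ \oo --> (0 : R).
Implicit Types u v : mR3 R -> R.

Definition shifted u n (x : mR3 R) : R := u ((x : R * R * R) - e n *: z).

Definition continuous_translation u : Prop := forall eps : R, 0 < eps ->
  \forall n \near \oo, (\int[mu]_x ((shifted u n x - u x) ^+ 2)%:E <= eps%:E)%E.

Lemma measurable_shifted u n : measurable_fun setT u -> measurable_fun setT (shifted u n).
Proof. by move=> m; exact: (measurableT_comp m (measurable_translate (- (e n *: z)))). Qed.

Lemma integral_shifted (h : mR3 R -> \bar R) n : measurable_fun setT h ->
  (forall x, 0 <= h x)%E ->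
  (\int[mu]_x h ((x : R * R * R) - e n *: z)%R = \int[mu]_x h x)%E.
Proof. by move=> mh h0; exact: ge0_integral_translate. Qed.

Let msq u v : measurable_fun setT u -> measurable_fun setT v ->
  measurable_fun setT (fun x => ((u x - v x) ^+ 2)%:E).
Proof. by move=> mu_ mv; apply/measurable_EFinP; apply: measurable_funX; exact: measurable_funB. Qed.

Lemma sqr_sum3_le (x1 x2 x3 : R) :
  (x1 + x2 + x3) ^+ 2 <= 3 * x1 ^+ 2 + 3 * x2 ^+ 2 + 3 * x3 ^+ 2.
Proof.
have := sqr_ge0 (x1 - x2); have := sqr_ge0 (x1 - x3); have := sqr_ge0 (x2 - x3); lra.
Qed.

(** Translations are isometries, so that an approximation of u approximates all
    translates of u equally well. *)
Lemma continuous_translation_closed u : measurable_fun setT u ->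
  (forall eps : R, 0 < eps -> exists v, [/\ measurable_fun setT v,
     (\int[mu]_x ((u x - v x) ^+ 2)%:E <= eps%:E)%E & continuous_translation v]) ->
  continuous_translation u.
Proof.
move=> mu_ h eps eps0.
have [v [mv uv cv]] := h (eps / 9) (divr_gt0 eps0 (ltr0n _ 9)).
near=> n.
have cvn : (\int[mu]_x ((shifted v n x - v x) ^+ 2)%:E <= (eps / 9)%:E)%E.
  by near: n; apply: cv; rewrite divr_gt0.
have msu := measurable_shifted n mu_; have msv := measurable_shifted n mv.
have uvn : (\int[mu]_x ((shifted u n x - shifted v n x) ^+ 2)%:E <= (eps / 9)%:E)%E.
  rewrite (@integral_shifted (fun x => ((u x - v x) ^+ 2)%:E))//; first exact: msq.
  by move=> x; rewrite lee_fin sqr_ge0.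
have vu : (\int[mu]_x ((v x - u x) ^+ 2)%:E <= (eps / 9)%:E)%E.
  by under eq_integral do rewrite -opprB sqrrN.
have md (f g : mR3 R -> R) : measurable_fun setT f -> measurable_fun setT g ->
    measurable_fun setT (fun x => (f x - g x) ^+ 2).
  by move=> mf mg; apply: measurable_funX; exact: measurable_funB.
have sq (f g : mR3 R -> R) x : 0 <= (f x - g x) ^+ 2 by exact: sqr_ge0.
apply: (@le_trans _ _ (3%:E * \int[mu]_x ((shifted u n x - shifted v n x) ^+ 2)%:E
   + 3%:E * \int[mu]_x ((shifted v n x - v x) ^+ 2)%:E
   + 3%:E * \int[mu]_x ((v x - u x) ^+ 2)%:E)%E).
  apply: ge0_le_integral_lin3; rewrite ?ler0n//; try exact: md.
  move=> x _; apply: le_trans (sqr_sum3_le _ _ _).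
  rewrite le_eqVlt; apply/orP; left; apply/eqP; congr (_ ^+ 2); ring.
have -> : eps%:E = (3%:E * (eps / 9)%:E + 3%:E * (eps / 9)%:E + 3%:E * (eps / 9)%:E)%E.
  by rewrite -!EFinM -!EFinD; congr (_%:E); field.
by apply: leeD; [apply: leeD|]; exact: lee_wpmul2l.
Unshelve. all: by end_near. Qed.

Lemma continuous_translation_lin u v (k : R) : measurable_fun setT u -> measurable_fun setT v ->
  continuous_translation u -> continuous_translation v ->
  continuous_translation (fun x => u x + k * v x).
Proof.
move=> mu_ mv cu cv eps eps0.
have k0 : 0 < 1 + k ^+ 2 by rewrite ltr_pwDl// sqr_ge0.
near=> n.
have cun : (\int[mu]_x ((shifted u n x - u x) ^+ 2)%:E <= (eps / 4)%:E)%E.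
  by near: n; apply: cu; rewrite divr_gt0.
have cvn : (\int[mu]_x ((shifted v n x - v x) ^+ 2)%:E <= (eps / 4 / (1 + k ^+ 2))%:E)%E.
  by near: n; apply: cv; rewrite !divr_gt0.
have msu := measurable_shifted n mu_; have msv := measurable_shifted n mv.
have md (f g : mR3 R -> R) : measurable_fun setT f -> measurable_fun setT g ->
    measurable_fun setT (fun x => (f x - g x) ^+ 2).
  by move=> mf mg; apply: measurable_funX; exact: measurable_funB.
have sq (f g : mR3 R -> R) x : 0 <= (f x - g x) ^+ 2 by exact: sqr_ge0.
have k2 : 0 <= 2 * k ^+ 2 by rewrite mulr_ge0// sqr_ge0.
have sl : measurable_fun setT (fun x => u x + k * v x).
  by apply: measurable_funD => //; exact: measurable_funM.
apply: (@le_trans _ _ (2%:E * \int[mu]_x ((shifted u n x - u x) ^+ 2)%:E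
   + (2 * k ^+ 2)%:E * \int[mu]_x ((shifted v n x - v x) ^+ 2)%:E)%E).
  apply: ge0_le_integral_lin2; rewrite ?ler0n//; try exact: md.
  - by apply: md => //; exact: measurable_shifted.
  - by move=> x; exact: sqr_ge0.
  move=> x _; rewrite /shifted; move: (u _) (u _) (v _) (v _) => u1 u2 v1 v2.
  have := sqr_ge0 ((u1 - u2) - k * (v1 - v2)); lra.
apply: (@le_trans _ _ (2%:E * (eps / 4)%:E + (2 * k ^+ 2)%:E * (eps / 4 / (1 + k ^+ 2))%:E)%E).
  by apply: leeD; apply: lee_wpmul2l => //; rewrite lee_fin.
rewrite -!EFinM -!EFinD lee_fin.
have : k ^+ 2 * (eps / 4 / (1 + k ^+ 2)) <= eps / 4.
  rewrite mulrCA ler_piMr ?divr_ge0 ?(ltW eps0)// ler_pdivrMr// mul1r lerDr//.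
by lra.
Unshelve. all: by end_near. Qed.

Lemma continuous_translation_cvg u (v : nat -> mR3 R -> R) (g : mR3 R -> R) :
  measurable_fun setT u -> square_integrable g ->
  (forall m, measurable_fun setT (v m)) -> (forall m, continuous_translation (v m)) ->
  (forall x, v m x @[m --> \oo] --> u x) -> (forall m x, `|u x - v m x| <= g x) ->
  continuous_translation u.
Proof.
move=> mu_ sg mv cv vu vg; apply: continuous_translation_closed => // eps eps0.
have ig : mu.-integrable setT (EFin \o (fun x => g x ^+ 2)) by apply/(square_integrableP sg.1).
have m2 m := msq mu_ (mv m).
have c x : ((u x - v m x) ^+ 2)%:E @[m --> \oo] --> 0%E.
  have D : (u x - v m x) @[m --> \oo] --> (0 : R).
    by rewrite -(subrr (u x)); apply: cvgB => //; exact: cvg_cst.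
  have H : ((u x - v m x) ^+ 2) @[m --> \oo] --> (0 : R).
    rewrite (_ : (fun m => _) = (fun m => (u x - v m x) * (u x - v m x))).
      by rewrite -(mulr0 (0 : R)); exact: cvgM.
    by apply/funext => m; rewrite expr2.
  by apply: cvg_EFin; [exact: nearW|exact: H].
have dom : forall x, forall m, [set: mR3 R] x -> (`|((u x - v m x) ^+ 2)%:E| <= (g x ^+ 2)%:E)%E.
  move=> x m _; rewrite /= lee_fin (ger0_norm (sqr_ge0 _)).
  rewrite -(real_normK (num_real (u x - v m x))) lerXn2r ?nnegrE//.
  exact: le_trans (vg m x).
have [_ _] := @dominated_convergence _ _ _ mu setT measurableT
  (fun m x => ((u x - v m x) ^+ 2)%:E) (cst 0%E) _ m2 (measurable_cst _)
  (aeW mu (fun x _ => c x)) ig (aeW mu dom).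
rewrite integral0 => /fine_cvgP[fin /cvgr0Pnorm_le/(_ _ eps0)h].
have [m [mf mh]] : exists m, (\int[mu]_x ((u x - v m x) ^+ 2)%:E)%E \is a fin_num /\
   `|fine (\int[mu]_x ((u x - v m x) ^+ 2)%:E)%E| <= eps.
  near \oo => m; exists m; split; near: m; [exact: fin|exact: h].
exists (v m); split => //.
by rewrite -(fineK mf) lee_fin (le_trans _ mh)// ler_norm.
Unshelve. all: by end_near. Qed.

End translation_continuity.

Section boxes.
Context {R : realType}.

Definition box (a b : 'I_3 -> R) : set (mR3 R) :=
  [set x | forall j, a j < coord j x <= b j].

Lemma boxE a b : box a b = (`]a ord0, b ord0]%classic `*` `]a 1, b 1]%classic) `*` `]a ord_max, b ord_max]%classic.
Proof.
apply/seteqP; split => x.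
  move=> h; split; [split|] => /=; rewrite in_itv/=.
  + exact: (h ord0). + exact: (h 1). + exact: (h ord_max).
move=> [[/= h0 h1] h2] j; rewrite !in_itv/= in h0 h1 h2.
have [->|->|->] := ord3P j.
- exact: h0.
- exact: h1.
- exact: h2.
Qed.

Lemma measurable_box a b : measurable (box a b).
Proof. by rewrite boxE; apply: measurableX => //; exact: measurableX. Qed.

Lemma box_cube n : cube R n = box (fun=> - n%:R) (fun=> n%:R).
Proof. by rewrite boxE. Qed.

Lemma boxI a b c d : box a b `&` box c d =
  box (fun j => Num.max (a j) (c j)) (fun j => Num.min (b j) (d j)).
Proof.
apply/seteqP; split => x; rewrite /box/=.
  by move=> [h1 h2] j; rewrite gt_max le_min; have /andP[-> ->] := h1 j; have /andP[-> ->] := h2 j.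
by move=> h; split => j; have := h j; rewrite gt_max le_min => /andP[/andP[? ?] /andP[? ?]]; apply/andP.
Qed.

Definition boxes : set (set (mR3 R)) := [set B | exists a b, B = box a b].

Lemma measurable_coord_boxes j (A : set (measurableTypeR R)) : measurable A ->
  <<s boxes >> (coord j @^-1` A).
Proof.
move=> mA.
have m : measurable_fun setT (coord j : g_sigma_algebraType boxes -> measurableTypeR R).
  apply: (@measurability _ _ _ _ _ _ (@ocitv R)) => //.
  move=> _ [_ [[a b] _ <-] <-]; rewrite setTI.
  have -> : coord j @^-1` `]a, b]%classic = \bigcup_n
      box (fun k => if k == j then a else - n%:R) (fun k => if k == j then b else n%:R).
    apply/seteqP; split => x.
      rewrite /= in_itv/= => xab.
      have : (\bigcup_n cube R n) x by rewrite bigcup_cube.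
      move=> [n _]; rewrite box_cube => xn; exists n => // k /=.
      by case: (eqVneq k j) => [->//|_]; exact: xn.
    by move=> [n _ /(_ j)]; rewrite eqxx /= in_itv.
  apply: sigma_algebra_bigcup => n; apply: sub_sigma_algebra.
  by exists (fun k => if k == j then a else - n%:R), (fun k => if k == j then b else n%:R).
by have := m measurableT A mA; rewrite setTI.
Qed.

Lemma measurable3_boxes : @measurable _ (mR3 R) = <<s boxes >>.
Proof.
apply/seteqP; split; last first.
  apply: smallest_sub; first exact: sigma_algebra_measurable.
  by move=> _ [a [b ->]]; exact: measurable_box.
have m : measurable_fun setT (id : g_sigma_algebraType boxes -> mR3 R).
  have mc j : measurable_fun setT (coord j : g_sigma_algebraType boxes -> measurableTypeR R).
    by move=> _ A mA; rewrite setTI; exact: measurable_coord_boxes.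
  exact: measurable_fun_coord.
by move=> A mA; have := m measurableT A mA; rewrite setTI.
Qed.

End boxes.
Section translation_continuity_L2.
Context {R : realType}.
Local Notation mu := (lebesgue3 R).
Variables (z : R * R * R) (e : nat -> R).
Hypothesis z0 : forall j, 0 < coord j z.
Hypothesis e0 : forall n, 0 < e n.
Hypothesis ecvg : e @ \oo --> (0 : R).
Implicit Types u v : mR3 R -> R.
Local Notation ct := (continuous_translation z e).

(** The endpoint a stays outside and the endpoint b inside the interval shifted by
    a small positive amount; a shift of the opposite sign would change both. *)
Lemma interval_shift_near (a b t w : R) : 0 < w ->
  \forall n \near \oo, (a < t - e n * w <= b) = (a < t <= b).
Proof.
move=> w0.
have ew (d : R) : 0 < d -> \forall n \near \oo, e n * w < d.
  move=> d0; have /cvgr0Pnorm_lt/(_ (d / w)) := ecvg.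
  move=> /(_ (divr_gt0 d0 w0)); apply: filterS => n h.
  by rewrite -ltr_pdivlMr// (le_lt_trans (ler_norm _)).
have p n : 0 < e n * w by rewrite mulr_gt0.
have [ta|at_] := leP t a.
  by apply: nearW => n; have := p n => pn; rewrite !ltNge (_ : t - e n * w <= a)/= ?ta//; lra.
have [tb|bt] := leP t b.
  have d0 : 0 < t - a by lra.
  move: (ew _ d0); apply: filterS => n h; have := p n => pn.
  by apply/andP; split; lra.
have d0 : 0 < t - b by lra.
move: (ew _ d0); apply: filterS => n h.
by rewrite andbC [in RHS]andbC leNgt (_ : b < t - e n * w)/=; lra.
Qed.

Lemma continuous_translation_box a b : ct (\1_(box a b)).
Proof.
move=> eps eps0; set Q := box a b.
have mQ : measurable Q by exact: measurable_box.
have [E Eb] : exists E : R, forall n, e n <= E.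
  have := cvg_seq_bounded (cvgP _ ecvg); rewrite /bounded_fun => /pinfty_ex_gt0[E _ h].
  by exists E => n; apply: le_trans (h n _) => //; exact: ler_norm.
pose m (j : 'I_3) := `|a j| + `|b j| + E * coord j z.
pose N := (Num.Def.trunc `|m ord0 + (m 1 + m ord_max)|).+1.
have E0 : 0 < E by rewrite (lt_le_trans (e0 0))// Eb.
have m0 j : 0 <= m j by rewrite addr_ge0 ?addr_ge0// mulr_ge0// ltW.
have mN j : m j < N%:R.
  have s0 : 0 <= m ord0 + (m 1 + m ord_max) by apply: addr_ge0 => //; apply: addr_ge0.
  apply: le_lt_trans (truncnS_gt _); rewrite (ger0_norm s0).
  have [->|->|->] := ord3P j.
  - by have := m0 1; have := m0 ord_max; lra.
  - by have := m0 ord0; have := m0 ord_max; lra.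
  - by have := m0 ord0; have := m0 1; lra.
have QN (x : mR3 R) (t : R) : 0 <= t <= E -> Q ((x : R * R * R) - t *: z) -> cube R N x.
  move=> /andP[t0 tE] xQ; rewrite box_cube => j; have := xQ j.
  rewrite coordB coordZ => /andP[h1 h2].
  have h3 : t * coord j z <= E * coord j z by rewrite ler_wpM2r// ltW.
  have h4 : 0 <= t * coord j z by rewrite mulr_ge0// ltW.
  have := mN j; rewrite /m; have := ler_norm (- a j); rewrite normrN.
  have := ler_norm (b j); have := normr_ge0 (a j); have := normr_ge0 (b j) => *.
  by apply/andP; split; lra.
pose f n (x : mR3 R) : \bar R := ((shifted z e (\1_Q : mR3 R -> R) n x - \1_Q x) ^+ 2)%:E.
have mf n : measurable_fun setT (f n).
  apply/measurable_EFinP; apply: measurable_funX; apply: measurable_funB.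
    by apply: measurable_shifted => //; exact: measurable_indic.
  exact: measurable_indic.
have ig : mu.-integrable setT (EFin \o (\1_(cube R N) : mR3 R -> R)).
  apply/integrableP; split.
    by apply/measurable_EFinP; apply: measurable_indic; exact: measurable_cube.
  have -> : (\int[mu]_x `|(EFin \o \1_(cube R N)) x| = \int[mu]_x (\1_(cube R N) x)%:E)%E.
    by apply: eq_integral => x _; rewrite /= indicE ger0_norm.
  by rewrite integral_indic//; [rewrite setIT lebesgue3_cube|exact: measurable_cube].
have dom : forall x, forall n, [set: mR3 R] x -> (`|f n x| <= (EFin \o \1_(cube R N)) x)%E.
  move=> x n _; rewrite /f /= lee_fin (ger0_norm (sqr_ge0 _)) /shifted !indicE.
  have [xN|xN] := pselect (cube R N x).
    rewrite [in leRHS]mem_set//.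
    by case: (_ \in _); case: (_ \in _); rewrite ?subrr ?subr0 ?sub0r ?sqrrN ?expr1n ?expr0n.
  rewrite [in leRHS]memNset// (memNset (A:=Q)); last first.
    by apply: contra_not xN => h; apply: QN h; rewrite (ltW (e0 n)) Eb.
  rewrite memNset ?subrr ?expr0n//.
  by apply: contra_not xN => h; apply: (@QN x 0); rewrite ?lexx ?(ltW E0)// scale0r subr0.
have cv : forall x, [set: mR3 R] x -> f n x @[n --> \oo] --> 0%E.
  move=> x _; apply: cvg_near_cst.
  have near_j j := interval_shift_near (a j) (b j) (coord j x) (z0 j).
  near=> n; rewrite /f /shifted !indicE.
  suff -> : ((x : R * R * R) - e n *: z \in Q) = (x \in Q) by rewrite subrr expr0n.
  have nj j : (a j < coord j x - e n * coord j z <= b j) = (a j < coord j x <= b j).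
    have [->|->|->] := ord3P j.
    - by near: n; exact: near_j.
    - by near: n; exact: near_j.
    - by near: n; exact: near_j.
  by apply/idP/idP; rewrite !inE => h j; have := h j; rewrite coordB coordZ nj.
have [_ _] := @dominated_convergence _ _ _ mu setT measurableT f (cst 0%E) _ mf
  (measurable_cst _) (aeW mu cv) ig (aeW mu dom).
rewrite integral0 => /fine_cvgP[fin /cvgr0Pnorm_le/(_ _ eps0)h].
near=> n.
have finn : (\int[mu]_x f n x)%E \is a fin_num by near: n; exact: fin.
rewrite -[leLHS](fineK finn) lee_fin; apply: le_trans (ler_norm _) _.
by near: n; exact: h.
Unshelve. all: by end_near. Qed.

Lemma continuous_translation0 : ct (fun=> 0).
Proof.
move=> eps eps0; apply: nearW => n; rewrite /shifted.
by under eq_integral do rewrite subrr expr0n/=; rewrite integral0 lee_fin ltW.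
Qed.

Lemma square_integrable_indic_cube N (A : set (mR3 R)) : measurable A ->
  square_integrable (\1_(A `&` cube R N) : mR3 R -> R).
Proof.
move=> mA; have mAN : measurable (A `&` cube R N).
  by apply: measurableI => //; exact: measurable_cube.
split; first exact: measurable_indic.
under eq_integral => x _.
  rewrite (_ : \1_(A `&` cube R N) x ^+ 2 = \1_(A `&` cube R N) x); last first.
    by rewrite indicE; case: (_ \in _); rewrite ?expr1n ?expr0n.
  over.
rewrite integral_indic// setIT; apply: le_lt_trans (lebesgue3_cube R N).
by apply: le_measure; rewrite ?inE//; exact: measurable_cube.
Qed.

(** Dynkin's pi-lambda theorem on the boxes; the cube keeps complements and
    countable unions of finite measure. *)
Lemma continuous_translation_indic N (A : set (mR3 R)) : measurable A ->
  ct (\1_(A `&` cube R N)).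
Proof.
rewrite measurable3_boxes; move: A.
apply: (@dynkin_induction _ (mR3 R) (@boxes R)
  (fun A => ct (\1_(A `&` cube R N)))).
- exact: measurable3_boxes.
- by move=> _ _ [a [b ->]] [c [d ->]]; rewrite boxI; do 2 eexists.
- by rewrite setTI box_cube; exact: continuous_translation_box.
- by move=> _ [a [b ->]] /=; rewrite box_cube boxI; exact: continuous_translation_box.
- move=> A mA cA.
  have -> : (\1_(~` A `&` cube R N) : mR3 R -> R) =
      (fun x => \1_(cube R N) x + (-1) * \1_(A `&` cube R N) x).
    apply/funext => x; rewrite !indicE !in_setI in_setC.
    by case: (x \in A); case: (x \in cube R N) => /=; ring.
  apply: continuous_translation_lin => //.
  + by apply: measurable_indic; exact: measurable_cube.
  + by apply: measurable_indic; apply: measurableI => //; exact: measurable_cube.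
  + by rewrite box_cube; exact: continuous_translation_box.
- move=> F mF tF cF.
  pose v m (x : mR3 R) : R := \sum_(i < m) \1_(F i `&` cube R N) x.
  have vE m x : v m x = \1_((\big[setU/set0]_(i < m) F i) `&` cube R N) x.
    rewrite /v; elim: m => [|m ih]; first by rewrite !big_ord0 set0I indicE in_set0.
    rewrite !big_ord_recr/= ih !indicE !in_setI in_setU.
    case: (boolP (x \in F m)) => xm; rewrite ?orbT ?orbF /= ?addr0//.
    rewrite (_ : (x \in \big[setU/set0]_(i < m) F i) = false) /= ?add0r//.
    apply/negbTE; rewrite notin_setE -bigcup_mkord => -[i /= im xi].
    have := tF i m I I; rewrite inE in xm; move=> /(_ (ex_intro _ x (conj xi xm))) E.
    by rewrite E ltnn in im.
  have mv m : measurable_fun setT (v m).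
    apply: measurable_sum => i; apply: measurable_indic.
    by apply: measurableI => //; exact: measurable_cube.
  have mFN : measurable (\bigcup_i F i `&` cube R N).
    by apply: measurableI; [exact: bigcup_measurable|exact: measurable_cube].
  apply: (@continuous_translation_cvg _ z e _ v (\1_(setT `&` cube R N))).
  + exact: measurable_indic.
  + exact: square_integrable_indic_cube.
  + exact: mv.
  + move=> m; rewrite /v; elim: m => [|m ih].
      by under eq_fun do rewrite big_ord0; exact: continuous_translation0.
    have -> : (fun x => \sum_(i < m.+1) \1_(F i `&` cube R N) x : R) =
       (fun x => \sum_(i < m) \1_(F i `&` cube R N) x + 1 * \1_(F m `&` cube R N) x).
      by apply/funext => x; rewrite big_ord_recr/= mul1r.
    apply: continuous_translation_lin => //; first exact: mv.
    by apply: measurable_indic; apply: measurableI => //; exact: measurable_cube.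
  + move=> x; apply: cvg_near_cst.
    have [[[i _ xi] xN]|nx] := pselect ((\bigcup_i F i `&` cube R N) x).
      near=> m; rewrite vE !indicE.
      have h1 : (\bigcup_k F k `&` cube R N) x by split => //; exists i.
      have h2 : (\big[setU/set0]_(k < m) F k `&` cube R N) x.
        split => //; rewrite -bigcup_mkord; exists i => //=.
        by near: m; exact: nbhs_infty_gt.
      by rewrite (mem_set h1) (mem_set h2).
    apply: nearW => m; rewrite vE !indicE !memNset//.
    by apply: contra_not nx => -[]; rewrite -bigcup_mkord => -[i _ xi] xN; split => //; exists i.
  + move=> m x; rewrite vE !indicE setTI; have [xN|xN] := pselect (cube R N x).
      rewrite [in leRHS](mem_set xN).
      by case: (_ \in _); case: (_ \in _); rewrite ?subrr ?subr0 ?sub0r ?normrN ?normr1 ?normr0.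
    rewrite (memNset (A:=\bigcup_k F k `&` _)); last by case.
    rewrite (memNset (A:=_ (index_enum _) _ `&` _)); last by case.
    by rewrite subrr normr0.
Unshelve. all: by end_near. Qed.

End translation_continuity_L2.

Section translation_continuity_square_integrable.
Context {R : realType}.
Local Notation mu := (lebesgue3 R).
Variables (z : R * R * R) (e : nat -> R).
Hypothesis z0 : forall j, 0 < coord j z.
Hypothesis e0 : forall n, 0 < e n.
Hypothesis ecvg : e @ \oo --> (0 : R).
Implicit Types u v : mR3 R -> R.
Local Notation ct := (continuous_translation z e).

Lemma continuous_translation_sum_indic N (s : seq R) (B : R -> set (mR3 R)) :
  (forall y, measurable (B y)) ->
  ct (fun x => \sum_(y <- s) y * \1_(B y `&` cube R N) x).
Proof.
move=> mB; elim: s => [|y s ih].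
  by under eq_fun do rewrite big_nil; exact: continuous_translation0.
have mI y' : measurable (B y' `&` cube R N) by apply: measurableI => //; exact: measurable_cube.
under eq_fun do rewrite big_cons addrC.
apply: continuous_translation_lin => //.
- by apply: measurable_sum => y'; apply: measurable_funM => //; exact: measurable_indic.
- exact: continuous_translation_indic.
Qed.

Import HBNNSimple.

(** Simple functions, cut off by cubes, increase to u and are dominated by it. *)
Lemma continuous_translation_nonneg u : square_integrable u -> (forall x, 0 <= u x) -> ct u.
Proof.
move=> su u0.
have mEu : measurable_fun setT (EFin \o u) by apply/measurable_EFinP; exact: su.1.
have u0' (x : mR3 R) : [set: mR3 R] x -> (0 <= (EFin \o u) x)%E by move=> _; rewrite lee_fin.
pose h m := nnsfun_approx measurableT mEu m.
pose v m (x : mR3 R) : R := h m x * \1_(cube R m) x.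
have hu m x : h m x <= u x.
  by rewrite /h nnsfun_approxE -lee_fin; exact: (le_approx m u0').
have mv m : measurable_fun setT (v m).
  by apply: measurable_funM => //; apply: measurable_indic; exact: measurable_cube.
apply: (@continuous_translation_cvg _ z e _ v u) => //; first exact: su.1.
- move=> m; rewrite /v.
  have -> : (fun x => h m x * \1_(cube R m) x) =
    (fun x => \sum_(y <- finmap.enum_fset (fset_set (range (h m)))) y * \1_((h m @^-1` [set y]) `&` cube R m) x).
    apply/funext => x; rewrite [in LHS](fimfunE (h m)) fsbig_finite//= mulr_suml.
    by apply: eq_bigr => y _; rewrite indicI mulrA.
  apply: continuous_translation_sum_indic => y.
  exact: measurable_sfunP.
- move=> x; have := cvg_nnsfun_approx measurableT mEu u0' (I : [set: mR3 R] x).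
  move=> /fine_cvgP[_ cx].
  have c1 : (\1_(cube R m) x : R) @[m --> \oo] --> (1 : R).
    apply: cvg_near_cst.
    have [n _ xn] : (\bigcup_n cube R n) x by rewrite bigcup_cube.
    near=> m; rewrite indicE mem_set//; apply: (@nd_cube _ n) => //.
    by near: m; exact: nbhs_infty_ge.
  by rewrite -[u x]mulr1; exact: (cvgM cx c1).
- move=> m x; rewrite /v indicE; have := hu m x; have := u0 x.
  have : 0 <= h m x by [].
  case: (_ \in _) => /=; rewrite ?mulr1 ?mulr0 => *; rewrite ger0_norm; lra.
Unshelve. all: by end_near. Qed.

Lemma continuous_translation_square_integrable u : square_integrable u -> ct u.
Proof.
move=> su.
have mp (w : mR3 R -> R) : measurable_fun setT w -> measurable_fun setT (fun x => Num.max (w x) 0).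
  by move=> mw; apply: measurable_maxr.
have sp (w : mR3 R -> R) : square_integrable w -> square_integrable (fun x => Num.max (w x) 0).
  move=> sw; apply: (@square_integrable_le _ w w _ 1 0) => //; first exact: mp sw.1.
  move=> x; rewrite mul1r mul0r addr0; case: (leP (w x) 0) => _ //.
  by rewrite expr0n sqr_ge0.
have sN : square_integrable (fun x => - u x).
  by have := square_integrableZ (-1) su; congr square_integrable; apply/funext => x; rewrite mulN1r.
have -> : u = (fun x => Num.max (u x) 0 + (-1) * Num.max (- u x) 0).
  apply/funext => x; have [ux|ux] := leP (u x) 0.
    by rewrite max_l ?oppr_ge0//; ring.
  by rewrite max_r ?oppr_le0 ?(ltW ux)//; ring.
apply: continuous_translation_lin.
- exact: mp su.1.
- exact: mp sN.1.
- by apply: continuous_translation_nonneg; [exact: sp|move=> x; rewrite le_max lexx orbT].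
- by apply: continuous_translation_nonneg; [exact: (sp _ sN)|move=> x; rewrite le_max lexx orbT].
Qed.

End translation_continuity_square_integrable.

(** * Mollification *)

Section mollifiers.
Context {R : realType}.
Local Notation mu := (lebesgue3 R).
Local Notation leb1 := (@lebesgue_measure R).

(** The support is the one-sided interval [0, 1]: mollification then averages
    translates in the directions of the open positive octant. *)
Definition bump (t : R) : R := flat 0 t * flat 0 (1 - t).

Lemma bump_ge0 t : 0 <= bump t.
Proof.
have f0 s : 0 <= flat 0 s :> R by rewrite /flat; case: ifP => // _; rewrite expr0 mul1r expR_ge0.
exact: mulr_ge0.
Qed.

Lemma bump_smooth : smooth1 bump.
Proof.
move=> N; apply: differentiable_upto_mul; first exact: flat_smooth.
have := @differentiable_upto_affine R N (flat 0) 1 (-1) (flat_smooth 0 N).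
by congr differentiable_upto; apply/funext => x; rewrite mulN1r.
Qed.

Lemma bump_eq0 t : ~~ (0 < t < 1) -> bump t = 0.
Proof.
rewrite negb_and -!leNgt /bump /flat => /orP[t0|t1].
  by rewrite ltNge t0 mul0r.
by rewrite [in X in _ * X]ltNge subr_le0 t1 mulr0.
Qed.

Lemma measurable_bump : measurable_fun [set: measurableTypeR R] (bump : measurableTypeR R -> measurableTypeR R).
Proof. by apply: smooth1_measurable; exact: bump_smooth. Qed.

Lemma bump_le1 t : bump t <= 1.
Proof.
have f1 (s : R) : 0 <= flat 0 s <= 1.
  rewrite /flat; case: ifPn => [s0|_]; last by rewrite lexx ler01.
  by rewrite expr0 mul1r expR_ge0/= -expR0 ler_expR oppr_le0 invr_ge0 ltW.
have /andP[a0 a1] := f1 t; have /andP[b0 b1] := f1 (1 - t).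
by rewrite -[leRHS]mulr1 ler_pM.
Qed.

Lemma bump_ge t : 4^-1 <= t <= 3 / 4 -> expR (- 8) <= bump t.
Proof.
have f s : 4^-1 <= s -> expR (- 4) <= flat 0 s.
  move=> s4; have s0 : 0 < s by apply: lt_le_trans s4; rewrite invr_gt0.
  by rewrite /flat s0 expr0 mul1r ler_expR lerN2 invf_ple ?posrE.
move=> /andP[t1 t2]; have -> : - 8 = - 4 + - 4 :> R by ring.
rewrite expRD; apply: ler_pM; rewrite ?expR_ge0//; apply: f => //; lra.
Qed.

Let I : \bar R := (\int[leb1]_t (bump t)%:E)%E.

Lemma integral_bump_gt0 : (0 < I < +oo)%E.
Proof.
have mb : measurable_fun [set: measurableTypeR R] (fun t : measurableTypeR R => (bump t)%:E).
  by apply/measurable_EFinP; exact: measurable_bump.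
have mi (a b : R) : measurable_fun [set: measurableTypeR R]
    (fun t : measurableTypeR R => (\1_(`[a, b]%classic) t : R)%:E).
  by apply/measurable_EFinP; apply: measurable_indic.
apply/andP; split.
  apply: (@lt_le_trans _ _ (\int[leb1]_t ((expR (- 8))%:E * (\1_(`[4^-1, 3 / 4]%classic) t)%:E))%E).
    rewrite ge0_integralZl//.
    rewrite integral_indic//= setIT lebesgue_measure_itv/= lte_fin.
    by rewrite ifT; [rewrite -EFinB -EFinM lte_fin mulr_gt0 ?expR_gt0//; lra|lra].
  apply: ge0_le_integral => //.
  - exact: measurable_funeM.
  - move=> x _; rewrite -EFinM lee_fin indicE; case: (boolP (x \in _)) => h.
      by rewrite mulr1 bump_ge//; move: h; rewrite inE/= in_itv.
    by rewrite mulr0 bump_ge0.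
apply: (@le_lt_trans _ _ (\int[leb1]_t (\1_(`[0, 1]%classic) t)%:E)%E).
  apply: ge0_le_integral => //.
  - by move=> x _; rewrite lee_fin bump_ge0.
  - move=> x _; rewrite lee_fin indicE; case: (boolP (x \in _)) => h; first exact: bump_le1.
    rewrite bump_eq0//; apply: contra h => /andP[x0 x1]; rewrite inE/= in_itv/=.
    by rewrite !ltW.
by rewrite integral_indic//= setIT lebesgue_measure_itv/= lte_fin ltr01 -EFinB ltry.
Qed.

Definition unit_bump (t : R) : R := (fine I)^-1 * bump t.

Let fI : 0 < fine I.
Proof. by have /andP[I0 Iy] := integral_bump_gt0; apply: fine_gt0; rewrite I0. Qed.

Lemma unit_bump_ge0 t : 0 <= unit_bump t.
Proof. by rewrite mulr_ge0 ?bump_ge0// invr_ge0 ltW. Qed.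

Lemma measurable_unit_bump : measurable_fun [set: measurableTypeR R]
  (fun t : measurableTypeR R => (unit_bump t)%:E).
Proof. by apply/measurable_EFinP; apply: measurable_funM => //; exact: measurable_bump. Qed.

Lemma integral_unit_bump : (\int[leb1]_t (unit_bump t)%:E = 1)%E.
Proof.
have mb : measurable_fun [set: measurableTypeR R] (fun t : measurableTypeR R => (bump t)%:E).
  by apply/measurable_EFinP; exact: measurable_bump.
have /andP[I0 Iy] := integral_bump_gt0.
under eq_integral do rewrite EFinM.
rewrite ge0_integralZl//; last 2 first.
- by move=> t _; rewrite lee_fin bump_ge0.
- by rewrite lee_fin invr_ge0 ltW.
have If : I \is a fin_num by rewrite ge0_fin_numE// ltW.
by rewrite -/I -[X in (_ * X)%E](fineK If) -EFinM mulVf// gt_eqF.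
Qed.

Definition mollifier (h t : R) : R := h^-1 * unit_bump (h^-1 * t).

Lemma mollifier_ge0 h t : 0 < h -> 0 <= mollifier h t.
Proof. by move=> h0; rewrite mulr_ge0 ?unit_bump_ge0// invr_ge0 ltW. Qed.

Lemma mollifier_eq0 h t : 0 < h -> ~~ (0 < t < h) -> mollifier h t = 0.
Proof.
move=> h0 th; rewrite /mollifier /unit_bump bump_eq0 ?mulr0//; apply: contra th.
by rewrite mulrC ltr_pdivrMr// mul1r pmulr_lgt0 ?invr_gt0.
Qed.

Lemma mollifier_test_kernel h : 0 < h -> test_kernel h (mollifier h).
Proof.
move=> h0; split=> [N|t ht].
  have := @differentiable_upto_affine R N bump 0 h^-1 (bump_smooth N).
  move=> /(differentiable_upto_lin (h^-1 * (fine I)^-1) 0)-/(_ _ (bump_smooth N)).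
  by congr differentiable_upto; apply/funext => x; rewrite /mollifier /unit_bump mul0r addr0 add0r mulrA.
apply: mollifier_eq0 => //; apply/negP => /andP[t0 t1].
by move: ht; rewrite gtr0_norm//; lra.
Qed.

Lemma mollifier_tensor_ge0 h z : 0 < h -> 0 <= tensor (fun=> mollifier h) z.
Proof. by move=> h0; apply: prodr_ge0 => j _; exact: mollifier_ge0. Qed.

Lemma tensor_unit_bumpE h (z : R * R * R) : tensor (fun=> mollifier h) z =
  h ^- 3 * tensor (fun=> unit_bump) (h^-1 *: z).
Proof.
rewrite /tensor /mollifier !big_ord_recl !big_ord0 !coordZ.
by rewrite -exprVn; ring.
Qed.

Lemma measurable_tensor_unit_bump :
  measurable_fun setT (tensor (fun=> unit_bump) : mR3 R -> R).
Proof.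
apply: measurable_prod => j _; apply: measurable_funM => //.
exact: (measurableT_comp measurable_bump (measurable_coord j)).
Qed.

Lemma tensor_unit_bump_ge0 z : 0 <= tensor (fun=> unit_bump) z.
Proof. by apply: prodr_ge0 => j _; exact: unit_bump_ge0. Qed.

Lemma tensor_unit_bump_eq0 (z : R * R * R) j : coord j z <= 0 -> tensor (fun=> unit_bump) z = 0.
Proof.
move=> z0; rewrite /tensor (bigD1 j)//= /unit_bump bump_eq0 ?mulr0 ?mul0r//.
by rewrite negb_and -leNgt z0.
Qed.

Lemma integral_tensor_unit_bump : (\int[mu]_z (tensor (fun=> unit_bump) z)%:E = 1)%E.
Proof.
have mU := measurable_unit_bump.
have U0 t : (0 <= (unit_bump t)%:E)%E by rewrite lee_fin unit_bump_ge0.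
have TE (x y z : R) : (tensor (fun=> unit_bump) (x, y, z))%:E =
    ((unit_bump x)%:E * ((unit_bump y)%:E * (unit_bump z)%:E))%E.
  by rewrite /tensor !big_ord_recl big_ord0 mulr1 /coord/= !EFinM.
have T0 z : (0 <= (tensor (fun=> unit_bump) z)%:E)%E by rewrite lee_fin tensor_unit_bump_ge0.
have mT : measurable_fun setT (fun z : mR3 R => (tensor (fun=> unit_bump) z)%:E).
  by apply/measurable_EFinP; exact: measurable_tensor_unit_bump.
rewrite lebesgue3_tonelli//.
transitivity (\int[leb1]_z (unit_bump z)%:E)%E; last exact: integral_unit_bump.
apply: eq_integral => z _.
rewrite (@lebesgue2_tonelli _ (fun x => (tensor (fun=> unit_bump) (x, z))%:E))//; last first.
  by have := measurableT_comp mT (measurable_pair2 z).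
transitivity (\int[leb1]_x ((unit_bump x)%:E * (unit_bump z)%:E))%E.
  apply: eq_integral => x _.
  under eq_integral do rewrite TE.
  rewrite ge0_integralZl//; last 2 first.
  - by apply: emeasurable_funM.
  - by move=> y _; rewrite mule_ge0.
  by rewrite ge0_integralZr// integral_unit_bump mul1e.
by rewrite ge0_integralZr// integral_unit_bump mul1e.
Qed.

Lemma mollifier_kernel h : 0 < h -> forall j : 'I_3, test_kernel h (mollifier h).
Proof. by move=> h0 _; exact: mollifier_test_kernel. Qed.

(** The substitution y = x - h z. *)
Lemma ge0_integral_mollifier h (x : R * R * R) (f : mR3 R -> R) : 0 < h ->
  measurable_fun setT f -> (forall y, 0 <= f y) ->
  (\int[mu]_y (f y * tensor (fun=> mollifier h) (x - (y : R * R * R)))%:E =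
   \int[mu]_z (f (x - h *: (z : R * R * R)) * tensor (fun=> unit_bump) z)%:E)%E.
Proof.
move=> h0 mf f0.
have mT := measurable_tensor_reflect (mollifier_kernel h0) x.
have mk : measurable_fun setT (fun y : mR3 R =>
    (f y * tensor (fun=> mollifier h) (x - (y : R * R * R)))%:E).
  by apply/measurable_EFinP; exact: measurable_funM.
have k0 y : (0 <= (f y * tensor (fun=> mollifier h) (x - (y : R * R * R)))%:E)%E.
  by rewrite lee_fin mulr_ge0// mollifier_tensor_ge0.
have Nh0 : - h != 0 by rewrite oppr_eq0 gt_eqF.
have := ge0_integral_affine3 x Nh0 mk k0.
rewrite normrN gtr0_norm// => E.
have h3 : 0 < h ^+ 3 by rewrite exprn_gt0.
transitivity ((h ^+ 3)%:E * ((h ^- 3)%:E *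
  \int[mu]_y (f y * tensor (fun=> mollifier h) (x - (y : R * R * R)))%:E))%E.
  by rewrite muleA -EFinM divff ?mul1e// gt_eqF.
rewrite -E -ge0_integralZl//; last 2 first.
- exact: (measurableT_comp mk (measurable_affine3 _ _)).
- by rewrite lee_fin ltW.
apply: eq_integral => z _.
have -> : affine3 (- h) x z = x - h *: (z : R * R * R).
  by rewrite /affine3; congr (_, _, _); rewrite /= mulNr.
rewrite -EFinM; congr (_%:E).
rewrite opprB addrCA subrr addr0 tensor_unit_bumpE scalerA mulVf ?gt_eqF// scale1r.
by rewrite mulrCA; congr (_ * _); rewrite mulrA divff ?mul1r// gt_eqF.
Qed.

Lemma integral_mollifier h (x : R * R * R) : 0 < h ->
  (\int[mu]_y (tensor (fun=> mollifier h) (x - (y : R * R * R)))%:E = 1)%E.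
Proof.
move=> h0; have := @ge0_integral_mollifier h x (fun=> 1) h0 (measurable_cst _) (fun=> ler01).
under eq_integral do rewrite mul1r.
move=> ->; under eq_integral do rewrite mul1r.
exact: integral_tensor_unit_bump.
Qed.

End mollifiers.
Section mollifier_convergence.
Context {R : realType}.
Local Notation mu := (lebesgue3 R).
Local Notation T := (tensor (fun=> @unit_bump R)).
Variables (u : mR3 R -> R) (e : nat -> R).
Hypothesis su : square_integrable u.
Hypothesis e0 : forall n, 0 < e n.
Hypothesis ecvg : e @ \oo --> (0 : R).

Lemma conv_mollifier_sub h (x : R * R * R) : 0 < h ->
  conv u (fun=> mollifier h) x - u x =
  \int[mu]_y ((u y - u x) * tensor (fun=> mollifier h) (x - (y : R * R * R))).
Proof.
move=> h0; have kg := @mollifier_kernel R h h0.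
have mT := measurable_tensor_reflect kg x.
have iT : mu.-integrable setT (EFin \o (fun y : mR3 R => tensor (fun=> mollifier h) (x - (y : R * R * R)))).
  apply/integrableP; split; first exact/measurable_EFinP.
  under eq_integral do rewrite /= ger0_norm ?mollifier_tensor_ge0//.
  by rewrite integral_mollifier// ltry.
have iux : mu.-integrable setT (EFin \o (fun y : mR3 R => u x * tensor (fun=> mollifier h) (x - (y : R * R * R)))).
  by apply: eq_integrable (integrableZl measurableT (u x) iT).
transitivity (\int[mu]_y (u y * tensor (fun=> mollifier h) (x - (y : R * R * R))
   - u x * tensor (fun=> mollifier h) (x - (y : R * R * R)))).
  rewrite RintegralB//; last exact: conv_integrable kg su.
  congr (_ - _); rewrite RintegralZl// /Rintegral integral_mollifier//=.
  by rewrite mulr1.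
by apply: eq_Rintegral => y _; rewrite mulrBl.
Qed.

(** Jensen's inequality for the average of u (x - h z) - u x against the bump. *)
Lemma sqr_conv_mollifier_sub_le h (x : R * R * R) : 0 < h ->
  (((conv u (fun=> mollifier h) x - u x) ^+ 2)%:E <=
   \int[mu]_z ((u (x - h *: (z : R * R * R)) - u x) ^+ 2 * T z)%:E)%E.
Proof.
move=> h0; rewrite conv_mollifier_sub//.
have mux : measurable_fun setT (fun y => u y - u x) by apply: measurable_funB => //; exact: su.1.
have := @le_sqr_integral_weighted _ _ _ mu (fun y => u y - u x)
  (fun y => tensor (fun=> mollifier h) (x - (y : R * R * R))) 1 ltr01 mux
  (measurable_tensor_reflect (mollifier_kernel h0) x) (fun y => mollifier_tensor_ge0 _ h0).
rewrite integral_mollifier// mul1e => /(_ (lexx _)).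
rewrite (@ge0_integral_mollifier R h x (fun y => (u y - u x) ^+ 2))//.
- exact: measurable_funX.
- by move=> y; exact: sqr_ge0.
Qed.

Let F n (w : mR3 R * mR3 R) : \bar R :=
  ((shifted w.2 e u n w.1 - u w.1) ^+ 2 * T w.2)%:E.

Let F0 n w : (0 <= F n w)%E.
Proof. by rewrite lee_fin mulr_ge0 ?sqr_ge0// tensor_unit_bump_ge0. Qed.

Let mF n : measurable_fun setT (F n).
Proof.
apply/measurable_EFinP; apply: measurable_funM; last first.
  exact: (measurableT_comp measurable_tensor_unit_bump measurable_snd).
apply: measurable_funX; apply: measurable_funB; last first.
  exact: (measurableT_comp su.1 measurable_fst).
rewrite /shifted; apply: (measurableT_comp su.1).
have ms : measurable_fun setT (fun w : mR3 R * mR3 R => (w.1, affine3 (e n) 0 w.2) : mR3 R * mR3 R).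
  apply/measurable_fun_pairP; split; first exact: measurable_fst.
  exact: (measurableT_comp (measurable_affine3 (e n) 0) measurable_snd).
have := measurableT_comp (@measurable_sub3 R) ms.
congr (measurable_fun _ _); apply/funext => w /=.
by rewrite /affine3 !add0r.
Qed.

Let FE n z : (\int[mu]_x F n (x, z) =
  (T z)%:E * \int[mu]_x ((shifted z e u n x - u x) ^+ 2)%:E)%E.
Proof.
rewrite -ge0_integralZl//.
- by apply: eq_integral => x _; rewrite /F /= mulrC EFinM.
- apply/measurable_EFinP; apply: measurable_funX; apply: measurable_funB; last exact: su.1.
  by apply: measurable_shifted; exact: su.1.
- by move=> x _; rewrite lee_fin sqr_ge0.
- by rewrite lee_fin tensor_unit_bump_ge0.
Qed.

Let U : R := fine (\int[mu]_x (u x ^+ 2)%:E)%E.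

Let UE : (\int[mu]_x (u x ^+ 2)%:E = U%:E)%E.
Proof.
by rewrite /U fineK// ge0_fin_numE ?su.2// integral_ge0// => x _; rewrite lee_fin sqr_ge0.
Qed.

Let U0 : 0 <= U.
Proof. by apply: fine_ge0; apply: integral_ge0 => x _; rewrite lee_fin sqr_ge0. Qed.

Let shift_le n z : (\int[mu]_x ((shifted z e u n x - u x) ^+ 2)%:E <= (4 * U)%:E)%E.
Proof.
have ms : measurable_fun setT (shifted z e u n) by apply: measurable_shifted; exact: su.1.
apply: (@le_trans _ _ (2%:E * \int[mu]_x (shifted z e u n x ^+ 2)%:E
    + 2%:E * \int[mu]_x (u x ^+ 2)%:E)%E).
  apply: ge0_le_integral_lin2 => //.
  - by apply: measurable_funX; apply: measurable_funB => //; exact: su.1.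
  - exact: measurable_funX.
  - by apply: measurable_funX; exact: su.1.
  - by move=> x; exact: sqr_ge0.
  - by move=> x; exact: sqr_ge0.
  - by move=> x; exact: sqr_ge0.
  - by move=> x _; have := sqr_ge0 (shifted z e u n x + u x); lra.
rewrite (@ge0_integral_translate _ (- (e n *: z)) (fun x => (u x ^+ 2)%:E)).
- by rewrite UE -!EFinM -EFinD lee_fin; lra.
- by apply: measurable_sqr; exact: su.1.
- by move=> x; rewrite lee_fin sqr_ge0.
Qed.

Let mG n : measurable_fun setT (fun z => \int[mu]_x F n (x, z))%E.
Proof. exact: (measurable_fun_fubini_tonelli_G (F n) (mF n) (F0 n)). Qed.

Let cvg_G z : (\int[mu]_x F n (x, z))%E @[n --> \oo] --> 0%E.
Proof.
have [[j zj]|zpos] := pselect (exists j, coord j z <= 0).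
  by apply: cvg_near_cst; apply: nearW => n; rewrite FE (tensor_unit_bump_eq0 zj) mul0e.
have z0 j : 0 < coord j z by rewrite ltNge; apply/negP => zj; apply: zpos; exists j.
have T0 : 0 <= T z := tensor_unit_bump_ge0 z.
have fin n : (\int[mu]_x ((shifted z e u n x - u x) ^+ 2)%:E)%E \is a fin_num.
  rewrite ge0_fin_numE; last by apply: integral_ge0 => x _; rewrite lee_fin sqr_ge0.
  by apply: le_lt_trans (shift_le n z) _; rewrite ltry.
apply/fine_cvgP; split; first by apply: nearW => n; rewrite FE fin_numM.
apply/cvgr0Pnorm_le => d d0.
have d'0 : 0 < d / (T z + 1) by rewrite divr_gt0// ltr_wpDl.
have := continuous_translation_square_integrable z0 e0 ecvg su d'0.
apply: filterS => n /=; rewrite FE -{1}(fineK (fin n)) lee_fin => h.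
rewrite fineM//= ger0_norm; last first.
  by rewrite mulr_ge0// fine_ge0// integral_ge0// => x _; rewrite lee_fin sqr_ge0.
apply: (@le_trans _ _ (T z * (d / (T z + 1)))); first exact: ler_wpM2l.
by rewrite mulrCA ler_piMr ?(ltW d0)// ler_pdivrMr ?ltr_wpDl// mul1r lerDl.
Qed.

(** By the preceding bound and Tonelli's theorem the error is at most an average over
    z of the translation errors in the mean. These tend to 0 for every z in the
    positive octant and never exceed 4 times the squared norm of u, whence the
    claim by dominated convergence. *)
Lemma mollifier_cvg (d : R) : 0 < d -> \forall n \near \oo,
  (\int[mu]_x ((conv u (fun=> mollifier (e n)) x - u x) ^+ 2)%:E <= d%:E)%E.
Proof.
move=> d0.
have mT : measurable_fun setT (fun z : mR3 R => (T z)%:E).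
  by apply/measurable_EFinP; exact: measurable_tensor_unit_bump.
have ig : mu.-integrable setT (fun z => (4 * U)%:E * (T z)%:E)%E.
  apply: integrableZl => //; apply/integrableP; split => //.
  under eq_integral do rewrite gee0_abs ?lee_fin ?tensor_unit_bump_ge0//.
  by rewrite integral_tensor_unit_bump ltry.
have dom : forall z, forall n, [set: mR3 R] z ->
    (`|\int[mu]_x F n (x, z)| <= (4 * U)%:E * (T z)%:E)%E.
  move=> z n _; rewrite gee0_abs; last exact: integral_ge0.
  by rewrite FE muleC lee_wpmul2r// lee_fin tensor_unit_bump_ge0.
have [_ _] := @dominated_convergence _ _ _ mu setT measurableT
  (fun n z => \int[mu]_x F n (x, z))%E (cst 0%E) _ mG (measurable_cst _)
  (aeW mu (fun z _ => cvg_G z)) ig (aeW mu dom).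
rewrite integral0 => /fine_cvgP[fin /cvgr0Pnorm_le/(_ _ d0)h].
near=> n.
have finn : (\int[mu]_z \int[mu]_x F n (x, z))%E \is a fin_num by near: n; exact: fin.
have hn : `|fine (\int[mu]_z \int[mu]_x F n (x, z))%E| <= d by near: n; exact: h.
apply: (@le_trans _ _ (\int[mu]_z \int[mu]_x F n (x, z))%E); last first.
  by rewrite -(fineK finn) lee_fin (le_trans (ler_norm _)).
have kg := @mollifier_kernel R (e n) (e0 n).
rewrite -(fubini_tonelli (F n) (mF n) (F0 n)).
apply: ge0_le_integral => //.
- by move=> x _; rewrite lee_fin sqr_ge0.
- apply/measurable_EFinP; apply: measurable_funX; apply: measurable_funB; last exact: su.1.
  exact: conv_measurable kg su.1.
- exact: (measurable_fun_fubini_tonelli_F (F n) (mF n) (F0 n)).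
- by move=> x _; exact: sqr_conv_mollifier_sub_le.
Unshelve. all: by end_near. Qed.

End mollifier_convergence.

(** * The mollified system *)

Section mollified_equation.
Context {R : realType}.
Local Notation mu := (lebesgue3 R).

Lemma conv_regular M (u : mR3 R -> R) g : (forall j, test_kernel M (g j)) ->
  square_integrable u ->
  regular (conv u g) (fun i => conv u (derive_factor i g))
    (fun i j => conv u (derive_factor i (derive_factor j g))).
Proof.
move=> kg su; have kg1 i := derive_factor_test_kernel i kg.
have kg2 i j := derive_factor_test_kernel i (kg1 j).
split.
- exact: conv_square_integrable kg su.
- by move=> i; exact: conv_square_integrable (kg1 i) su.
- by move=> i j; exact: conv_square_integrable (kg2 i j) su.
- by move=> i; exact: conv_has_partial kg su.
- by move=> i j; exact: conv_has_partial (kg1 j) su.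
- by move=> i j; rewrite derive_factorC.
- move=> i j; apply: has_partial_line_continuous => k.
  exact: conv_has_partial (kg2 i j) su.
Qed.

Lemma conv_laplacian M (u : mR3 R -> R) g (x : R * R * R) : (forall j, test_kernel M (g j)) ->
  square_integrable u ->
  \int[mu]_y (u y * laplacian (fun y => tensor g (x - y)) y) =
  \sum_(i < 3) conv u (derive_factor i (derive_factor i g)) x.
Proof.
move=> kg su; rewrite laplacian_tensor; last by move=> j; exact: (kg j).1.
have kg2 i := derive_factor_test_kernel i (derive_factor_test_kernel i kg).
have i2 i := conv_integrable x (kg2 i) su.
rewrite !big_ord_recl big_ord0 addr0.
rewrite /conv -RintegralD// -RintegralD//; last first.
  by apply: eq_integrable (integrableD measurableT (i2 _) (i2 _)) => // y _.
by apply: eq_Rintegral => y _; rewrite !big_ord_recl big_ord0 addr0 !mulrDr.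
Qed.

Variables (u f : R * R * R -> R[i]) (e a : R).
Local Notation ur := (fun x => complex.Re (u x)).
Local Notation ui := (fun x => complex.Im (u x)).
Local Notation fr := (fun x => complex.Re (f x)).
Local Notation fi := (fun x => complex.Im (f x)).
Hypothesis sur : square_integrable ur.
Hypothesis sui : square_integrable ui.
Hypothesis sol : helmholtz_sol e a u f.

(** The equation tested against y |-> g (x - y), split into real and imaginary
    parts: pairings become convolutions at x. *)
Lemma mollified_helmholtz M g x : (forall j, test_kernel M (g j)) ->
  \sum_(i < 3) conv ur (derive_factor i (derive_factor i g)) x
    + e^-1 ^+ 2 * conv ur g x + a / e * conv ui g x = conv fr g x /\
  \sum_(i < 3) conv ui (derive_factor i (derive_factor i g)) x
    + e^-1 ^+ 2 * conv ui g x - a / e * conv ur g x = conv fi g x.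
Proof.
move=> kg; have := sol (tensor_test_function x kg).
have E v : pairing v (fun y => tensor g (x - y)) =
  Complex (conv (fun y => complex.Re (v y)) g x) (conv (fun y => complex.Im (v y)) g x) by [].
have L : pairing u (laplacian (fun y => tensor g (x - y))) =
  Complex (\sum_(i < 3) conv ur (derive_factor i (derive_factor i g)) x)
     (\sum_(i < 3) conv ui (derive_factor i (derive_factor i g)) x).
  by rewrite -(conv_laplacian x kg sur) -(conv_laplacian x kg sui).
rewrite !E L exprVn => H; split.
- have := congr1 (@complex.Re R) H => /= <-; ring.
- have := congr1 (@complex.Im R) H => /= <-; ring.
Qed.

End mollified_equation.

(** * Coupling of a mollified source with a function *)

Section source_coupling.
Context {R : realType}.
Local Notation mu := (lebesgue3 R).
Variables (h : R).
Hypothesis h0 : 0 < h.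
Local Notation rho := (tensor (fun=> @mollifier R h)).

Let rho0 z : 0 <= rho z. Proof. exact: mollifier_tensor_ge0. Qed.

Let mrho : measurable_fun setT (rho : mR3 R -> R).
Proof. exact: measurable_tensor (mollifier_kernel h0). Qed.

Let mrho2 : measurable_fun setT (fun w : mR3 R * mR3 R => rho ((w.1 : R * R * R) - w.2)).
Proof. exact: measurable_tensor_sub (mollifier_kernel h0). Qed.

Lemma integral_mollifier_tensor : (\int[mu]_z (rho z)%:E = 1)%E.
Proof.
rewrite -(@ge0_integral_reflect _ (fun z => (rho z)%:E) 0); last 2 first.
- exact/measurable_EFinP.
- by move=> z; rewrite lee_fin.
exact: integral_mollifier.
Qed.

Lemma integral_mollifier_translate (y : R * R * R) :
  (\int[mu]_x (rho ((x : R * R * R) - y))%:E = 1)%E.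
Proof.
rewrite (@ge0_integral_translate _ (- y) (fun z => (rho z)%:E)).
- exact: integral_mollifier_tensor.
- exact/measurable_EFinP.
- by move=> z; rewrite lee_fin.
Qed.

(** Cauchy-Schwarz on the product space, a factor rho (x - y) ^ (1/2) being given to
    each side; both marginals of rho (x - y) have density 1. *)
Lemma mollified_cauchy_schwarz (f g : mR3 R -> R) (a b : R) : 0 <= a -> 0 <= b ->
  measurable_fun setT f -> measurable_fun setT g ->
  (forall x, 0 <= f x) -> (forall x, 0 <= g x) ->
  (\int[mu]_y (f y ^+ 2)%:E <= (a ^+ 2)%:E)%E -> (\int[mu]_x (g x ^+ 2)%:E <= (b ^+ 2)%:E)%E ->
  (\int[mu]_y \int[mu]_x (f y * rho ((x : R * R * R) - (y : R * R * R)) * g x)%:E <= (a * b)%:E)%E.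
Proof.
move=> a0 b0 mf mg f0 g0 fa gb.
pose s (w : mR3 R * mR3 R) := Num.sqrt (rho ((w.1 : R * R * R) - w.2)).
have ss w : s w * s w = rho ((w.1 : R * R * R) - w.2) by rewrite -expr2 sqr_sqrtr.
have ms : measurable_fun setT s.
  by apply: measurableT_comp mrho2 => //; exact: (continuous_measurable_fun (@sqrt_continuous R)).
pose F (w : mR3 R * mR3 R) := f w.2 * s w.
pose G (w : mR3 R * mR3 R) := g w.1 * s w.
have mF : measurable_fun setT F.
  by apply: measurable_funM => //; exact: (measurableT_comp mf measurable_snd).
have mG : measurable_fun setT G.
  by apply: measurable_funM => //; exact: (measurableT_comp mg measurable_fst).
have mF2 : measurable_fun setT (fun w => (F w ^+ 2)%:E).
  exact: measurable_sqr.
have mG2 : measurable_fun setT (fun w => (G w ^+ 2)%:E).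
  exact: measurable_sqr.
have mFG : measurable_fun setT (fun w => `|F w * G w|%:E).
  by apply/measurable_EFinP; apply: measurableT_comp => //; exact: measurable_funM.
have mf2 : measurable_fun setT (fun y => (f y ^+ 2)%:E).
  exact: measurable_sqr.
have mg2 : measurable_fun setT (fun y => (g y ^+ 2)%:E).
  exact: measurable_sqr.
have hF : (\int[mu \x mu]_w (F w ^+ 2)%:E <= (a ^+ 2)%:E)%E.
  apply: le_trans fa; rewrite (fubini_tonelli2 _ mF2); last by move=> w; rewrite lee_fin sqr_ge0.
  rewrite le_eqVlt; apply/orP; left; apply/eqP.
  apply: eq_integral => y _; rewrite /fubini_G /F /=.
  under eq_integral do rewrite exprMn [X in _ * X]expr2 ss EFinM /=.
  rewrite ge0_integralZl//.
  - by rewrite integral_mollifier_translate mule1.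
  - by apply/measurable_EFinP; exact: (measurableT_comp mrho2 (measurable_pair2 y)).
  - by move=> x _; rewrite lee_fin.
  - by rewrite lee_fin sqr_ge0.
have hG : (\int[mu \x mu]_w (G w ^+ 2)%:E <= (b ^+ 2)%:E)%E.
  apply: le_trans gb; rewrite (fubini_tonelli1 _ mG2); last by move=> w; rewrite lee_fin sqr_ge0.
  rewrite le_eqVlt; apply/orP; left; apply/eqP.
  apply: eq_integral => x _; rewrite /fubini_F /G /=.
  under eq_integral do rewrite exprMn [X in _ * X]expr2 ss EFinM /=.
  rewrite ge0_integralZl//.
  - by rewrite integral_mollifier// mule1.
  - by apply/measurable_EFinP; exact: (measurableT_comp mrho2 (measurable_pair1 x)).
  - by move=> y _; rewrite lee_fin.
  - by rewrite lee_fin sqr_ge0.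
have FG := cauchy_schwarz a0 b0 mF mG hF hG.
apply: le_trans FG; rewrite (fubini_tonelli2 _ mFG)//.
rewrite le_eqVlt; apply/orP; left; apply/eqP.
apply: eq_integral => y _; rewrite /fubini_G; apply: eq_integral => x _; congr (_%:E).
rewrite ger0_norm; last by rewrite !mulr_ge0// sqrtr_ge0.
by rewrite /F /G mulrACA ss/=; ring.
Qed.

Variables (f g : mR3 R -> R) (D E : nat -> set (mR3 R)) (a b : nat -> R).
Hypothesis mf : measurable_fun setT f.
Hypothesis mg : measurable_fun setT g.
Hypothesis f0 : forall x, 0 <= f x.
Hypothesis g0 : forall x, 0 <= g x.
Hypothesis mD : forall k, measurable (D k).
Hypothesis mE : forall k, measurable (E k).
Hypothesis tD : trivIset setT D.
Hypothesis DT : \bigcup_k D k = setT.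
(* E k absorbs the spreading of the piece D k by the kernel. *)
Hypothesis DE : forall k (x y : R * R * R), D k y -> rho (x - y) != 0 -> E k x.
Hypothesis a0 : forall k, 0 <= a k.
Hypothesis b0 : forall k, 0 <= b k.
Hypothesis fa : forall k, (\int[mu]_(y in D k) (f y ^+ 2)%:E <= (a k ^+ 2)%:E)%E.
Hypothesis gb : forall k, (\int[mu]_(x in E k) (g x ^+ 2)%:E <= (b k ^+ 2)%:E)%E.

Lemma mollified_coupling_le :
  (\int[mu]_x \int[mu]_y (f y * rho ((x : R * R * R) - (y : R * R * R)) * g x)%:E <=
   \sum_(0 <= k <oo) (a k * b k)%:E)%E.
Proof.
pose H (w : mR3 R * mR3 R) := (f w.2 * rho ((w.1 : R * R * R) - w.2) * g w.1)%:E.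
have H0 w : (0 <= H w)%E by rewrite lee_fin !mulr_ge0.
have mH : measurable_fun setT H.
  apply/measurable_EFinP; apply: measurable_funM.
    by apply: measurable_funM => //; exact: (measurableT_comp mf measurable_snd).
  exact: (measurableT_comp mg measurable_fst).
pose K (y : mR3 R) := (\int[mu]_x H (x, y))%E.
have mK : measurable_fun setT K by exact: (measurable_fun_fubini_tonelli_G H mH H0).
rewrite (fubini_tonelli H mH H0) -/(K _).
have -> : (\int[mu]_y K y = \int[mu]_(y in \bigcup_k D k) K y)%E by rewrite DT.
rewrite ge0_integral_bigcup//; last 2 first.
- exact: measurable_funTS.
- by move=> y _; exact: integral_ge0.
apply: lee_nneseries => [k _ _|k _].
  by apply: integral_ge0 => y _; exact: integral_ge0.
have ind (A : set (mR3 R)) (v : mR3 R -> R) (c : R) : measurable A -> measurable_fun setT v ->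
    (\int[mu]_(y in A) (v y ^+ 2)%:E <= c%:E)%E ->
    (\int[mu]_y ((v y * \1_A y) ^+ 2)%:E <= c%:E)%E.
  move=> mA mv; rewrite integral_mkcond; apply: le_trans.
  rewrite le_eqVlt; apply/orP; left; apply/eqP; apply: eq_integral => y _.
  rewrite patchE indicE; case: ifP => _; first by rewrite mulr1.
  by rewrite mulr0 expr0n.
have := @mollified_cauchy_schwarz (fun y => f y * \1_(D k) y) (fun x => g x * \1_(E k) x)
  (a k) (b k) (a0 k) (b0 k).
have mi (A : set (mR3 R)) (v : mR3 R -> R) : measurable A -> measurable_fun setT v ->
    measurable_fun setT (fun y => v y * \1_A y).
  by move=> mA mv; apply: measurable_funM => //; exact: measurable_indic.
have i0 (A : set (mR3 R)) (v : mR3 R -> R) : (forall x, 0 <= v x) ->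
    forall y, 0 <= v y * \1_A y.
  by move=> v0 y; rewrite mulr_ge0// indicE.
move=> /(_ (mi _ _ (mD k) mf) (mi _ _ (mE k) mg) (i0 _ _ f0) (i0 _ _ g0)).
move=> /(_ (ind _ _ _ (mD k) mf (fa k)) (ind _ _ _ (mE k) mg (gb k))).
apply: le_trans; rewrite le_eqVlt; apply/orP; left; apply/eqP.
rewrite integral_mkcond; apply: eq_integral => y _; rewrite patchE.
case: ifPn => [yD|yD]; last first.
  rewrite -[LHS](integral0 mu setT); apply: eq_integral => x _.
  by rewrite indicE (negbTE yD) mulr0 !mul0r.
apply: eq_integral => x _; rewrite /H indicE yD mulr1/=.
have [->|r0] := eqVneq (rho ((x : R * R * R) - y)) 0; first by rewrite mulr0 !mul0r.
rewrite inE in yD; by rewrite indicE mem_set ?mulr1//; exact: DE yD r0.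
Qed.

End source_coupling.

(** * Dyadic shells and the two norms *)

Section dyadic_shells.
Context {R : realType}.
Local Notation mu := (lebesgue3 R).

Definition dyadic_shell (k : nat) : set (mR3 R) := @shell R (k%:Z - 1).

Lemma sqr_euclid3 (x : R * R * R) : euclid3 x ^+ 2 = \sum_(j < 3) coord j x ^+ 2.
Proof.
rewrite /euclid3 sqr_sqrtr; last by rewrite !addr_ge0 ?sqr_ge0.
by rewrite !big_ord_recl big_ord0 addr0 addrA.
Qed.

Lemma euclid3_lt (x : R * R * R) (r : R) : 0 <= r ->
  (euclid3 x < r) = (\sum_(j < 3) coord j x ^+ 2 < r ^+ 2).
Proof. by move=> r0; rewrite -sqr_euclid3 ltr_pXn2r// nnegrE sqrtr_ge0. Qed.

Lemma dyadic_shellE k : dyadic_shell k = [set x |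
  (if k is k'.+1 then 2 ^+ k' <= euclid3 x else true) && (euclid3 x < 2 ^+ k)].
Proof.
rewrite /dyadic_shell /shell; case: k => [|k].
  by rewrite sub0r eqxx; apply/seteqP; split => x /=; rewrite expr0.
have -> : k.+1%:Z - 1 = k%:Z by rewrite -addn1 PoszD addrK.
by rewrite -PoszD addn1.
Qed.

Lemma dyadic_shell_lt k x : dyadic_shell k x -> euclid3 x < 2 ^+ k.
Proof. by rewrite dyadic_shellE/= => /andP[]. Qed.

Lemma measurable_euclid3 : measurable_fun setT (@euclid3 R : mR3 R -> R).
Proof.
have -> : (@euclid3 R : mR3 R -> R) = (fun x : mR3 R => Num.sqrt (\sum_(j < 3) coord j x ^+ 2)).
  by apply/funext => x; rewrite -sqr_euclid3 sqrtr_sqr ger0_norm ?sqrtr_ge0.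
have := @measurable_sum _ _ R setT 'I_3 (index_enum _) (fun j (x : mR3 R) => coord j x ^+ 2).
move=> /(_ (fun j => measurable_funX 2 (measurable_coord j))) ms.
by apply: measurableT_comp ms => //; exact: (continuous_measurable_fun (@sqrt_continuous R)).
Qed.

Lemma measurable_euclid3_lt r : measurable [set x : mR3 R | euclid3 x < r].
Proof.
rewrite -[X in measurable X]setTI.
have mf : measurable_fun setT (fun x : mR3 R => euclid3 x < r).
  by apply: measurable_fun_ltr => //; exact: measurable_euclid3.
by have := mf measurableT [set true] I; rewrite preimage_true.
Qed.

Lemma measurable_dyadic_shell k : measurable (dyadic_shell k).
Proof.
rewrite dyadic_shellE; case: k => [|k]; first exact: measurable_euclid3_lt.
rewrite [X in measurable X](_ : _ = [set x | euclid3 x < 2 ^+ k.+1] `\` [set x | euclid3 x < 2 ^+ k]).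
  by apply: measurableD; exact: measurable_euclid3_lt.
apply/seteqP; split => x /=; first by move=> /andP[h ?]; split => //; rewrite ltNge h.
by move=> [-> /negP]; rewrite -leNgt => ->.
Qed.

Lemma trivIset_dyadic_shell : trivIset setT dyadic_shell.
Proof.
suff h (i j : nat) (x : mR3 R) : (i < j)%N -> dyadic_shell i x -> ~ dyadic_shell j x.
  move=> i j _ _ [x [xi xj]]; case: (ltngtP i j) => // ij.
  - by have := h i j x ij xi xj.
  - by have := h j i x ij xj xi.
rewrite !dyadic_shellE; case: j => //= j ij /andP[_ xi] /andP[xj _].
have : (2 : R) ^+ i <= 2 ^+ j by rewrite ler_weXn2l// ler1n.
by move=> /(lt_le_trans xi)/lt_le_trans/(_ xj); rewrite ltxx.
Qed.

Lemma bigcup_dyadic_shell : \bigcup_k dyadic_shell k = setT.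
Proof.
apply/seteqP; split => // x _.
have ex : exists k, euclid3 x < (2 : R) ^+ k.
  exists (Num.Def.trunc (euclid3 x)).+1.
  apply: lt_trans (truncnS_gt (euclid3 x)) _.
  by rewrite -natrX ltr_nat ltn_expl.
case: (ex_minnP ex) => k xk kmin; exists k => //; rewrite dyadic_shellE/= xk andbT.
case: k xk kmin => // k _ kmin; rewrite leNgt; apply/negP => /kmin.
by rewrite ltnn.
Qed.

End dyadic_shells.

Section besov_type_norms.
Context {R : realType}.
Local Notation mu := (lebesgue3 R).

Lemma sqr_normc (z : R[i]) : normc z ^+ 2 = complex.Re z ^+ 2 + complex.Im z ^+ 2.
Proof. by case: z => x y /=; rewrite sqr_sqrtr// addr_ge0 ?sqr_ge0. Qed.

Lemma measurable_sqr_normc (S : mR3 R -> R[i]) : measurable_cplx S ->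
  measurable_fun setT (fun x => (normc (S x) ^+ 2)%:E).
Proof.
move=> [mr mi]; apply/measurable_EFinP.
under eq_fun do rewrite sqr_normc.
by apply: measurable_funD; exact: measurable_funX.
Qed.

Lemma sqnorm2_onE A (S : mR3 R -> R[i]) :
  sqnorm2_on A S = (\int[mu]_(x in A) (normc (S x) ^+ 2)%:E)%E.
Proof. by []. Qed.

Lemma sqnorm2_on_ge0 A (S : mR3 R -> R[i]) : (0 <= sqnorm2_on A S)%E.
Proof. by apply: integral_ge0 => x _; rewrite lee_fin sqr_ge0. Qed.

Definition shell_mass (S : mR3 R -> R[i]) k : R := fine (sqnorm2_on (dyadic_shell k) S).

Lemma shell_mass_ge0 S k : 0 <= shell_mass S k.
Proof. by apply: fine_ge0; exact: sqnorm2_on_ge0. Qed.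

Let term (S : mR3 R -> R[i]) k : \bar R :=
  sqrte (((2 : R) ^+ k)%:E * sqnorm2_on (dyadic_shell k) S)%E.

Let B_norm_term S : B_norm S = (\sum_(0 <= k <oo) term S k)%E.
Proof.
rewrite /B_norm; apply: eq_eseriesr => k _; rewrite /term /dyadic_shell.
by rewrite subrK.
Qed.

Let term_ge0 S k : (0 <= term S k)%E. Proof. exact: sqrte_ge0. Qed.

Lemma B_norm_ge0 (S : mR3 R -> R[i]) : (0 <= B_norm S)%E.
Proof. by rewrite B_norm_term; apply: nneseries_ge0. Qed.

Let term_le S k : (term S k <= B_norm S)%E.
Proof.
rewrite B_norm_term; apply: le_trans (nneseries_lim_ge k.+1 (fun n _ _ => term_ge0 S n)).
by rewrite big_nat_recr//= leeDr// sume_ge0.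
Qed.

Lemma sqnorm2_shell (S : mR3 R -> R[i]) k : in_B S ->
  sqnorm2_on (dyadic_shell k) S = (shell_mass S k)%:E.
Proof.
move=> [_ By]; rewrite /shell_mass fineK//.
have t2 : (0 <= ((2 : R) ^+ k)%:E * sqnorm2_on (dyadic_shell k) S)%E.
  by rewrite mule_ge0 ?sqnorm2_on_ge0// lee_fin.
have : term S k \is a fin_num by rewrite ge0_fin_numE// (le_lt_trans (term_le S k)).
rewrite /term sqrte_fin_num//; have := sqnorm2_on_ge0 (dyadic_shell k) S.
case: (sqnorm2_on _ _) => //= _; rewrite mulry gtr0_sg ?exprn_gt0//.
by rewrite mul1e.
Qed.

Let term_mass S k : in_B S -> term S k = (Num.sqrt (2 ^+ k * shell_mass S k))%:E.
Proof. by move=> hS; rewrite /term sqnorm2_shell// -EFinM. Qed.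

Lemma B_normE (S : mR3 R -> R[i]) : in_B S ->
  B_norm S = (\sum_(0 <= k <oo) (Num.sqrt (2 ^+ k * shell_mass S k))%:E)%E.
Proof.
by move=> hS; rewrite B_norm_term; apply: eq_eseriesr => k _; rewrite term_mass.
Qed.

(** All weights 2 ^ k are at least 1, and a sum of squares of nonnegative terms is at
    most the square of their sum. *)
Lemma sqnorm2_le_B_norm (S : mR3 R -> R[i]) : in_B S ->
  (sqnorm2_on setT S <= B_norm S * B_norm S)%E.
Proof.
move=> hS; have By := hS.2.
have Bf : B_norm S \is a fin_num by rewrite ge0_fin_numE ?B_norm_ge0.
rewrite sqnorm2_onE -(@bigcup_dyadic_shell R) ge0_integral_bigcup//; last 4 first.
- by move=> k; exact: measurable_dyadic_shell.
- by apply: measurable_funTS; exact: measurable_sqr_normc hS.1.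
- by move=> x _; rewrite lee_fin sqr_ge0.
- exact: trivIset_dyadic_shell.
rewrite -{1}(fineK Bf) [in X in (_ <= _ * X)%E]B_norm_term -nneseriesZl//.
apply: lee_nneseries => [k _ _|k _].
  by apply: integral_ge0 => x _; rewrite lee_fin sqr_ge0.
rewrite fineK//; apply: (@le_trans _ _ (term S k * term S k)%E); last first.
  by apply: lee_wpmul2r; [exact: term_ge0|exact: term_le].
rewrite -sqnorm2_onE term_mass// sqnorm2_shell// -EFinM lee_fin -expr2 sqr_sqrtr.
  by rewrite ler_peMl ?shell_mass_ge0// exprn_ege1// ler1n.
by rewrite mulr_ge0 ?shell_mass_ge0.
Qed.

(** The shell of index j = k - 1 lies in the ball of radius 2 ^ k and carries the weight
    2 ^ (- j) = 2 / 2 ^ k. *)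
Lemma le_Bstar_norm (u : mR3 R -> R[i]) (M : R) : 0 <= M ->
  (forall k, (\int[mu]_(x in [set x : mR3 R | (euclid3 x < 2 ^+ k)%R]) (normc (u x) ^+ 2)%:E <=
     (2 ^+ k * M ^+ 2)%:E)%E) -> measurable_cplx u ->
  (Bstar_norm u <= (2 * M)%:E)%E.
Proof.
move=> M0 h mu_; apply: ge_ereal_sup => _ [k _ <-] /=.
have -> : (2 * M)%:E = sqrte ((4 * M ^+ 2)%:E) :> \bar R.
  by rewrite /= (_ : 4 * M ^+ 2 = (2 * M) ^+ 2) ?sqrtr_sqr ?ger0_norm ?mulr_ge0//; ring.
rewrite lee_sqrt; last by rewrite lee_fin mulr_ge0// sqr_ge0.
have hk : (sqnorm2_on (dyadic_shell k) u <= (2 ^+ k * M ^+ 2)%:E)%E.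
  apply: le_trans (h k); apply: ge0_subset_integral => //.
  - exact: measurable_dyadic_shell.
  - exact: measurable_euclid3_lt.
  - by apply: measurable_funTS; exact: measurable_sqr_normc.
  - by move=> x _; rewrite lee_fin sqr_ge0.
  - by move=> x; exact: dyadic_shell_lt.
have -> : (2 : R) ^ (- (k%:Z - 1)) = 2 * 2 ^- k.
  by rewrite opprB expfzDr// expr1z -exprnN.
have -> : (4 * M ^+ 2)%:E = ((2 * 2 ^- k)%:E * (2 ^+ k * (2 * M ^+ 2))%:E)%E :> \bar R.
  by rewrite -EFinM; congr (_%:E); field; rewrite expf_neq0.
apply: lee_wpmul2l; first by rewrite lee_fin mulr_ge0// invr_ge0 exprn_ge0.
apply: le_trans hk _; rewrite lee_fin ler_wpM2l ?exprn_ge0//.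
by have := sqr_ge0 M; lra.
Qed.

End besov_type_norms.

(** * A rescaled source *)

Section rescaled_sources.
Context {R : realType}.
Local Notation mu := (lebesgue3 R).
Variables (e : R) (c : R * R * R).
Hypothesis e0 : 0 < e.

Definition rescale (x : mR3 R) : mR3 R := e^-1 *: ((x : R * R * R) - c).

Lemma coord_rescale j x : coord j (rescale x) = e^-1 * (coord j x - coord j c).
Proof. by rewrite /rescale coordZ coordB. Qed.

Lemma rescale_affine3 : rescale = affine3 e^-1 (- (e^-1 *: c)).
Proof.
apply/funext => x; rewrite /rescale scalerBr addrC.
by rewrite /affine3.
Qed.

Lemma measurable_rescale : measurable_fun setT rescale.
Proof. by rewrite rescale_affine3; exact: measurable_affine3. Qed.

Lemma ge0_integral_rescale (A : set (mR3 R)) (v : mR3 R -> \bar R) : measurable A ->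
  measurable_fun setT v -> (forall x, 0 <= v x)%E ->
  (\int[mu]_(x in rescale @^-1` A) v (rescale x) = (e ^+ 3)%:E * \int[mu]_(x in A) v x)%E.
Proof.
move=> mA mv v0; rewrite integral_mkcond [X in (_ * X)%E]integral_mkcond.
have -> : ((fun x => v (rescale x)) \_ (rescale @^-1` A)) =
   (fun x => (v \_ A) (affine3 e^-1 (- (e^-1 *: c)) x)).
  apply/funext => x; rewrite -rescale_affine3 !patchE.
  by rewrite (_ : (x \in rescale @^-1` A) = (rescale x \in A))//; apply/idP/idP; rewrite !inE.
rewrite ge0_integral_affine3.
- by rewrite gtr0_norm ?invr_gt0// exprVn invrK.
- by rewrite invr_neq0// gt_eqF.
- by apply/(measurable_restrictT _ mA); exact: measurable_funTS.
- by move=> x; rewrite patchE; case: ifP.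
Qed.

Variable S : mR3 R -> R[i].
Hypothesis BS : in_B S.

Definition source_modulus (x : mR3 R) : R :=
  e ^- 3 * (`|complex.Re (S (rescale x))| + `|complex.Im (S (rescale x))|).

Lemma source_modulus_ge0 x : 0 <= source_modulus x.
Proof. by rewrite mulr_ge0 ?addr_ge0// invr_ge0 exprn_ge0// ltW. Qed.

Lemma measurable_source_modulus : measurable_fun setT source_modulus.
Proof.
have [[mr mi] _] := BS; apply: measurable_funM => //.
by apply: measurable_funD; apply: measurableT_comp => //;
  [apply: measurableT_comp mr _|apply: measurableT_comp mi _]; exact: measurable_rescale.
Qed.

Let e30 : 0 <= e ^- 3. Proof. by rewrite invr_ge0 exprn_ge0// ltW. Qed.

Lemma sqr_source_modulus_le x :
  source_modulus x ^+ 2 <= 2 * (e ^- 3) ^+ 2 * normc (S (rescale x)) ^+ 2.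
Proof.
rewrite /source_modulus exprMn [leRHS](_ : _ = (e ^- 3) ^+ 2 * (2 * normc (S (rescale x)) ^+ 2)); last by ring.
rewrite ler_wpM2l ?sqr_ge0// sqr_normc.
rewrite -(real_normK (num_real (complex.Re _))) -(real_normK (num_real (complex.Im _))).
by have := sqr_ge0 (`|complex.Re (S (rescale x))| - `|complex.Im (S (rescale x))|); lra.
Qed.

Lemma measurable_rescale_normc :
  measurable_fun setT (fun x : mR3 R => (e ^- 3) ^+ 2 * normc (S (rescale x)) ^+ 2).
Proof.
apply: measurable_funM => //; apply/measurable_EFinP.
exact: (measurableT_comp (measurable_sqr_normc BS.1) measurable_rescale).
Qed.

Lemma integral_rescale_normc (A : set (mR3 R)) : measurable A ->
  (\int[mu]_(x in rescale @^-1` A) ((e ^- 3) ^+ 2 * normc (S (rescale x)) ^+ 2)%:E =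
   (e ^- 3)%:E * sqnorm2_on A S)%E.
Proof.
move=> mA; have mS := measurable_sqr_normc BS.1.
rewrite (_ : (fun x : mR3 R => _) = (fun x : mR3 R => ((e ^- 3) ^+ 2)%:E * (normc (S (rescale x)) ^+ 2)%:E)%E); last first.
  by apply/funext => x; rewrite EFinM.
have mA' : measurable (rescale @^-1` A).
  by rewrite -[X in measurable X]setTI; exact: measurable_rescale.
rewrite ge0_integralZl//.
- rewrite (ge0_integral_rescale mA mS); last by move=> x; rewrite lee_fin sqr_ge0.
  rewrite muleA -EFinM -sqnorm2_onE; congr (_%:E * _)%E.
  by rewrite expr2 -mulrA mulVf ?mulr1// expf_neq0// gt_eqF.
- by apply: measurable_funTS; exact: (measurableT_comp mS measurable_rescale).
- by move=> x _; rewrite lee_fin sqr_ge0.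
- by rewrite lee_fin sqr_ge0.
Qed.

Lemma integral_sqr_source_modulus k :
  (\int[mu]_(x in rescale @^-1` dyadic_shell k) (source_modulus x ^+ 2)%:E <=
   (2 * e ^- 3 * shell_mass S k)%:E)%E.
Proof.
have mA := @measurable_dyadic_shell R k.
have mA' : measurable (rescale @^-1` dyadic_shell k).
  by rewrite -[X in measurable X]setTI; exact: measurable_rescale.
rewrite -mulrA EFinM (EFinM (e ^- 3)) -sqnorm2_shell// -integral_rescale_normc//.
apply: ge0_le_integral_lin1 => //.
- by apply: measurable_funTS; apply: measurable_funX; exact: measurable_source_modulus.
- by apply: measurable_funTS; exact: measurable_rescale_normc.
- by move=> x; exact: sqr_ge0.
- by move=> x; rewrite mulr_ge0 ?sqr_ge0.
- by move=> x _; rewrite mulrA; exact: sqr_source_modulus_le.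
Qed.

Variables (h K : R) (A : mR3 R -> R).
Hypothesis h0 : 0 < h.
Hypothesis he : 2 * h <= e.
Hypothesis K0 : 0 <= K.
Hypothesis mA : measurable_fun setT A.
Hypothesis A0 : forall x, 0 <= A x.
Hypothesis AK : forall r : R, e <= r ->
  (\int[mu]_(x in ball3 c r) (A x ^+ 2)%:E <= (K * r)%:E)%E.
Local Notation rho := (tensor (fun=> @mollifier R h)).

(** On the k-th shell around c, dilated by e, the square of the source has mass at
    most 2 e^-3 times that of S on the shell, and on the ball of radius 2 e 2^k the
    square of A has mass at most 2 K e 2^k. The geometric mean is a multiple of
    e^-1 times the k-th term of the B norm. *)
Lemma source_coupling_le :
  (\int[mu]_x \int[mu]_y (source_modulus y * rho ((x : R * R * R) - (y : R * R * R)) * A x)%:E <=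
   (2 * Num.sqrt K * e^-1)%:E * B_norm S)%E.
Proof.
have pow0 k : 0 < 2 ^+ k :> R by rewrite exprn_gt0.
have pow1 k : 1 <= 2 ^+ k :> R by rewrite exprn_ege1// ler1n.
pose r k : R := e * (2 * 2 ^+ k).
have r0 k : 0 <= r k by rewrite mulr_ge0 ?(ltW e0)// mulr_ge0// ltW.
have er k : e <= r k.
  by rewrite /r ler_peMr ?(ltW e0)//; have := pow1 k; lra.
pose a k := Num.sqrt (2 * e ^- 3 * shell_mass S k).
pose b k := Num.sqrt (K * r k).
have a2 k : 0 <= 2 * e ^- 3 * shell_mass S k by rewrite mulr_ge0 ?shell_mass_ge0// mulr_ge0.
have b2 k : 0 <= K * r k by rewrite mulr_ge0.
rewrite B_normE// -nneseriesZl; last by move=> k _; rewrite lee_fin sqrtr_ge0.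
rewrite (_ : \sum_(0 <= k <oo) _ = \sum_(0 <= k <oo) (a k * b k)%:E)%E; last first.
  apply: eq_eseriesr => k _; rewrite -EFinM /a /b -sqrtrM//; congr (_%:E).
  rewrite -[2](ger0_norm (ler0n _ 2)) -(sqrtr_sqr 2) -sqrtrM ?sqr_ge0//.
  rewrite -[e^-1]ger0_norm ?invr_ge0 ?(ltW e0)// -(sqrtr_sqr e^-1) -sqrtrM; last first.
    by rewrite mulr_ge0 ?sqr_ge0.
  rewrite -sqrtrM; last by rewrite mulr_ge0 ?sqr_ge0// mulr_ge0 ?sqr_ge0.
  by congr (Num.sqrt _); rewrite /r !sqrtr_sqr !(ger0_norm (ler0n R 2)); field; rewrite gt_eqF.
apply: (@mollified_coupling_le _ h h0 source_modulus A
  (fun k => rescale @^-1` dyadic_shell k) (fun k => ball3 c (r k)) a b) => //.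
- exact: measurable_source_modulus.
- exact: source_modulus_ge0.
- move=> k; rewrite -[X in measurable X]setTI; apply: measurable_rescale => //.
  exact: measurable_dyadic_shell.
- by move=> k; exact: measurable_ball3.
- move=> i j _ _ [x [xi xj]]; apply: (@trivIset_dyadic_shell R i j I I).
  by exists (rescale x).
- apply/seteqP; split => // x _.
  have : (\bigcup_k dyadic_shell k) (rescale x) by rewrite bigcup_dyadic_shell.
  by move=> [k _ xk]; exists k.
- move=> k x y /= /dyadic_shell_lt; rewrite euclid3_lt ?(ltW (pow0 k))// => yk xy.
  (* y is within e 2^k of c, and the kernel moves each coordinate by at most e / 2 *)
  have h1 : \sum_(j < 3) (coord j y - coord j c) ^+ 2 < e ^+ 2 * (2 ^+ k) ^+ 2.
    rewrite -(ltr_pM2l (_ : 0 < (e^-1) ^+ 2)) ?exprn_gt0 ?invr_gt0//.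
    rewrite mulrA -exprMn mulVf ?gt_eqF// expr1n mul1r; apply: le_lt_trans yk.
    rewrite mulr_sumr; apply: ler_sum => j _; by rewrite coord_rescale exprMn.
  have h2 j : (coord j x - coord j y) ^+ 2 <= h ^+ 2.
    rewrite -real_normK ?num_real// lerXn2r ?nnegrE ?(ltW h0)//.
    rewrite leNgt; apply: contra xy => hj; rewrite -coordB in hj.
    by rewrite (tensor_eq0 (mollifier_kernel h0) hj).
  have h3 : \sum_(j < 3) (coord j x - coord j c) ^+ 2 <=
      \sum_(j < 3) (2 * h ^+ 2 + 2 * (coord j y - coord j c) ^+ 2).
    apply: ler_sum => j _; have := h2 j.
    by have := sqr_ge0 ((coord j x - coord j y) - (coord j y - coord j c)); lra.
  apply: le_lt_trans h3 _; rewrite big_split/= sumr_const card_ord -mulr_sumr.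
  have h4 : (2 * h) ^+ 2 <= e ^+ 2 by rewrite lerXn2r ?nnegrE// ?mulr_ge0// ltW.
  have h5 : e ^+ 2 <= e ^+ 2 * (2 ^+ k) ^+ 2.
    by rewrite ler_peMr ?sqr_ge0// exprn_ege1.
  have -> : r k ^+ 2 = 4 * (e ^+ 2 * (2 ^+ k) ^+ 2) by rewrite /r; ring.
  rewrite exprMn in h4; have : 0 < e ^+ 2 * (2 ^+ k) ^+ 2 by rewrite mulr_gt0 ?exprn_gt0.
  move: h4 h5 h1; rewrite -mulr_natr.
  move: (e ^+ 2 * _) (\sum_(j < 3) _) => Z Y h4 h5 h1 Z0; lra.
- by move=> k; exact: sqrtr_ge0.
- by move=> k; exact: sqrtr_ge0.
- by move=> k; rewrite sqr_sqrtr//; exact: integral_sqr_source_modulus.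
- by move=> k; rewrite sqr_sqrtr//; exact: AK.
Qed.

End rescaled_sources.

(** * Two sources *)

Section two_sources.
Context {R : realType}.
Local Notation mu := (lebesgue3 R).

Lemma in_L2_square_integrable (u : mR3 R -> R[i]) : in_L2 u ->
  square_integrable (fun x : mR3 R => complex.Re (u x)) /\
  square_integrable (fun x : mR3 R => complex.Im (u x)).
Proof.
move=> [mu_ uy]; have [mr mi] := mu_; have mS := measurable_sqr_normc mu_.
have le (v : mR3 R -> R) : measurable_fun setT v ->
    (forall x, v x ^+ 2 <= normc (u x) ^+ 2) -> square_integrable v.
  move=> mv vu; split => //; apply: le_lt_trans uy.
  apply: ge0_le_integral => //.
  - by move=> x _; rewrite lee_fin sqr_ge0.
  - by apply/measurable_EFinP; exact: measurable_funX.
  - by move=> x _; rewrite lee_fin.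
split; apply: le => // x; rewrite sqr_normc.
  by rewrite lerDl sqr_ge0.
by rewrite lerDr sqr_ge0.
Qed.

Variables (e : R) (c1 c2 : R * R * R) (S1 S2 : mR3 R -> R[i]).
Hypothesis e0 : 0 < e.
Hypothesis BS1 : in_B S1.
Hypothesis BS2 : in_B S2.

Definition two_sources (x : mR3 R) : R[i] :=
  ((e ^- 3)%:C)%C * S1 (rescale e c1 x) + ((e ^- 3)%:C)%C * S2 (rescale e c2 x).

Lemma Re_two_sources x : complex.Re (two_sources x) =
  e ^- 3 * complex.Re (S1 (rescale e c1 x)) + e ^- 3 * complex.Re (S2 (rescale e c2 x)).
Proof. by rewrite /two_sources; case: (S1 _) => ? ?; case: (S2 _) => ? ? /=; ring. Qed.

Lemma Im_two_sources x : complex.Im (two_sources x) =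
  e ^- 3 * complex.Im (S1 (rescale e c1 x)) + e ^- 3 * complex.Im (S2 (rescale e c2 x)).
Proof. by rewrite /two_sources; case: (S1 _) => ? ?; case: (S2 _) => ? ? /=; ring. Qed.

Let e30 : 0 <= e ^- 3. Proof. by rewrite invr_ge0 exprn_ge0// ltW. Qed.

Lemma two_sources_modulus_le x :
  `|complex.Re (two_sources x)| + `|complex.Im (two_sources x)| <=
  source_modulus e c1 S1 x + source_modulus e c2 S2 x.
Proof.
rewrite Re_two_sources Im_two_sources /source_modulus -!mulrDr !normrM (ger0_norm e30).
rewrite -!mulrDr ler_wpM2l//.
move: (complex.Re _) (complex.Re _) (complex.Im _) (complex.Im _) => a b a' b'.
by have := ler_normD b a; have := ler_normD b' a'; lra.
Qed.

Lemma sqr_normc_two_sources_le x : normc (two_sources x) ^+ 2 <=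
  2 * ((e ^- 3) ^+ 2 * normc (S1 (rescale e c1 x)) ^+ 2) +
  2 * ((e ^- 3) ^+ 2 * normc (S2 (rescale e c2 x)) ^+ 2).
Proof.
rewrite !sqr_normc Re_two_sources Im_two_sources; move: (e ^- 3) => k.
move: (complex.Re _) (complex.Re _) (complex.Im _) (complex.Im _) => a b a' b'.
rewrite -subr_ge0 [leRHS](_ : _ = (k * (a - b)) ^+ 2 + (k * (a' - b')) ^+ 2); last by ring.
by rewrite addr_ge0 ?sqr_ge0.
Qed.

Lemma measurable_two_sources : measurable_cplx two_sources.
Proof.
have [[mr1 mi1] _] := BS1; have [[mr2 mi2] _] := BS2.
have m (f g : mR3 R -> R) : measurable_fun setT f -> measurable_fun setT g ->
    measurable_fun setT (fun x : mR3 R => e ^- 3 * f (rescale e c1 x) + e ^- 3 * g (rescale e c2 x)).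
  move=> mf mg; apply: measurable_funD; apply: measurable_funM => //.
    exact: (measurableT_comp mf (measurable_rescale e c1)).
  exact: (measurableT_comp mg (measurable_rescale e c2)).
split.
  by under eq_fun do rewrite Re_two_sources; exact: (m _ _ mr1 mr2).
by under eq_fun do rewrite Im_two_sources; exact: (m _ _ mi1 mi2).
Qed.

Lemma integral_sqr_two_sources_le :
  (\int[mu]_x (normc (two_sources x) ^+ 2)%:E <=
   (2 * e ^- 3)%:E * (B_norm S1 + B_norm S2) * (B_norm S1 + B_norm S2))%E.
Proof.
have b1 := B_norm_ge0 S1; have b2 := B_norm_ge0 S2.
have iN c (S : mR3 R -> R[i]) : in_B S ->
    (\int[mu]_x ((e ^- 3) ^+ 2 * normc (S (rescale e c x)) ^+ 2)%:E <=
     (e ^- 3)%:E * (B_norm S * B_norm S))%E.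
  move=> BS; have := integral_rescale_normc c e0 BS measurableT.
  rewrite preimage_setT => ->; apply: lee_wpmul2l; first by rewrite lee_fin.
  exact: sqnorm2_le_B_norm.
have N0 c (S : mR3 R -> R[i]) (x : mR3 R) : 0 <= (e ^- 3) ^+ 2 * normc (S (rescale e c x)) ^+ 2.
  by rewrite mulr_ge0 ?sqr_ge0.
have mN : measurable_fun setT (fun x => normc (two_sources x) ^+ 2).
  by apply/measurable_EFinP; exact: measurable_sqr_normc measurable_two_sources.
have := ge0_le_integral_lin2 mu measurableT (ler0n R 2) (ler0n R 2) mN
  (measurable_rescale_normc e c1 BS1) (measurable_rescale_normc e c2 BS2) (fun=> sqr_ge0 _)
  (N0 c1 S1) (N0 c2 S2) (fun x _ => sqr_normc_two_sources_le x).
move=> /le_trans; apply.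
apply: (@le_trans _ _ (2%:E * ((e ^- 3)%:E * (B_norm S1 * B_norm S1)) +
   2%:E * ((e ^- 3)%:E * (B_norm S2 * B_norm S2)))%E).
  by apply: leeD; apply: lee_wpmul2l => //; exact: iN.
have f1 : B_norm S1 \is a fin_num by rewrite ge0_fin_numE// BS1.2.
have f2 : B_norm S2 \is a fin_num by rewrite ge0_fin_numE// BS2.2.
move: f1 f2 b1 b2; case: (B_norm S1) => // x1 _; case: (B_norm S2) => // x2 _.
move=> h1 h2; have x10 : 0 <= x1 by rewrite -lee_fin.
have x20 : 0 <= x2 by rewrite -lee_fin.
suff : 2 * (e ^- 3 * (x1 * x1)) + 2 * (e ^- 3 * (x2 * x2)) <= 2 * e ^- 3 * (x1 + x2) * (x1 + x2).
  by rewrite -lee_fin.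
rewrite -subr_ge0 [leRHS](_ : _ = 4 * (e ^- 3 * (x1 * x2))); last by ring.
by rewrite !mulr_ge0.
Qed.

Lemma in_L2_two_sources : in_L2 two_sources.
Proof.
split; first exact: measurable_two_sources.
apply: le_lt_trans integral_sqr_two_sources_le _.
have f1 : B_norm S1 \is a fin_num by rewrite ge0_fin_numE ?B_norm_ge0// BS1.2.
have f2 : B_norm S2 \is a fin_num by rewrite ge0_fin_numE ?B_norm_ge0// BS2.2.
by move: f1 f2; case: (B_norm S1) => // x1 _; case: (B_norm S2) => // x2 _; rewrite ltry.
Qed.

Variables (h : R).
Hypothesis h0 : 0 < h.
Local Notation rho := (fun=> @mollifier R h).
Local Notation p := (conv (fun x : mR3 R => complex.Re (two_sources x)) rho).
Local Notation q := (conv (fun x : mR3 R => complex.Im (two_sources x)) rho).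

Lemma mollified_sources_le (x : R * R * R) : ((`|p x| + `|q x|)%:E <=
  \int[mu]_y ((source_modulus e c1 S1 y + source_modulus e c2 S2 y)
     * tensor rho (x - (y : R * R * R)))%:E)%E.
Proof.
have [sr si] := in_L2_square_integrable in_L2_two_sources.
have kg := @mollifier_kernel R h h0.
have mt := measurable_tensor_reflect kg x.
have t0 (y : mR3 R) : 0 <= tensor rho (x - (y : R * R * R)) by exact: mollifier_tensor_ge0.
have one (v : mR3 R -> R) : square_integrable v -> (`|conv v rho x|%:E <=
    \int[mu]_y (`|v y| * tensor rho (x - (y : R * R * R)))%:E)%E.
  move=> sv; have iv := conv_integrable x kg (square_integrable_abs sv).
  have i := conv_integrable x kg sv.
  apply: (@le_trans _ _ (\int[mu]_y (`|v y| * tensor rho (x - (y : R * R * R))))%:E).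
    rewrite lee_fin; apply: le_trans (le_normr_Rintegral measurableT i) _.
    by under eq_Rintegral do rewrite normrM (ger0_norm (t0 _)).
  rewrite /Rintegral fineK//.
  exact: integrable_fin_num.
have mabs (v : mR3 R -> R) : square_integrable v ->
    measurable_fun setT (fun y : mR3 R => (`|v y| * tensor rho (x - (y : R * R * R)))%:E).
  move=> sv; apply/measurable_EFinP; apply: measurable_funM => //.
  by apply: measurableT_comp => //; exact: sv.1.
rewrite EFinD; apply: le_trans (leeD (one _ sr) (one _ si)) _.
rewrite -ge0_integralD//; last 4 first.
- by move=> y _; rewrite lee_fin mulr_ge0.
- exact: mabs.
- by move=> y _; rewrite lee_fin mulr_ge0.
- exact: mabs.
apply: ge0_le_integral => //.
- by move=> y _; rewrite adde_ge0// lee_fin mulr_ge0.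
- by apply: emeasurable_funD; exact: mabs.
- apply/measurable_EFinP; apply: measurable_funM => //.
  by apply: measurable_funD; exact: measurable_source_modulus.
- by move=> y _; rewrite -EFinD -mulrDl lee_fin ler_wpM2r// two_sources_modulus_le.
Qed.

Variables (K : R) (A : mR3 R -> R).
Hypothesis he : 2 * h <= e.
Hypothesis K0 : 0 <= K.
Hypothesis mA : measurable_fun setT A.
Hypothesis A0 : forall x, 0 <= A x.
Hypothesis AK : forall c (r : R), e <= r ->
  (\int[mu]_(x in ball3 c r) (A x ^+ 2)%:E <= (K * r)%:E)%E.

(** Each source is decomposed around its own centre, where the hypothesis on A is
    applied; the distance between the centres therefore never appears. *)
Lemma two_sources_coupling_le :
  (\int[mu]_x ((`|p x| + `|q x|) * A x)%:E <=
   (2 * Num.sqrt K * e^-1)%:E * (B_norm S1 + B_norm S2))%E.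
Proof.
have [sr si] := in_L2_square_integrable in_L2_two_sources.
have kg := @mollifier_kernel R h h0.
pose G c S (w : mR3 R * mR3 R) : \bar R :=
  (source_modulus e c S w.2 * tensor rho ((w.1 : R * R * R) - w.2) * A w.1)%:E.
have mG c S : in_B S -> measurable_fun setT (G c S).
  move=> BS; apply/measurable_EFinP; apply: measurable_funM; last first.
    exact: (measurableT_comp mA measurable_fst).
  apply: measurable_funM; last exact: measurable_tensor_sub kg.
  exact: (measurableT_comp (measurable_source_modulus _ _ BS) measurable_snd).
have G0 c S w : (0 <= G c S w)%E.
  by rewrite lee_fin !mulr_ge0 ?source_modulus_ge0// mollifier_tensor_ge0.
have mGx c S (x : mR3 R) : in_B S -> measurable_fun setT (fun y : mR3 R => G c S (x, y)).
  by move=> BS; exact: (measurableT_comp (mG c S BS) (measurable_pair1 x)).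
apply: (@le_trans _ _ (\int[mu]_x (\int[mu]_y G c1 S1 (x, y) + \int[mu]_y G c2 S2 (x, y)))%E).
  apply: ge0_le_integral => //.
  - by move=> x _; rewrite lee_fin mulr_ge0// addr_ge0.
  - apply/measurable_EFinP; apply: measurable_funM => //.
    by apply: measurable_funD; apply: measurableT_comp => //;
      [exact: conv_measurable kg sr.1|exact: conv_measurable kg si.1].
  - apply: emeasurable_funD.
      exact: (measurable_fun_fubini_tonelli_F _ (mG c1 S1 BS1) (G0 c1 S1)).
    exact: (measurable_fun_fubini_tonelli_F _ (mG c2 S2 BS2) (G0 c2 S2)).
  move=> x _; rewrite -ge0_integralD//; [|exact: mGx|exact: mGx].
  rewrite EFinM; have mt := measurable_tensor_reflect kg (x : R * R * R).
  apply: le_trans (lee_wpmul2r _ (mollified_sources_le x)) _; first by rewrite lee_fin.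
  rewrite muleC -ge0_integralZl//; last 3 first.
  - apply/measurable_EFinP; apply: measurable_funM => //.
    by apply: measurable_funD; exact: measurable_source_modulus.
  - move=> y _; rewrite lee_fin mulr_ge0 ?mollifier_tensor_ge0//.
    by rewrite addr_ge0// source_modulus_ge0.
  - by rewrite lee_fin.
  rewrite le_eqVlt; apply/orP; left; apply/eqP; apply: eq_integral => y _.
  by rewrite /G /= -EFinM -EFinD; congr (_%:E); ring.
rewrite ge0_integralD//; last 4 first.
- by move=> x _; exact: integral_ge0.
- exact: (measurable_fun_fubini_tonelli_F _ (mG c1 S1 BS1) (G0 c1 S1)).
- by move=> x _; exact: integral_ge0.
- exact: (measurable_fun_fubini_tonelli_F _ (mG c2 S2 BS2) (G0 c2 S2)).
rewrite ge0_muleDr ?B_norm_ge0//; apply: leeD.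
  exact: (source_coupling_le e0 BS1 h0 he K0 mA A0 (AK c1)).
exact: (source_coupling_le e0 BS2 h0 he K0 mA A0 (AK c2)).
Qed.

End two_sources.

(** * The uniform estimate *)

Lemma square_integrable_amplitude (R : realType) (a b : mR3 R -> R)
    (da db : 'I_3 -> mR3 R -> R) (dda ddb : 'I_3 -> 'I_3 -> mR3 R -> R) (l : R) :
  regular a da dda -> regular b db ddb -> square_integrable (amplitude a b da db l).
Proof.
move=> ra rb.
have pair (u v : mR3 R -> R) : square_integrable u -> square_integrable v ->
    square_integrable (fun x => `|u x| + `|v x|).
  by move=> su sv; exact: (square_integrableD (square_integrable_abs su) (square_integrable_abs sv)).
have s j := pair _ _ (reg_dsq ra j) (reg_dsq rb j).
have s3 := square_integrableD (s ord0) (square_integrableD (s (lift ord0 ord0))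
  (s (lift ord0 (lift ord0 ord0)))).
have := square_integrableD s3 (square_integrableZ l (pair _ _ (reg_sq ra) (reg_sq rb))).
congr square_integrable; apply/funext => x.
by rewrite /amplitude !big_ord_recl big_ord0 addr0.
Qed.

Lemma le_of_le_sqrt (R : realType) (N l B : R) : 0 <= N -> 0 <= l -> 0 <= B ->
  N <= 2 * Num.sqrt (112 * N) * l * B -> N <= 448 * l ^+ 2 * B ^+ 2.
Proof.
move=> N0 l0 B0 NB.
have K0 : 0 <= 112 * N by apply: mulr_ge0; first exact: ler0n.
have [N00|Nn0] := eqVneq N 0.
  rewrite N00; apply: mulr_ge0; last exact: sqr_ge0.
  by apply: mulr_ge0; [exact: ler0n|exact: sqr_ge0].
have Np : 0 < N by rewrite lt0r Nn0.
have h2 : N ^+ 2 <= (2 * Num.sqrt (112 * N) * l * B) ^+ 2.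
  have X0 : 0 <= 2 * Num.sqrt (112 * N) * l * B.
    exact: (mulr_ge0 (mulr_ge0 (mulr_ge0 (ler0n _ 2) (sqrtr_ge0 _)) l0) B0).
  exact: (lerXn2r 2 N0 X0 NB).
rewrite -(ler_pM2l Np) -expr2; apply: le_trans h2 _.
rewrite !exprMn sqr_sqrtr// le_eqVlt; apply/orP; left; apply/eqP; ring.
Qed.

Section a_priori_bound.
Context {R : realType}.
Local Notation mu := (lebesgue3 R).
Variables (a b p q : mR3 R -> R) (da db : 'I_3 -> mR3 R -> R) (dda ddb : 'I_3 -> 'I_3 -> mR3 R -> R).
Variables (e m B : R).
Local Notation l := (e^-1).
Hypothesis ra : regular a da dda.
Hypothesis rb : regular b db ddb.
Hypothesis sp : square_integrable p.
Hypothesis sq : square_integrable q.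
Hypothesis e0 : 0 < e.
Hypothesis e1 : e <= 1.
Hypothesis m0 : 0 < m.
Hypothesis B0 : 0 <= B.
Hypothesis eqa : forall x, \sum_(i < 3) dda i i x + l ^+ 2 * a x + m * b x = p x.
Hypothesis eqb : forall x, \sum_(i < 3) ddb i i x + l ^+ 2 * b x - m * a x = q x.
Local Notation A := (amplitude a b da db l).
Local Notation cpl := (coupling a b da db p q l).
Hypothesis coupling_le : forall K : R, 0 <= K ->
  (forall c (r : R), e <= r ->
    (\int[mu]_(x in ball3 c r) (A x ^+ 2)%:E <= (K * r)%:E)%E) ->
  (\int[mu]_x (cpl x)%:E <= (2 * Num.sqrt K * l * B)%:E)%E.
Hypothesis source_le : (\int[mu]_x (p x ^+ 2 + q x ^+ 2)%:E <= (2 * e ^- 3 * B ^+ 2)%:E)%E.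
Let mp : measurable_fun setT p := sp.1.
Let mq : measurable_fun setT q := sq.1.
Let ma : measurable_fun setT a := (reg_sq ra).1.
Let mb : measurable_fun setT b := (reg_sq rb).1.
Let sA : square_integrable A := square_integrable_amplitude l ra rb.
Let l0 : 0 < l. Proof. by rewrite invr_gt0. Qed.

Let cpl_fin : (\int[mu]_x (cpl x)%:E)%E \is a fin_num.
Proof.
apply: integrable_fin_num => //; apply: integrable_mul_sqr => //.
exact: (square_integrableD (square_integrable_abs sp) (square_integrable_abs sq)).
Qed.

Let ball_energy r := (\int[mu]_(x in [set x : mR3 R | euclid3 x < r]%R) (a x ^+ 2 + b x ^+ 2)%:E)%E.

(* The coupling N controls the energy on all balls, hence A ^ 2, hence itself through
   N <= C N ^ (1/2); then 14 * 448 = 6272. *)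
Let weak_damping (r : R) : m <= l ^+ 2 -> e <= r ->
  (ball_energy r <= (6272 * r * B ^+ 2)%:E)%E.
Proof.
move=> ml er.
have [N NE] : exists N, (\int[mu]_x (cpl x)%:E = N%:E)%E.
  by exists (fine (\int[mu]_x (cpl x)%:E)%E); rewrite fineK.
have N0 : 0 <= N.
  by rewrite -lee_fin -NE; apply: integral_ge0 => x _; rewrite lee_fin coupling_ge0.
have r0 : 0 < r by apply: lt_le_trans er.
have en c t : e <= t ->
    (\int[mu]_(x in ball3 c t) (energy_density a b da db l x)%:E <= (14 * t * N)%:E)%E.
  move=> et; have lt : l^-1 <= t by rewrite invrK.
  have := local_energy ra rb mp mq l0 m0 eqa eqb ml c lt.
  by rewrite NE -EFinM.
have me := measurable_energy_density ra rb l.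
have en0 x := energy_density_ge0 a b da db l x.
have AK c t : e <= t -> (\int[mu]_(x in ball3 c t) (A x ^+ 2)%:E <= (112 * N * t)%:E)%E.
  move=> et; have -> : 112 * N * t = 8 * (14 * t * N) by ring.
  rewrite (EFinM 8); apply: le_trans (lee_wpmul2l _ (en c t et)); last by rewrite lee_fin.
  apply: (ge0_le_integral_lin1 _ (measurable_ball3 c t)) => //.
  - by apply: measurable_funTS; apply: measurable_funX; exact: sA.1.
  - exact: measurable_funTS.
  - by move=> x; exact: sqr_ge0.
  - by move=> x _; exact: sqr_amplitude_le.
have K0 : 0 <= 112 * N by apply: mulr_ge0; first exact: ler0n.
have NB := coupling_le K0 AK.
have {}NB : N <= 2 * Num.sqrt (112 * N) / e * B by rewrite -lee_fin -NE.
have N2 : N <= 448 * l ^+ 2 * B ^+ 2 by exact: le_of_le_sqrt N0 (ltW l0) B0 NB.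
have E0 : [set x : mR3 R | euclid3 x < r] = ball3 0 r.
  have c00 j : coord j (0 : R * R * R) = 0 by rewrite -(scale0r (0 : R * R * R)) coordZ mul0r.
  apply/seteqP; split => x; rewrite /ball3 /= euclid3_lt ?(ltW r0)//;
  by under [X in is_true (X < _) -> _]eq_bigr do rewrite ?c00 ?subr0;
     under [X in _ -> is_true (X < _)]eq_bigr do rewrite ?c00 ?subr0.
have l20 : 0 < l ^+ 2 by rewrite exprn_gt0.
have : ((l ^+ 2)%:E * ball_energy r <= (l ^+ 2)%:E * (6272 * r * B ^+ 2)%:E)%E; last first.
  by rewrite lee_pmul2l.
have mball := measurable_ball3 0 r.
rewrite /ball_energy E0 -ge0_integralZl//; last 3 first.
- apply: measurable_funTS; apply/measurable_EFinP.
  by apply: measurable_funD; exact: measurable_funX.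
- by move=> x _; rewrite lee_fin addr_ge0 ?sqr_ge0.
- by rewrite lee_fin ltW.
apply: (@le_trans _ _ (14 * r * N)%:E).
  apply: le_trans (en 0 r er); apply: ge0_le_integral => //.
  - by move=> x _; rewrite lee_fin mulr_ge0 ?(ltW l20)// addr_ge0 ?sqr_ge0.
  - apply: measurable_funTS; apply: measurable_funeM; apply/measurable_EFinP.
    by apply: measurable_funD; exact: measurable_funX.
  - by apply: measurable_funTS; apply/measurable_EFinP.
  - move=> x _; rewrite -EFinM lee_fin /energy_density lerDr.
    by apply: sumr_ge0 => j _; rewrite addr_ge0 ?sqr_ge0.
rewrite -EFinM lee_fin.
have -> : l ^+ 2 * (6272 * r * B ^+ 2) = 14 * r * (448 * l ^+ 2 * B ^+ 2) by ring.
by rewrite ler_wpM2l// mulr_ge0// ltW.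
Qed.

(* Here m ^ 2 >= l ^ 4 >= l ^ 3, so that the L2 norm of the sources is enough. *)
Let strong_damping (r : R) : l ^+ 2 <= m -> 1 <= r ->
  (ball_energy r <= (6272 * r * B ^+ 2)%:E)%E.
Proof.
move=> lm r1.
have mab : measurable_fun setT (fun x => (a x ^+ 2 + b x ^+ 2)%:E).
  by apply/measurable_EFinP; apply: measurable_funD; exact: measurable_funX.
have mpq : measurable_fun setT (fun x => (p x ^+ 2 + q x ^+ 2)%:E).
  by apply/measurable_EFinP; apply: measurable_funD; exact: measurable_funX.
have := damped_energy ra rb mp mq m0 eqa eqb.
under eq_integral do rewrite EFinM.
under [X in (_ <= X)%E -> _]eq_integral do rewrite EFinM.
rewrite !ge0_integralZl//; last 4 first.
- by move=> x _; rewrite lee_fin addr_ge0 ?sqr_ge0.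
- by rewrite lee_fin invr_ge0 ltW.
- by move=> x _; rewrite lee_fin addr_ge0 ?sqr_ge0.
- by rewrite lee_fin ltW.
move=> ab.
have {}ab : (m%:E * \int[mu]_x (a x ^+ 2 + b x ^+ 2)%:E <= m%:E * (6272 * r * B ^+ 2)%:E)%E.
  apply: le_trans ab _.
  apply: (@le_trans _ _ (m^-1%:E * (2 * e ^- 3 * B ^+ 2)%:E)%E).
    by apply: lee_wpmul2l => //; rewrite lee_fin invr_ge0 ltW.
  rewrite -!EFinM lee_fin mulrC ler_pdivrMr//.
  have lm2 : l ^+ 2 * l ^+ 2 <= m * m by rewrite ler_pM ?sqr_ge0.
  have l31 : l ^+ 3 <= l ^+ 2 * l ^+ 2.
    by rewrite -exprD ler_weXn2l// invf_cp1// e1.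
  have -> : m * (6272 * r * B ^+ 2) * m = 6272 * r * (m * m) * B ^+ 2 by ring.
  apply: ler_wpM2r; first exact: sqr_ge0.
  rewrite -exprVn; have mm : 0 <= m * m by rewrite mulr_ge0 ?(ltW m0).
  have : m * m <= r * (m * m) by rewrite ler_peMl.
  by lra.
apply: (@le_trans _ _ (\int[mu]_x (a x ^+ 2 + b x ^+ 2)%:E)%E).
  apply: ge0_subset_integral => //.
  - exact: measurable_euclid3_lt.
  - by move=> x _; rewrite lee_fin addr_ge0 ?sqr_ge0.
by move: ab; rewrite lee_pmul2l// lte_fin.
Qed.

(** The threshold m = l ^ 2 corresponds to damping of size alpha = 1 / e. *)
Lemma a_priori_bound (r : R) : 1 <= r -> (ball_energy r <= (6272 * r * B ^+ 2)%:E)%E.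
Proof.
move=> r1; have [ml|/ltW lm] := leP m (l ^+ 2).
  by apply: weak_damping => //; exact: le_trans e1 r1.
exact: strong_damping.
Qed.

End a_priori_bound.

Section helmholtz_estimate.
Context {R : realType}.
Local Notation mu := (lebesgue3 R).
Variables (e al : R) (c1 c2 : R * R * R) (S1 S2 u : mR3 R -> R[i]).
Hypothesis e0 : 0 < e.
Hypothesis e1 : e <= 1.
Hypothesis al0 : 0 < al.
Hypothesis BS1 : in_B S1.
Hypothesis BS2 : in_B S2.
Hypothesis L2u : in_L2 u.
Hypothesis sol : helmholtz_sol e al u (two_sources e c1 c2 S1 S2).
Local Notation F := (two_sources e c1 c2 S1 S2).
Let ur (x : mR3 R) := complex.Re (u x).
Let ui (x : mR3 R) := complex.Im (u x).
Let fr (x : mR3 R) := complex.Re (F x).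
Let fi (x : mR3 R) := complex.Im (F x).
Let B : R := fine (B_norm S1 + B_norm S2)%E.

Let BE : (B_norm S1 + B_norm S2 = B%:E)%E.
Proof.
rewrite /B fineK// fin_numD.
by rewrite !ge0_fin_numE ?B_norm_ge0// BS1.2 BS2.2.
Qed.

Let B0 : 0 <= B.
Proof. by apply: fine_ge0; rewrite adde_ge0// B_norm_ge0. Qed.

Let sur : square_integrable ur := (in_L2_square_integrable L2u).1.
Let sui : square_integrable ui := (in_L2_square_integrable L2u).2.
Let sfr : square_integrable fr := (in_L2_square_integrable (in_L2_two_sources c1 c2 e0 BS1 BS2)).1.
Let sfi : square_integrable fi := (in_L2_square_integrable (in_L2_two_sources c1 c2 e0 BS1 BS2)).2.

Lemma mollified_ball_energy_le (h r : R) : 0 < h -> 2 * h <= e -> 1 <= r ->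
  (\int[mu]_(x in [set x : mR3 R | euclid3 x < r]%R)
     (conv ur (fun=> mollifier h) x ^+ 2 + conv ui (fun=> mollifier h) x ^+ 2)%:E
   <= (6272 * r * B ^+ 2)%:E)%E.
Proof.
move=> h0 he r1; have kg := @mollifier_kernel R h h0.
have ra := conv_regular kg sur; have rb := conv_regular kg sui.
have m0 : 0 < al / e by rewrite divr_gt0.
have eqs x := mollified_helmholtz sur sui sol x kg.
have sp := conv_square_integrable kg sfr; have sq := conv_square_integrable kg sfi.
apply: (a_priori_bound ra rb sp sq e0 e1 m0 B0 (fun x => (eqs x).1) (fun x => (eqs x).2)) => //.
- move=> K K0 AK; rewrite EFinM -BE.
  have mA := (square_integrable_amplitude e^-1 ra rb).1.
  have l0 : 0 < e^-1 by rewrite invr_gt0.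
  have A0 := amplitude_ge0 (conv ur (fun=> mollifier h)) (conv ui (fun=> mollifier h))
    (fun i => conv ur (derive_factor i (fun=> mollifier h)))
    (fun i => conv ui (derive_factor i (fun=> mollifier h))) l0.
  exact: (@two_sources_coupling_le R e c1 c2 S1 S2 e0 BS1 BS2 h h0 K _ he K0 mA A0 AK).
- have T1 : (\int[mu]_z `|tensor (fun=> mollifier h) z|%:E <= 1%:E)%E.
    under eq_integral do rewrite ger0_norm ?mollifier_tensor_ge0//.
    by rewrite integral_mollifier_tensor.
  have := integral_sqr_conv_le kg ltr01 T1 sfr; have := integral_sqr_conv_le kg ltr01 T1 sfi.
  rewrite expr1n !mul1e => hq hp.
  have m2 (v : mR3 R -> R) : square_integrable v -> measurable_fun setT (fun x => (v x ^+ 2)%:E).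
    by move=> sv; apply: measurable_sqr; exact: sv.1.
  have z2 (v : mR3 R -> R) (x : mR3 R) : (0 <= (v x ^+ 2)%:E)%E by rewrite lee_fin sqr_ge0.
  have iD (v w : mR3 R -> R) : square_integrable v -> square_integrable w ->
    (\int[mu]_x (v x ^+ 2 + w x ^+ 2)%:E = \int[mu]_x (v x ^+ 2)%:E + \int[mu]_x (w x ^+ 2)%:E)%E.
    move=> sv sw; under eq_integral do rewrite EFinD.
    by rewrite ge0_integralD//; [exact: m2|exact: m2].
  rewrite iD//; apply: le_trans (leeD hp hq) _; rewrite -iD//.
  have := integral_sqr_two_sources_le c1 c2 e0 BS1 BS2.
  rewrite BE -!EFinM expr2 !mulrA; apply: le_trans.
  by rewrite le_eqVlt; apply/orP; left; apply/eqP; apply: eq_integral => x _; rewrite sqr_normc.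
Qed.

(** The mollification parameter tends to 0; the factor 2 is lost in
    |u| ^ 2 <= 2 |Tu| ^ 2 + 2 |Tu - u| ^ 2. *)
Lemma ball_energy_le (r : R) : 1 <= r ->
  (\int[mu]_(x in [set x : mR3 R | euclid3 x < r]%R) (normc (u x) ^+ 2)%:E <=
   (12544 * r * B ^+ 2)%:E)%E.
Proof.
move=> r1; set D := [set x : mR3 R | (euclid3 x < r)%R].
have mD : measurable D by exact: measurable_euclid3_lt.
pose h n : R := e / 2 * n.+1%:R^-1.
have h0 n : 0 < h n by rewrite mulr_gt0 ?divr_gt0.
have he n : 2 * h n <= e.
  rewrite /h mulrA mulrCA divff// mulr1 ler_piMr ?(ltW e0)//.
  by rewrite invf_le1// ler1n.
have hcvg : h @ \oo --> (0 : R).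
  rewrite -(mulr0 (e / 2)); apply: cvgM; first exact: cvg_cst.
  exact: cvg_harmonic.
apply/lee_addgt0Pr => d d0.
have d4 : 0 < d / 4 by rewrite divr_gt0.
have nr := mollifier_cvg sur h0 hcvg d4; have ni := mollifier_cvg sui h0 hcvg d4.
near \oo => n.
have hr : (\int[mu]_x ((conv ur (fun=> mollifier (h n)) x - ur x) ^+ 2)%:E <= (d / 4)%:E)%E.
  by near: n; exact: nr.
have hi : (\int[mu]_x ((conv ui (fun=> mollifier (h n)) x - ui x) ^+ 2)%:E <= (d / 4)%:E)%E.
  by near: n; exact: ni.
have kg := @mollifier_kernel R (h n) (h0 n).
have mTr := conv_measurable kg sur.1; have mTi := conv_measurable kg sui.1.
set Tr := conv ur _ in hr mTr *; set Ti := conv ui _ in hi mTi *.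
have md (f g : mR3 R -> R) : measurable_fun setT f -> measurable_fun setT g ->
    measurable_fun setT (fun x => (f x - g x) ^+ 2).
  by move=> mf mg; apply: measurable_funX; exact: measurable_funB.
have mr := md _ _ mTr sur.1; have mi := md _ _ mTi sui.1.
have sub (f : mR3 R -> R) : measurable_fun setT f -> (forall x, 0 <= f x) ->
    (\int[mu]_x (f x)%:E <= (d / 4)%:E)%E -> (\int[mu]_(x in D) (f x)%:E <= (d / 4)%:E)%E.
  move=> mf f0; apply: le_trans; apply: ge0_subset_integral => //.
    exact/measurable_EFinP.
  by move=> x _; rewrite lee_fin.
have := mollified_ball_energy_le (h0 n) (he n) r1; rewrite -/Tr -/Ti -/D => hT.
have s0 (f g : mR3 R -> R) x : 0 <= (f x - g x) ^+ 2 by exact: sqr_ge0.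
apply: (@le_trans _ _ (2%:E * \int[mu]_(x in D) (Tr x ^+ 2 + Ti x ^+ 2)%:E
  + 2%:E * \int[mu]_(x in D) ((Tr x - ur x) ^+ 2)%:E
  + 2%:E * \int[mu]_(x in D) ((Ti x - ui x) ^+ 2)%:E)%E).
  apply: ge0_le_integral_lin3; rewrite ?ler0n//.
  - by apply: measurable_funTS; apply/measurable_EFinP; exact: measurable_sqr_normc L2u.1.
  - by apply: measurable_funTS; apply: measurable_funD; exact: measurable_funX.
  - exact: measurable_funTS.
  - exact: measurable_funTS.
  - by move=> x; exact: sqr_ge0.
  - by move=> x; rewrite addr_ge0 ?sqr_ge0.
  - move=> x _; rewrite sqr_normc -/(ur x) -/(ui x).
    by have := sqr_ge0 (2 * Tr x - ur x); have := sqr_ge0 (2 * Ti x - ui x); lra.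
have -> : ((12544 * r * B ^+ 2)%:E + d%:E = 2%:E * (6272 * r * B ^+ 2)%:E +
   2%:E * (d / 4)%:E + 2%:E * (d / 4)%:E)%E.
  by rewrite -!EFinM -!EFinD; congr (_%:E); field.
apply: leeD; [apply: leeD|]; apply: lee_wpmul2l => //; exact: sub.
Unshelve. all: by end_near. Qed.

Lemma helmholtz_Bstar_estimate : (Bstar_norm u <= 224%:E * (B_norm S1 + B_norm S2))%E.
Proof.
(* 112 ^ 2 = 12544 *)
have E1 : 224 * B = 2 * (112 * B) by ring.
rewrite BE -EFinM E1; apply: le_Bstar_norm.
- exact: (mulr_ge0 (ler0n _ 112) B0).
- move=> k; have k1 : 1 <= 2 ^+ k :> R by rewrite exprn_ege1// ler1n.
  have := ball_energy_le k1.
  have E2 : 12544 * 2 ^+ k * B ^+ 2 = 2 ^+ k * (112 * B) ^+ 2 by ring.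
  by rewrite E2.
- exact: L2u.1.
Qed.

End helmholtz_estimate.

Local Open Scope complex_scope.

Theorem proposition3p1 (R : realType) (q1 : R * R * R) (hq1 : q1 != 0)
    (alpha : R -> R)
    (alpha_gt0 : forall e : R, 0 < e <= 1 -> 0 < alpha e)
    (alpha_cvg0 : alpha e @[e --> 0^'+] --> 0) :
  exists C : R,
    forall S0 S1 : R * R * R -> R[i], in_B S0 -> in_B S1 ->
    forall e : R, 0 < e <= 1 ->
    forall u : R * R * R -> R[i], in_L2 u ->
    helmholtz_sol e (alpha e) u
      (fun x => (e ^- 3)%:C * S0 (e^-1 *: x)
              + (e ^- 3)%:C * S1 (e^-1 *: (x - q1))) ->
    (Bstar_norm u <= C%:E * (B_norm S0 + B_norm S1))%E.
Proof.
exists 224 => S0 S1 B0 B1 e e01 u L2u sol.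
have /andP[e0 e1] := e01.
apply: (@helmholtz_Bstar_estimate R e (alpha e) 0 q1 S0 S1 u e0 e1 (alpha_gt0 _ e01) B0 B1 L2u).
rewrite (_ : two_sources e 0 q1 S0 S1 = (fun x => (e ^- 3)%:C * S0 (e^-1 *: x)
              + (e ^- 3)%:C * S1 (e^-1 *: (x - q1))))//.
by apply/funext => x; rewrite /two_sources /rescale subr0.
Qed.
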